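(* Let $0<\alpha<4$ and let $(a_{ij})_{1\le i\le j}$ be i.i.d. real random variables with $\bar F(x)=1-F(x)=\mathbb{P}(|a_{ij}|>x)=L(x)x^{-\alpha}$ for $x>0$, where $L$ is slowly varying at infinity. If $2\le\alpha<4$, assume in addition that $\mathbb{E}(a_{ij})=0$. Let $A_n$ be the $n\times n$ real symmetric random matrix whose entries on and above the diagonal are $a_{ij}$, $1\le i\le j\le n$, let $\lambda_1\ge\dots\ge\lambda_n$ be its eigenvalues, and let $b_n=\inf\{x: 1-F(x)\le \frac{2}{n(n+1)}\}$. Then the point process $$\mathcal{P}_n=\sum_{i=1}^n \delta_{b_n^{-1}\lambda_i}\mathbf{1}_{\lambda_i>0}$$ on $(0,\infty)$ converges in distribution, as $n\to\infty$, to the Poisson point process $\mathcal{P}$ on $(0,\infty)$ with intensity $\rho(x)=\frac{\alpha}{x^{1+\alpha}}$.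
   Context: A function $L$ is slowly varying if $\lim_{x\to\infty}L(tx)/L(x)=1$ for all $t>0$. $F$ denotes the distribution function of $|a_{ij}|$. *)

(* Defs.v *)
From HB Require Import structures.
From mathcomp Require Import all_boot all_order all_algebra.
From mathcomp Require Import all_classical all_reals all_analysis measurable_realfun.

Set Implicit Arguments.
Unset Strict Implicit.
Unset Printing Implicit Defensive.

Import Order.TTheory GRing.Theory Num.Theory.
Import numFieldNormedType.Exports.

Local Open Scope classical_set_scope.
Local Open Scope ring_scope.

Definition slowly_varying (R : realType) (L : R -> R) : Prop :=
  forall t : R, 0 < t -> L (t * x) / L x @[x --> +oo] --> (1 : R).

(* Mutual independence of the family (X i)_(i in D): product rule over every
   finite subfamily. *)
Definition mutually_independent (R : realType) (d : measure_display)
    (T : measurableType d) (P : probability T R) (d' : measure_display)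
    (S : measurableType d') (I : choiceType) (D : set I) (X : I -> T -> S) :
    Prop :=
  forall (J : seq I) (B : I -> set S), uniq J -> (forall i, i \in J -> D i) ->
    (forall i, measurable (B i)) ->
    P (\bigcap_(i in [set` J]) X i @^-1` B i) =
    (\big[*%E/1%E]_(i <- J) P (X i @^-1` B i))%E.

(* The i.i.d. array (a_ij)_(i <= j); the values of a below the diagonal are
   irrelevant, and indices start at 0. *)
Definition iid_upper (R : realType) (d : measure_display)
    (T : measurableType d) (P : probability T R)
    (a : nat -> nat -> {RV P >-> R}) : Prop :=
  mutually_independent P [set p : nat * nat | (p.1 <= p.2)%N]
    (fun p => a p.1 p.2 : T -> R) /\
  forall i j : nat, (i <= j)%N -> forall B : set R, measurable B ->
    distribution P (a i j) B = distribution P (a 0%N 0%N) B.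

Definition sym_mx (R : realType) (T : Type) (a : nat -> nat -> T -> R)
    (n : nat) (w : T) : 'M[R]_n :=
  \matrix_(i < n, j < n) a (minn i j) (maxn i j) w.

Definition ordered_eigenvalues (R : realType) (n : nat) (A : 'M[R]_n)
    (l : n.-tuple R) : Prop :=
  sorted >=%R l /\ char_poly A = \prod_(x <- l) ('X - x%:P).

Definition abs_cdf (R : realType) (d : measure_display) (T : measurableType d)
    (P : probability T R) (X : T -> R) (x : R) : R :=
  fine (P [set w | `|X w| <= x]).

Definition normalization (R : realType) (F : R -> R) (n : nat) : R :=
  inf [set x : R | 1 - F x <= 2 / (n * n.+1)%:R].

(* Point measures on (0, +oo), i.e. integer-valued measures that are finite on
   compact subsets of (0, +oo), encoded as measures on R not charging
   (-oo, 0]. *)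
Record pointMeasure (R : realType) := PointMeasure {
  pm_measure :> {measure set (measurableTypeR R) -> \bar R} ;
  pm_neg : pm_measure `]-oo, 0]%classic = 0%E ;
  pm_int : forall (a b : R) (B : set (measurableTypeR R)), 0 < a ->
    measurable B -> B `<=` `[a, b]%classic ->
    exists k : nat, pm_measure B = (k%:R)%:E }.

(* C_c((0, +oo)), each function being extended by 0 to R. *)
Record testFun (R : realType) := TestFun {
  tf_fun :> R -> R ;
  tf_cont : continuous tf_fun ;
  tf_supp : exists K : set R, [/\ compact K, K `<=` `]0, +oo[%classic &
    forall x, ~ K x -> tf_fun x = 0] }.

HB.instance Definition _ (R : realType) := gen_eqMixin (testFun R).
HB.instance Definition _ (R : realType) := gen_choiceMixin (testFun R).

Definition pm_int_test (R : realType) (mu : pointMeasure R) :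
    {ptws testFun R -> R} :=
  fun f => (\int[pm_measure mu]_x (f x))%R.

HB.instance Definition _ (R : realType) := gen_eqMixin (pointMeasure R).
HB.instance Definition _ (R : realType) := gen_choiceMixin (pointMeasure R).

(* The vague topology: the coarsest one making all mu |-> \int f dmu,
   f in C_c((0, +oo)), continuous. *)
HB.instance Definition _ (R : realType) :=
  Topological.copy (pointMeasure R) (initial_topology (@pm_int_test R)).

Definition point_process (R : realType) (d : measure_display)
    (T : measurableType d) (N : T -> pointMeasure R) : Prop :=
  forall B : set (measurableTypeR R), measurable B ->
    measurable_fun [set: T] (fun w => N w B).

(* Weak convergence of the laws on the space of point measures with the vague
   topology. *)
Definition converges_in_distribution (R : realType)
    (d : measure_display) (T : measurableType d) (P : probability T R)
    (Ns : nat -> T -> pointMeasure R)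
    (d' : measure_display) (T' : measurableType d') (P' : probability T' R)
    (N : T' -> pointMeasure R) : Prop :=
  [/\ forall n, point_process (Ns n), point_process N &
    forall Phi : pointMeasure R -> R, continuous Phi ->
      (exists M : R, forall mu, `|Phi mu| <= M) ->
      ('E_P[Phi \o Ns n] @[n --> \oo] --> 'E_P'[Phi \o N])%E].

Definition intensity (R : realType) (rho : R -> R)
    (B : set (measurableTypeR R)) : \bar R :=
  (\int[@lebesgue_measure R]_(x in B) (rho x)%:E)%E.

(* The Poisson probabilities are written out because the library's poisson_pmf
   is constantly 1 at rate 0. *)
Definition Poisson_point_process (R : realType) (d : measure_display)
    (T : measurableType d) (P : probability T R) (N : T -> pointMeasure R)
    (rho : R -> R) : Prop :=
  [/\ point_process N,
    forall (B : set (measurableTypeR R)) (r : R), measurable B ->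
      B `<=` `]0, +oo[%classic -> intensity rho B = r%:E ->
      forall k : nat, P [set w | N w B = (k%:R)%:E] =
        (r ^+ k / k`!%:R * expR (- r))%:E,
    forall B : set (measurableTypeR R), measurable B -> B `<=` `]0, +oo[%classic ->
      intensity rho B = +oo%E -> P [set w | N w B = +oo%E] = 1%E &
    forall (m : nat) (B : 'I_m -> set (measurableTypeR R)),
      (forall i, measurable (B i)) -> (forall i, B i `<=` `]0, +oo[%classic) ->
      trivIset [set: 'I_m] B ->
      mutually_independent P [set: 'I_m] (fun i w => N w (B i))].

Definition atom_if_pos (R : realType) (b x : R) :
    {measure set (measurableTypeR R) -> \bar R} :=
  if 0 < x then [the measure _ _ of \d_(b^-1 * x : measurableTypeR R)]
  else [the measure _ _ of mzero].

Lemma measurable_pos_half_line (R : realType) :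
  measurable (`]0, +oo[%classic : set (measurableTypeR R)).
Proof. exact: measurable_itv. Qed.

(* sum_i delta_(b^-1 l_i) 1_(l_i > 0) as a measure on (0, +oo). If b > 0 then
   the restriction has no effect; the normalization b_n is positive for all but
   finitely many n. *)
Definition eig_measure (R : realType) (b : R) (l : seq R) :
    {measure set (measurableTypeR R) -> \bar R} :=
  mrestr (msum (fun i => atom_if_pos b l`_i) (size l))
    (@measurable_pos_half_line R).

Lemma eig_measure_neg (R : realType) (b : R) (l : seq R) :
  eig_measure b l `]-oo, 0]%classic = 0%E.
Proof.
rewrite /eig_measure /= /mrestr (_ : _ `&` _ = set0) ?measure0//.
apply/seteqP; split=> x //=; rewrite !in_itv/= andbT => -[x0].
by rewrite ltNge x0.
Qed.

Lemma eig_measure_int (R : realType) (b : R) (l : seq R) (u v : R)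
    (B : set (measurableTypeR R)) : 0 < u -> measurable B ->
  B `<=` `[u, v]%classic -> exists k : nat, eig_measure b l B = (k%:R)%:E.
Proof.
move=> _ _ _; rewrite /eig_measure /= /mrestr /msum /=.
elim: (size l) => [|m [k IH]]; first by exists 0%N; rewrite big_ord0.
rewrite big_ord_recr /= IH /atom_if_pos; case: ifPn => _.
  rewrite /= /dirac indicE; by rewrite -EFinD -natrD; eexists.
by exists k; rewrite /= /mzero adde0.
Qed.

Definition eig_process (R : realType) (b : R) (l : seq R) : pointMeasure R :=
  PointMeasure (@eig_measure_neg R b l) (@eig_measure_int R b l).

(* Main.v *)
(* Scale x_n = b_n n^(-1/(4 alpha)), slightly below b_n. With high probability no
   row of A_n contains two entries larger than x_n and none of these lies on the
   diagonal, so the large entries form disjoint 2 x 2 blocks with eigenvalues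
   +-|a_ij|. The quadratic form of the remaining matrix S is o(b_n) |v|^2: for
   alpha < 2 by its Frobenius norm, for alpha >= 2 because the mean matrix is
   small and so is E tr Z^q, a sum over closed walks, for the centred part Z and q
   large. Hence there are as many eigenvalues above t b_n as entries |a_ij|, i < j,
   above t b_n, up to a small shift of t, and with high probability no entry falls
   into the gaps so created.

   The probability that no rescaled entry falls into a finite union of intervals
   is (1 - p)^(n (n - 1) / 2) -> exp (- mu); by inclusion-exclusion, and as fine
   cells rarely contain two points, the joint laws of the numbers of points in
   rays ]t, +oo[ converge to those of the Poisson process.

   This suffices for convergence in distribution: for a null sequence c, the map
   sending z to the point measure sum_j delta_(min (z_j, c_j)) is continuous for
   the product topology, so a continuous functional of it is uniformly continuous
   on the compact box prod_j [0, c_j]. With high probability, for both processes,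
   the j-th largest atom is at most c_j, and the ray counts locate the first m
   atoms up to a small error. *)

Require Import Defs.
From mathcomp Require Import all_boot all_order all_algebra.
From mathcomp Require Import all_classical all_reals all_analysis measurable_realfun.
From mathcomp Require Import ring lra zify.

Set Implicit Arguments.
Unset Strict Implicit.
Unset Printing Implicit Defensive.

Import Order.TTheory GRing.Theory Num.Theory.
Import numFieldNormedType.Exports.

Local Open Scope ring_scope.

(** * Real symmetric matrices *)

(** The exponents behind the overview, up to small powers of [n]: [b_n] is [n ^ (2 / alpha)] and a
    truncated entry has second moment [x_n ^ (2 - alpha)] if [alpha < 2], and 1 if [alpha >= 2]. The
    Frobenius norm requires [n ^ 2] second moments to be [o(b_n ^ 2)]. For [alpha < 2] this holds
    thanks to the gap between [x_n] and [b_n]; for [alpha >= 2] it fails. The trace of a high power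
    requires only [n] second moments to be [o(b_n ^ 2)], that is [4 / alpha > 1]: this is the origin
    of the bound [alpha < 4].

    The scale [x_n] must be small against [b_n] by a power of [n], which is what a high trace power
    amplifies, yet so large that two large entries in a row are unlikely: [n ^ 3 * P(|a| > x_n) ^ 2]
    is about [n ^ (3 - 7 / 2)] for the exponent [1 / (4 alpha)].

    As [L] is controlled only up to small powers, every exponent carries a loss governed by a
    parameter [kap], chosen at the very end from the distance of [alpha] to 2 or to 4. *)

Section RealSymmetric.
Variable R : rcfType.

Definition dotv n (u v : 'rV[R]_n) : R := \sum_i u 0 i * v 0 i.

Lemma dotvE n (u v : 'rV[R]_n) : dotv u v = (u *m v^T) 0 0.
Proof. by rewrite mxE; apply: eq_bigr => i _; rewrite mxE. Qed.

Lemma mx11_dotv n (u v : 'rV[R]_n) : u *m v^T = (dotv u v)%:M.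
Proof. by rewrite dotvE -mx11_scalar. Qed.

Lemma dotvC n (u v : 'rV[R]_n) : dotv u v = dotv v u.
Proof. by apply: eq_bigr => i _; rewrite mulrC. Qed.

Lemma dotvDl n (u v w : 'rV[R]_n) : dotv (u + v) w = dotv u w + dotv v w.
Proof. by rewrite -big_split; apply: eq_bigr => i _; rewrite mxE mulrDl. Qed.

Lemma dotvZl n a (u v : 'rV[R]_n) : dotv (a *: u) v = a * dotv u v.
Proof. by rewrite mulr_sumr; apply: eq_bigr => i _; rewrite mxE mulrA. Qed.

Lemma dotvDr n (u v w : 'rV[R]_n) : dotv w (u + v) = dotv w u + dotv w v.
Proof. by rewrite dotvC dotvDl !(dotvC w). Qed.

Lemma dotvZr n a (u v : 'rV[R]_n) : dotv v (a *: u) = a * dotv v u.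
Proof. by rewrite dotvC dotvZl (dotvC v). Qed.

Lemma dotv_ge0 n (u : 'rV[R]_n) : 0 <= dotv u u.
Proof. by apply: sumr_ge0 => i _; rewrite -expr2 sqr_ge0. Qed.

Lemma dotv_eq0 n (u : 'rV[R]_n) : (dotv u u == 0) = (u == 0).
Proof.
apply/eqP/eqP => [|->]; last by rewrite /dotv big1// => i _; rewrite mxE mul0r.
move=> /psumr_eq0P => h; apply/rowP => i; rewrite mxE.
have := h (fun i _ => _) i isT; rewrite -expr2 => /(_ _)/eqP.
by rewrite sqrf_eq0 => e; apply/eqP/e => j; rewrite -expr2 sqr_ge0.
Qed.

Lemma dotv_gt0 n (u : 'rV[R]_n) : (0 < dotv u u) = (u != 0).
Proof. by rewrite lt_def dotv_ge0 andbT dotv_eq0. Qed.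

Lemma dotv_mull n m (u : 'rV[R]_n) (A : 'M[R]_(n, m)) (v : 'rV[R]_m) :
  dotv (u *m A) v = dotv u (v *m A^T).
Proof. by rewrite !dotvE trmx_mul trmxK mulmxA. Qed.

Lemma dotv_orth n m (Q : 'M[R]_(n, m)) (u v : 'rV[R]_n) : Q *m Q^T = 1%:M ->
  dotv (u *m Q) (v *m Q) = dotv u v.
Proof. by move=> QQ; rewrite dotv_mull -mulmxA QQ mulmx1. Qed.

Lemma cauchy_schwarz n (u v : 'rV[R]_n) :
  dotv u v ^+ 2 <= dotv u u * dotv v v.
Proof.
have [->|v0] := eqVneq v 0.
  by rewrite dotvC -(scale0r 0) !dotvZl !mul0r mulr0 expr0n.
have vv : 0 < dotv v v by rewrite dotv_gt0.
have := dotv_ge0 (dotv v v *: u - dotv u v *: v).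
rewrite -scaleNr !dotvDl !dotvDr !dotvZl !dotvZr (dotvC v u).
set a := dotv u u; set b := dotv u v; set c := dotv v v => h.
rewrite -subr_ge0 -(pmulr_rge0 _ vv); suff -> : dotv v v * (a * c - b ^+ 2) =
  c * (c * a) + c * (- b * b) + (- b * (c * b) + - b * (- b * c)) by [].
rewrite -/c; ring.
Qed.

(* [H = 1 - 2 w^T w / |w|^2] with [w = u - v] exchanges [u] and [v]. *)
Lemma householder n (u v : 'rV[R]_n) : dotv u u = 1 -> dotv v v = 1 ->
  exists H : 'M[R]_n, [/\ H^T = H, H *m H = 1%:M & u *m H = v].
Proof.
move=> u1 v1; have [<-|uv] := eqVneq u v.
  by exists 1%:M; rewrite trmx1 !mulmx1.
pose w : 'rV[R]_n := u - v; have w0 : dotv w w != 0 by rewrite dotv_eq0 subr_eq0.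
pose c := 2 / dotv w w.
have cw : c * dotv w w = 2 by rewrite divfK.
have wE : dotv w w = 2 - 2 * dotv u v.
  rewrite /w -scaleN1r !dotvDl !dotvDr !dotvZl !dotvZr (dotvC v u) u1 v1; ring.
exists (1%:M - c *: (w^T *m w)); split.
- by rewrite linearB/= linearZ/= trmx_mul trmxK trmx1.
- have PP : (w^T *m w) *m (w^T *m w) = dotv w w *: (w^T *m w).
    by rewrite mulmxA -(mulmxA w^T w) mx11_dotv mul_mx_scalar -scalemxAl.
  move: PP; set P := w^T *m w => PP.
  rewrite mulmxBl !mulmxBr !mul1mx !mulmx1 -!scalemxAl -!scalemxAr PP !scalerA.
  by rewrite -mulrA cw mulr_natr mulr2n scalerDl opprD opprK addKr subrK.
- rewrite mulmxBr mulmx1 -scalemxAr mulmxA mx11_dotv mul_scalar_mx scalerA.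
  suff -> : c * dotv u w = 1 by rewrite scale1r /w opprB addrC subrK.
  apply: (mulfI (_ : 2 != 0)); first by rewrite pnatr_eq0.
  rewrite mulr1 mulrCA -[RHS]cw; congr (_ * _).
  rewrite wE /w -scaleN1r dotvDr dotvZr u1; ring.
Qed.

Lemma char_poly_conj n (A P Q : 'M[R]_n) : P *m Q = 1%:M ->
  char_poly (P *m A *m Q) = char_poly A.
Proof.
move=> PQ; rewrite /char_poly /char_poly_mx !map_mxM.
have PQ' : map_mx polyC P *m map_mx polyC Q = 1%:M.
  by rewrite -map_mxM PQ map_mx1.
have -> : 'X%:M - map_mx polyC P *m map_mx polyC A *m map_mx polyC Q =
  map_mx polyC P *m ('X%:M - map_mx polyC A) *m map_mx polyC Q.
  by rewrite mulmxBr mulmxBl mul_mx_scalar -scalemxAl PQ' scalemx1.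
by rewrite !det_mulmx mulrAC -det_mulmx PQ' det1 mul1r.
Qed.

Lemma char_poly_block n (x : R) (B : 'M[R]_n) :
  char_poly (block_mx x%:M 0 0 B : 'M[R]_(1 + n)) = ('X - x%:P) * char_poly B.
Proof.
rewrite /char_poly /char_poly_mx map_block_mx !map_mx0 scalar_mx_block opp_block_mx.
by rewrite add_block_mx !oppr0 !addr0 det_ublock det_mx11 !mxE !mulr1n.
Qed.

(** The given splitting of [char_poly A] supplies the real eigenvalues. A reflection carries a unit
    eigenvector for the head of [l] to the first basis vector; symmetry clears the first column
    along with the first row, and the remaining block has the remaining factors. The order of [l] is
    preserved. *)
Theorem spectral_theorem n (A : 'M[R]_n) (l : seq R) : A^T = A -> size l = n ->
  char_poly A = \prod_(x <- l) ('X - x%:P) ->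
  exists Q : 'M[R]_n, Q *m Q^T = 1%:M /\ A = Q^T *m diag_mx (\row_i l`_i) *m Q.
Proof.
elim: n A l => [|n IHn] A [|x l]//=.
  by move=> _ _ _; exists 1%:M; rewrite trmx1 mulmx1; split => //; apply/matrixP => -[].
move=> AT [sl]; rewrite big_cons => cA.
have : eigenvalue A x.
  by rewrite eigenvalue_root_char cA rootM root_XsubC eqxx.
move=> /eigenvalueP [v vA v0].
have vv : 0 < dotv v v by rewrite dotv_gt0.
pose u := (Num.sqrt (dotv v v))^-1 *: v.
have u1 : dotv u u = 1.
  rewrite dotvZl dotvZr mulrA -expr2 exprVn sqr_sqrtr ?dotv_ge0// mulVf//.
  by rewrite gt_eqF.
pose e : 'rV[R]_n.+1 := delta_mx 0 0.
have e1 : dotv e e = 1.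
  rewrite /dotv (bigD1 0)//= !mxE !eqxx mulr1 big1 ?addr0// => i /negPf i0.
  by rewrite mxE eqxx i0 mul0r.
have [H [HT HH uH]] := householder u1 e1.
have uA : u *m A = x *: u by rewrite -scalemxAl vA scalerA mulrC -scalerA.
have [B defB] : exists B, B = H *m A *m H by eexists.
have BT : B^T = B by rewrite defB !trmx_mul HT AT mulmxA.
have eB : e *m B = x *: e.
  by rewrite -uH defB !mulmxA -[u *m H *m H]mulmxA HH mulmx1 uA -scalemxAl.
have B0 j : B 0 j = x *+ (j == 0).
  have := congr1 (fun M : 'rV_n.+1 => M 0 j) eB.
  by rewrite -rowE !mxE eqxx/= mulr_natr.
pose B' := drsubmx (B : 'M[R]_(1 + n)).
have BE : B = block_mx x%:M 0 0 B' :> 'M[R]_(1 + n).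
  rewrite -[LHS](@submxK _ 1 n 1 n); congr block_mx; apply/matrixP => i j.
  - rewrite !mxE !ord1 lshift0; have := B0 0; rewrite eqxx mulr1n => <-.
    by congr (B _ _); apply/val_inj.
  - rewrite !mxE !ord1 lshift0.
    by have := B0 (rshift 1 j); rewrite mulr0n => <-; congr (B _ _); apply/val_inj.
  - rewrite !mxE !ord1 lshift0 -BT mxE.
    by have := B0 (rshift 1 i); rewrite mulr0n => <-; congr (B _ _); apply/val_inj.
have B'T : B'^T = B' by rewrite /B' trmx_drsub BT.
have cB' : char_poly B' = \prod_(y <- l) ('X - y%:P).
  apply: (mulfI (_ : 'X - x%:P != 0)); first by rewrite polyXsubC_eq0.
  by rewrite -char_poly_block -BE defB (char_poly_conj _ HH).
have [Q [QQ B'E]] := IHn B' l B'T sl cB'.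
pose Q1 : 'M[R]_(1 + n) := block_mx 1%:M 0 0 Q.
have Q1T : Q1^T = block_mx 1%:M 0 0 Q^T.
  by rewrite tr_block_mx trmx1 !trmx0.
have Q1Q : Q1 *m Q1^T = 1%:M.
  rewrite Q1T /Q1 mulmx_block.
  by rewrite !mulmx0 !mul0mx !addr0 add0r QQ mulmx1 -scalar_mx_block.
exists (Q1 *m H); split.
  by rewrite trmx_mul HT !mulmxA -(mulmxA Q1) HH mulmx1.
have -> : diag_mx (\row_i (x :: l)`_i) =
    block_mx x%:M 0 0 (diag_mx (\row_i l`_i)) :> 'M[R]_(1 + n).
  apply/matrixP => i j; rewrite -[i]splitK -[j]splitK.
  case: (fintype.split i) => {}i; case: (fintype.split j) => {}j /=;
    rewrite ?block_mxEul ?block_mxEur ?block_mxEdl ?block_mxEdr !mxE ?ord1 //=.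
have BQ : B = Q1^T *m block_mx x%:M 0 0 (diag_mx (\row_i l`_i)) *m Q1.
  rewrite BE Q1T /Q1 !mulmx_block.
  by rewrite !(mulmx0, mul0mx, addr0, add0r, mul1mx, mulmx1) -B'E.
have <- : H *m B *m H = A.
  by rewrite defB !mulmxA HH mul1mx -mulmxA HH mulmx1.
by rewrite trmx_mul HT BQ !mulmxA.
Qed.

Lemma left_kernel p K (M : 'M[R]_(p, K)) : (K < p)%N ->
  exists2 c : 'rV[R]_p, c != 0 & c *m M = 0.
Proof.
move=> Kp; have : kermx M != 0.
  by rewrite kermx_eq0 -row_leq_rank -ltnNge (leq_ltn_trans (rank_leq_col M)).
case/rowV0Pn => c /sub_kermxP cM c0; by exists c.
Qed.

Lemma card_nth (p : pred R) n (l : seq R) : size l = n ->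
  #|[set i : 'I_n | p l`_i]| = count p l.
Proof.
move=> sl; rewrite -sum1_card -sum1_count (big_nth 0) sl big_mkord.
by apply: eq_bigl => i; rewrite inE.
Qed.

(** * Counting eigenvalues with quadratic forms (Courant-Fischer) *)

Section Counting.
Variables (n : nat) (A Q : 'M[R]_n) (l : seq R).
Hypotheses (QQ : Q *m Q^T = 1%:M) (AE : A = Q^T *m diag_mx (\row_i l`_i) *m Q).
Hypothesis sl : size l = n.

Let QQ' : Q^T *m Q = 1%:M. Proof. exact: mulmx1C. Qed.

Lemma dotv_spectral v : dotv v v = \sum_i (v *m Q^T) 0 i ^+ 2.
Proof.
by rewrite -(@dotv_orth _ _ Q^T) ?trmxK.
Qed.

Lemma quad_spectral v :
  dotv (v *m A) v = \sum_(i < n) l`_i * (v *m Q^T) 0 i ^+ 2.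
Proof.
rewrite AE !mulmxA dotv_mull mul_mx_diag; apply: eq_bigr => i _.
by rewrite mxE [(\row_k _) 0 i]mxE; ring.
Qed.

Lemma quad_spectralB t v :
  dotv (v *m A) v - t * dotv v v = \sum_(i < n) (l`_i - t) * (v *m Q^T) 0 i ^+ 2.
Proof.
rewrite quad_spectral dotv_spectral mulr_sumr -sumrB.
by apply: eq_bigr => i _; rewrite mulrBl.
Qed.

(** By dimension, the span of more than [K] eigenvectors meets the common kernel of [K] linear forms
    outside 0. If their eigenvalues exceed [t], the form is strictly larger than [t * dotv v v]
    there. *)
Lemma count_gt_le K (U : 'M[R]_(K, n)) t :
  (forall v, v *m U^T = 0 -> dotv (v *m A) v <= t * dotv v v) ->
  (count (> t) l <= K)%N.
Proof.
move=> h; rewrite -(card_nth _ sl) leqNgt; apply/negP.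
set I := [set i | _]; set p := #|I| => Kp.
pose f (k : 'I_p) : 'I_n := enum_val k.
have [c c0 cU] := left_kernel (rowsub f Q *m U^T) Kp.
pose v := c *m rowsub f Q.
have := h v; rewrite -mulmxA => /(_ cU); rewrite -subr_le0 quad_spectralB.
set d := v *m Q^T => ds.
have dE i : d 0 i = \sum_k c 0 k * (f k == i)%:R.
  rewrite /d /v -mulmxA mul_rowsub_mx QQ mxE.
  by apply: eq_bigr => k _; rewrite !mxE.
have df k : d 0 (f k) = c 0 k.
  rewrite dE (bigD1 k)//= eqxx mulr1 big1 ?addr0// => j /negPf jk.
  by rewrite (inj_eq enum_val_inj) jk mulr0.
have d0 i : i \notin I -> d 0 i = 0.
  move=> iI; rewrite dE big1// => k _; case: eqP => [ki|]; last by rewrite mulr0.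
  by move: iI; rewrite -ki enum_valP.
(* In eigenvector coordinates [d] is supported on [I], so every term is nonnegative; as the sum is
   nonpositive, all of them vanish. *)
have term_ge0 (i : 'I_n) : true -> 0 <= (l`_i - t) * d 0 i ^+ 2.
  have [|/d0 ->] := boolP (i \in I); last by rewrite expr0n mulr0.
  by rewrite inE => ti; rewrite mulr_ge0 ?sqr_ge0// subr_ge0 ltW.
have {}ds : \sum_(i < n) (l`_i - t) * d 0 i ^+ 2 = 0.
  by apply/eqP; rewrite eq_le ds sumr_ge0.
move/eqP: c0; apply; apply/rowP => k; rewrite mxE -df.
have /eqP := psumr_eq0P term_ge0 ds (i := f k) isT.
have := enum_valP k; rewrite -/(f k) inE => ti.
by rewrite mulf_eq0 sqrf_eq0 subr_eq0 gt_eqF//= => /eqP.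
Qed.

(** Dual dimension count: with fewer than [K] eigenvalues [>= t], some nonzero combination of the
    rows of [U] would be orthogonal to their eigenvectors, and the form would be below
    [t * dotv v v] there. Freeness of the rows turns a nonzero [c] into a nonzero [v]. *)
Lemma count_ge_ge K (U : 'M[R]_(K, n)) t : row_free U ->
  (forall c v, v = c *m U -> t * dotv v v <= dotv (v *m A) v) ->
  (K <= count (>= t) l)%N.
Proof.
move=> fU h; rewrite -(card_nth _ sl) leqNgt; apply/negP.
set I := [set i | _]; set p := #|I| => pK.
pose f (k : 'I_p) : 'I_n := enum_val k.
have [c c0 cU] := left_kernel (U *m (rowsub f Q)^T) pK.
pose v := c *m U.
have := h c v erefl; rewrite -subr_ge0 quad_spectralB.
set d := v *m Q^T => ds.
have d0 i : i \in I -> d 0 i = 0.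
  move=> iI; have := congr1 (fun M : 'rV_p => M 0 (enum_rank_in iI i)) cU.
  rewrite mulmxA mxE [in RHS]mxE => <-; rewrite /d mxE; apply: eq_bigr => j _.
  by rewrite !mxE /f enum_rankK_in.
have term_le0 (i : 'I_n) : true -> 0 <= - ((l`_i - t) * d 0 i ^+ 2).
  have [/d0 ->|] := boolP (i \in I); first by rewrite expr0n mulr0 oppr0.
  rewrite inE -ltNge => ti.
  by rewrite -mulNr mulr_ge0 ?sqr_ge0// oppr_ge0 subr_le0 ltW.
have {}ds : \sum_(i < n) - ((l`_i - t) * d 0 i ^+ 2) = 0.
  by apply/eqP; rewrite eq_le sumr_ge0// andbT sumrN oppr_le0.
have dz i : d 0 i = 0.
  have [/d0 //|] := boolP (i \in I); rewrite inE -ltNge => ti.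
  have /eqP := psumr_eq0P term_le0 ds (i := i) isT.
  by rewrite oppr_eq0 mulf_eq0 sqrf_eq0 subr_eq0 lt_eqF//= => /eqP.
have : dotv v v = 0.
  by rewrite dotv_spectral big1// => i _; rewrite -/d dz expr0n.
move/eqP; rewrite dotv_eq0 => /eqP v0; move/eqP: c0; apply.
by apply: (row_free_inj fU); rewrite -/v v0 mul0mx.
Qed.

End Counting.

Lemma quadE n (A : 'M[R]_n) v :
  dotv (v *m A) v = \sum_i \sum_j A i j * (v 0 i * v 0 j).
Proof.
rewrite exchange_big; apply: eq_bigr => j _; rewrite mxE mulr_suml.
by apply: eq_bigr => i _; rewrite mulrCA mulrA.
Qed.

Lemma quadD n (A B : 'M[R]_n) v :
  dotv (v *m (A + B)) v = dotv (v *m A) v + dotv (v *m B) v.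
Proof. by rewrite mulmxDr dotvDl. Qed.

(** A crude norm bound. It serves to show that eigenvalues are Lipschitz functions of the entries,
    hence measurable, where the constant is irrelevant. *)
Lemma quad_entries n (A : 'M[R]_n) v :
  `|dotv (v *m A) v| <= (\sum_i \sum_j `|A i j|) * dotv v v.
Proof.
have vi i : v 0 i ^+ 2 <= dotv v v.
  rewrite /dotv (bigD1 i)//= -expr2 lerDl; apply: sumr_ge0 => j _.
  by rewrite -expr2 sqr_ge0.
rewrite quadE mulr_suml (le_trans (ler_norm_sum _ _ _))//.
apply: ler_sum => i _; rewrite mulr_suml (le_trans (ler_norm_sum _ _ _))//.
apply: ler_sum => j _; rewrite normrM ler_wpM2l//.
have := vi i; have := vi j; have := sqr_ge0 (v 0 i - v 0 j).
have := sqr_ge0 (v 0 i + v 0 j).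
by rewrite ler_norml => *; apply/andP; split; nra.
Qed.

(** * Norm bounds from traces of powers *)

Section PowerBound.
Variables (n : nat) (S : 'M[R]_n).
Hypothesis ST : S^T = S.

Lemma tr_expmx k : (S ^+ k)^T = S ^+ k.
Proof.
elim: k => [|k IH]; first by rewrite expr0 trmx1.
by rewrite {1}exprS exprSr trmx_mul IH ST.
Qed.

Lemma dotv_mulmx_le m (M : 'M[R]_(n, m)) v :
  dotv (v *m M) (v *m M) <= dotv v v * \sum_i \sum_j M i j ^+ 2.
Proof.
rewrite exchange_big mulr_sumr; apply: ler_sum => j _.
have -> : (v *m M) 0 j = dotv v (\row_i M i j).
  by rewrite mxE; apply: eq_bigr => i _; rewrite mxE.
rewrite -expr2 (le_trans (cauchy_schwarz _ _))// ler_wpM2l ?dotv_ge0//.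
by apply: ler_sum => i _; rewrite mxE expr2.
Qed.

Lemma trace_expmx k : \tr (S ^+ (k + k)) = \sum_i \sum_j (S ^+ k) i j ^+ 2.
Proof.
rewrite exprD; apply: eq_bigr => i _; rewrite mxE; apply: eq_bigr => j _.
by rewrite expr2 -[in X in _ * X](tr_expmx k) mxE.
Qed.

Let s v j := dotv (v *m S ^+ j) (v *m S ^+ j).

(** Symmetry moves [S ^+ k] to the other side of the scalar product, where Cauchy-Schwarz applies.
    Each use doubles the exponent, whence the powers of two below. *)
Lemma dotv_expmx_sqr k v : s v k ^+ 2 <= dotv v v * s v (k + k)%N.
Proof.
rewrite [X in X ^+ 2](_ : _ = dotv v (v *m S ^+ (k + k))) ?cauchy_schwarz//.
by rewrite /s dotv_mull tr_expmx -mulmxA exprD.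
Qed.

(** With [N = 2 ^ r] this is [(|v S| / |v|) ^ (2 N) <= |v S ^ N| ^ 2 / |v| ^ 2], cleared of
    denominators so that [v = 0] is admissible. *)
Lemma dotv_expmx_pow2 r v :
  s v 1%N ^+ (2 ^ r) * dotv v v <= dotv v v ^+ (2 ^ r) * s v (2 ^ r)%N.
Proof.
have D0 := dotv_ge0 v; have s0 j : 0 <= s v j := dotv_ge0 _.
elim: r => [|r IH]; first by rewrite !expn0 !expr1 mulrC.
move: D0; rewrite le_eqVlt => /orP[/eqP D0|Dp].
  by rewrite -D0 mulr0 mulr_ge0// ?exprn_ge0.
rewrite expnSr !muln2 -addnn !exprD.
have := dotv_expmx_sqr (2 ^ r) v.
move: IH; move: (s0 (2 ^ r)%N) (exprn_ge0 (2 ^ r) (s0 1%N)) (exprn_gt0 (2 ^ r) Dp).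
move: (s v (2 ^ r + 2 ^ r)%N) (s v (2 ^ r)%N) (s v 1%N ^+ (2 ^ r)) (dotv v v ^+ (2 ^ r)).
move: (dotv v v) Dp => D Dp z y a b y0 a0 b0 h1 h2.
rewrite -(ler_pM2r Dp) (@le_trans _ _ (b * y * (b * y)))//.
  have -> : a * a * D * D = a * D * (a * D) by ring.
  by apply: ler_pM => //; rewrite mulr_ge0// ltW.
have -> : b * y * (b * y) = b * b * (y ^+ 2) by ring.
by rewrite -!mulrA !ler_pM2l// mulrC.
Qed.

(** For [N = 2 ^ r] the trace is the squared Frobenius norm of [S ^ N], which controls [|v S|] by
    the previous lemma; Cauchy-Schwarz passes to the form. The case [r = 0] is the plain Frobenius
    bound; a large [r] loses only a small power of the dimension. *)
Lemma quad_trace_le r eta v : 0 <= eta ->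
  \tr (S ^+ (2 ^ r + 2 ^ r)) <= eta ^+ (2 ^ r + 2 ^ r) ->
  `|dotv (v *m S) v| <= eta * dotv v v.
Proof.
move=> e0; rewrite trace_expmx => trS.
have [->|v0] := eqVneq v 0; first by rewrite mul0mx -(scale0r 0) !dotvZl !mul0r mulr0 normr0.
have D0 : 0 < dotv v v by rewrite dotv_gt0.
have := dotv_expmx_pow2 r v; rewrite /s expr1 => h1.
have h2 := dotv_mulmx_le (S ^+ (2 ^ r)) v.
have s1 : dotv (v *m S) (v *m S) <= eta ^+ 2 * dotv v v.
  rewrite -(@ler_pXn2r _ (2 ^ r)) ?nnegrE ?dotv_ge0 ?expn_gt0//; last first.
    by rewrite mulr_ge0 ?sqr_ge0// ltW.
  rewrite -(ler_pM2r D0) (le_trans h1)// exprMn mulrAC mulrC ler_pM2r ?exprn_gt0//.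
  rewrite (le_trans h2)// mulrC ler_pM2r// (le_trans trS)//.
  by rewrite -exprM mul2n addnn.
rewrite -(@ler_pXn2r _ 2) ?nnegrE ?normr_ge0//; last by rewrite mulr_ge0// ltW.
rewrite -normrX ger0_norm ?sqr_ge0// (le_trans (cauchy_schwarz _ _))//.
have -> : (eta * dotv v v) ^+ 2 = eta ^+ 2 * dotv v v * dotv v v by ring.
by rewrite ler_pM2r.
Qed.

End PowerBound.

(** * Symmetric matrices with isolated large entries *)

Section SparsePlusSmall.
Variables (n : nat) (A : 'M[R]_n) (x t eta : R).
Hypothesis AT : A^T = A.
Let big i j := x < `|A i j|.
Hypothesis big_row : forall i j j', big i j -> big i j' -> j = j'.
Hypothesis big_diag : forall i, ~~ big i i.
Hypothesis small : forall v,
  `|dotv (v *m (\matrix_(i, j) (if big i j then 0 else A i j))) v| <= eta * dotv v v.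
Hypotheses (x0 : 0 <= x) (xt : x <= t).

Let Asym i j : A i j = A j i. Proof. by rewrite -{1}AT mxE. Qed.

Definition large_pairs := [set p : 'I_n * 'I_n | (p.1 < p.2)%N && (t < `|A p.1 p.2|)].

Let K := #|large_pairs|.
Let e (k : 'I_K) := enum_val k.
(* The row of [(i, j)] is [e_i + sgn(A_ij) e_j], the eigenvector of the block of
   [(i, j)] for the eigenvalue [|A_ij|]. *)
Definition pair_rows : 'M[R]_(K, n) :=
  \matrix_(k, l) ((l == (e k).1)%:R + Num.sg (A (e k).1 (e k).2) * (l == (e k).2)%:R).

Let bigS i j : big i j = big j i. Proof. by rewrite /big Asym. Qed.

Let quad_big v : dotv (v *m A) v <=
  \sum_i \sum_j (if big i j then A i j else 0) * (v 0 i * v 0 j) + eta * dotv v v /\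
  \sum_i \sum_j (if big i j then A i j else 0) * (v 0 i * v 0 j) - eta * dotv v v <=
    dotv (v *m A) v.
Proof.
pose B := \matrix_(i, j) (if big i j then A i j else 0).
have AB : A = B + \matrix_(i, j) (if big i j then 0 else A i j).
  by apply/matrixP => i j; rewrite !mxE; case: ifP; rewrite ?addr0 ?add0r.
rewrite [in X in X <= _]AB [in X in _ /\ _ <= X]AB quadD.
have := small v; rewrite ler_norml => /andP[h1 h2].
have -> : dotv (v *m B) v =
    \sum_i \sum_j (if big i j then A i j else 0) * (v 0 i * v 0 j).
  by rewrite quadE; apply: eq_bigr => i _; apply: eq_bigr => j _; rewrite mxE.
by split; rewrite lerD2l.
Qed.

Let eP k : [/\ ((e k).1 < (e k).2)%N, t < `|A (e k).1 (e k).2| & big (e k).1 (e k).2].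
Proof.
have := enum_valP k; rewrite inE -/(e k) => /andP[-> tA]; split => //.
exact: le_lt_trans tA.
Qed.

(** On the orthogonal complement of [pair_rows], an entry of size above [t] forces
    [v_i = - sgn a_ij v_j] and so contributes a nonpositive amount. Large entries of size at most
    [t], being alone in their rows, contribute at most [t |v| ^ 2], and the small part at most
    [eta |v| ^ 2]; then [count_gt_le] applies. *)
Lemma count_le_large_pairs (l : seq R) : size l = n ->
  char_poly A = \prod_(x <- l) ('X - x%:P) ->
  (count (> (t + eta)%R) l <= #|large_pairs|)%N.
Proof.
move=> sl cA; have [Q [QQ AE]] := spectral_theorem AT sl cA.
apply: (count_gt_le QQ AE sl (U := pair_rows)) => v vU.
have ev k : v 0 (e k).1 = - (Num.sg (A (e k).1 (e k).2) * v 0 (e k).2).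
  have := congr1 (fun M : 'rV_K => M 0 k) vU; rewrite mxE [RHS]mxE.
  under eq_bigr do rewrite !mxE mulrDr.
  rewrite big_split/= (bigD1 (e k).1)//= eqxx mulr1 big1 ?addr0; last first.
    by move=> i /negPf ->; rewrite mulr0.
  rewrite (bigD1 (e k).2)//= eqxx mulr1 big1 ?addr0; last first.
    by move=> i /negPf ->; rewrite !mulr0.
  by move/eqP; rewrite addr_eq0 => /eqP ->; rewrite mulrC.
have neg (i j : 'I_n) : (i < j)%N -> t < `|A i j| -> A i j * (v 0 i * v 0 j) <= 0.
  move=> ij tA; have ijE : (i, j) \in large_pairs by rewrite inE ij.
  have := ev (enum_rank_in ijE (i, j)); rewrite /e enum_rankK_in//= => ->.
  set a := A i j; set b := v 0 j.
  have -> : a * (- (Num.sg a * b) * b) = - ((Num.sg a * a) * b ^+ 2) by ring.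
  by rewrite -normrEsg oppr_le0 mulr_ge0 ?sqr_ge0.
(* Half of each entry is charged to row [i] and half to row [j], so that the uniqueness of large
   entries in a row bounds the double sum. *)
have term (i j : 'I_n) : (if big i j then A i j else 0) * (v 0 i * v 0 j) <=
    t / 2 * ((big i j)%:R * v 0 i ^+ 2 + (big j i)%:R * v 0 j ^+ 2).
  have t0 : 0 <= t by apply: le_trans xt.
  have := sqr_ge0 (v 0 i); have := sqr_ge0 (v 0 j).
  rewrite -bigS; case: ifPn => [bij|_ *]; last by rewrite !mul0r addr0 mulr0.
  rewrite !mul1r => p1 p2; have q0 : 0 <= v 0 i ^+ 2 + v 0 j ^+ 2 by rewrite addr_ge0.
  have [tA|At] := ltP t `|A i j|.
    apply: (@le_trans _ _ 0); last by rewrite mulr_ge0// mulr_ge0 ?invr_ge0.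
    have [ij|ji|/val_inj ij] := ltngtP i j; first exact: neg.
      by rewrite Asym [v 0 i * _]mulrC; apply: neg; rewrite // Asym.
    by move: bij; rewrite ij (negPf (big_diag j)).
  apply: (le_trans (ler_norm _)); rewrite normrM.
  apply: (@le_trans _ _ (t * `|v 0 i * v 0 j|)); first by rewrite ler_wpM2r.
  rewrite -mulrA ler_wpM2l//.
  have := sqr_ge0 (v 0 i - v 0 j); have := sqr_ge0 (v 0 i + v 0 j).
  by rewrite ler_norml => *; apply/andP; split; nra.
have rowsum i : \sum_j (big i j)%:R * v 0 i ^+ 2 <= v 0 i ^+ 2.
  have [j0 b0|nb] := pickP (big i); last first.
    by rewrite big1 ?sqr_ge0// => j _; rewrite nb mul0r.
  rewrite (bigD1 j0)//= b0 mul1r big1 ?addr0// => j jj0.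
  have [bij|_] := boolP (big i j); last by rewrite mul0r.
  by rewrite (big_row bij b0) eqxx in jj0.
rewrite mulrDl; apply: (le_trans (quad_big v).1); rewrite lerD2r.
apply: (@le_trans _ _ (\sum_i \sum_j
    t / 2 * ((big i j)%:R * v 0 i ^+ 2 + (big j i)%:R * v 0 j ^+ 2))).
  by apply: ler_sum => i _; apply: ler_sum => j _.
have -> : \sum_i \sum_j t / 2 * ((big i j)%:R * v 0 i ^+ 2 + (big j i)%:R * v 0 j ^+ 2)
   = t * \sum_i \sum_j ((big i j)%:R * v 0 i ^+ 2).
  under eq_bigr do rewrite -mulr_sumr big_split/=.
  rewrite -mulr_sumr big_split/= [X in _ + X]exchange_big/=.
  by rewrite -[in RHS](@mulfK _ 2 _ t) ?pnatr_eq0//; set W := \sum_i _; field.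
rewrite ler_wpM2l ?(le_trans x0)//.
by apply: ler_sum => i _; rewrite -expr2.
Qed.

(** The rows of [pair_rows] have disjoint supports. On their span every coordinate [v_i] is 0 or
    belongs to a pair with [a_ij v_i v_j = |a_ij| v_i ^ 2], so the form is at least
    [(t - eta) |v| ^ 2] and [count_ge_ge] applies. *)
Lemma large_pairs_le_count (l : seq R) : size l = n ->
  char_poly A = \prod_(x <- l) ('X - x%:P) ->
  (#|large_pairs| <= count (>= (t - eta)%R) l)%N.
Proof.
move=> sl cA; have [Q [QQ AE]] := spectral_theorem AT sl cA.
(* The first index of pair [k] occurs in no other pair: as a first index it would have the same
   partner, as a second index it would reverse the order of the two. *)
have cU1 (c : 'rV_K) k : (c *m pair_rows) 0 (e k).1 = c 0 k.
  have [ij tA bij] := eP k.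
  rewrite mxE (bigD1 k)//= !mxE eqxx [_ == _](_ : _ = false) ?mulr0 ?addr0 ?mulr1; last first.
    by apply/negbTE; rewrite neq_ltn ij.
  rewrite big1 ?addr0// => k' kk'; have [ij' tA' bij'] := eP k'; rewrite !mxE.
  case: eqP => [ii'|_] /=.
    move: bij'; rewrite -ii' => /(big_row bij) jj'; move/eqP: kk'; case.
    by apply: enum_val_inj; rewrite -/(e k) -/(e k') [e k]surjective_pairing [e k']surjective_pairing ii' jj'.
  case: eqP => [ij''|_]; last by rewrite mulr0 addr0 mulr0.
  move: bij'; rewrite -ij'' bigS => /(big_row bij) ji'.
  by move: ij'; rewrite -ij'' -ji' ltnNge (ltnW ij).
have cU2 (c : 'rV_K) k : (c *m pair_rows) 0 (e k).2 = Num.sg (A (e k).1 (e k).2) * c 0 k.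
  have [ij tA bij] := eP k.
  rewrite mxE (bigD1 k)//= !mxE eqxx [_ == _](_ : _ = false) ?add0r ?mulr1; last first.
    by apply/negbTE; rewrite neq_ltn ij orbT.
  rewrite big1 ?addr0 1?mulrC// => k' kk'; have [ij' tA' bij'] := eP k'; rewrite !mxE.
  case: eqP => [ji'|_] /=.
    move: bij'; rewrite -ji' bigS; rewrite bigS in bij.
    by rewrite bigS => /(big_row bij) jj'; move: ij'; rewrite -ji' -jj' ltnNge (ltnW ij).
  case: eqP => [jj'|_]; last by rewrite mulr0 addr0 mulr0.
  move: bij'; rewrite -jj' bigS; rewrite bigS in bij => /(big_row bij) ii'.
  by move/eqP: kk'; case; apply: enum_val_inj; rewrite -/(e k) -/(e k') [e k]surjective_pairing [e k']surjective_pairing ii' jj'.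
have cU0 (c : 'rV_K) i : (forall j, ~~ (t < `|A i j|)) -> (c *m pair_rows) 0 i = 0.
  move=> ni; rewrite mxE big1// => k _; have [ij tA bij] := eP k; rewrite mxE.
  case: eqP => [ii'|_]; first by move: (ni (e k).2); rewrite ii' tA.
  case: eqP => [ii'|_]; last by rewrite mulr0 addr0 mulr0.
  by move: (ni (e k).1); rewrite ii' Asym tA.
apply: (count_ge_ge QQ AE sl (U := pair_rows)).
  apply: inj_row_free => c cU; apply/rowP => k.
  by rewrite -cU1 cU !mxE.
move=> c v vE; have neg (i j : 'I_n) : (i < j)%N -> t < `|A i j| ->
    A i j * (v 0 i * v 0 j) = `|A i j| * v 0 i ^+ 2 /\
    A i j * (v 0 i * v 0 j) = `|A i j| * v 0 j ^+ 2.
  move=> ij tA; have ijE : (i, j) \in large_pairs by rewrite inE ij.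
  have := cU1 c (enum_rank_in ijE (i, j)); have := cU2 c (enum_rank_in ijE (i, j)).
  rewrite /e enum_rankK_in//= -vE => -> ->.
  have A0 : A i j != 0 by rewrite -normr_gt0 (le_lt_trans _ tA)// (le_trans x0).
  set d := c 0 _; rewrite normrEsg exprMn sqr_sg A0 mul1r.
  by set a := A i j; split; ring.
rewrite mulrBl; apply: le_trans (quad_big v).2; rewrite lerD2r mulr_sumr.
apply: ler_sum => i _; have [j0 t0|nb] := pickP (fun j => t < `|A i j|); last first.
  have v0 : v 0 i = 0 by rewrite vE cU0// => j; rewrite nb.
  by rewrite v0 mulr0 mulr0 big1// => j _; rewrite mul0r mulr0.
have b0 : big i j0 by apply: le_lt_trans t0.
rewrite (bigD1 j0)//= b0 big1 ?addr0; last first.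
  move=> j jj0; case: ifPn => [bij|]; last by rewrite mul0r.
  by rewrite (big_row bij b0) eqxx in jj0.
suff -> : A i j0 * (v 0 i * v 0 j0) = `|A i j0| * v 0 i ^+ 2.
  by rewrite -expr2 ler_wpM2r ?sqr_ge0// ltW.
have [ij|ji|/val_inj ij] := ltngtP i j0.
- exact: (neg _ _ ij t0).1.
- by rewrite Asym in t0 *; rewrite [v 0 i * _]mulrC (neg _ _ ji t0).2.
- by move: b0; rewrite -ij (negPf (big_diag i)).
Qed.

End SparsePlusSmall.

Lemma ge_nth_sorted (l : seq R) k t : sorted >=%R l -> (k < size l)%N ->
  (t <= l`_k) = (k < count (>= t) l)%N.
Proof.
elim: l k => [|x l IH]//= k xl kl.
have sl := path_sorted xl; have xmax y : y \in l -> y <= x.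
  by move=> yl; have /allP/(_ _ yl) := order_path_min (rev_trans le_trans) xl.
case: k kl => [|k] kl /=.
  have [tx|xt] := leP t x; first by rewrite addnC addn1.
  rewrite add0n; apply/esym/negbTE; rewrite -leqNgt leqn0; apply/eqP.
  rewrite -(count_pred0 l); apply: eq_in_count => y /xmax yx /=.
  by apply/negbTE; rewrite -ltNge (le_lt_trans yx).
rewrite (IH k sl kl); have [tx|xt] := leP t x; first by rewrite add1n ltnS.
rewrite add0n [RHS](_ : _ = false); last first.
  apply/negbTE; rewrite -leqNgt (_ : count _ _ = 0)%N//.
  rewrite -(count_pred0 l); apply: eq_in_count => y /xmax yx /=.
  by apply/negbTE; rewrite -ltNge (le_lt_trans yx).
apply/negbTE; rewrite -leqNgt (_ : count _ _ = 0)%N//.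
rewrite -(count_pred0 l); apply: eq_in_count => y /xmax yx /=.
by apply/negbTE; rewrite -ltNge (le_lt_trans yx).
Qed.

(** Weyl's inequality: the eigenvectors of [B] whose eigenvalues are at least the one of rank [k]
    span a space of dimension more than [k], on which passing to [A] costs at most [eta]. *)
Lemma eigenvalue_perturbation n (A B : 'M[R]_n) (l m : seq R) eta :
  A^T = A -> B^T = B -> size l = n -> size m = n ->
  char_poly A = \prod_(x <- l) ('X - x%:P) ->
  char_poly B = \prod_(x <- m) ('X - x%:P) ->
  sorted >=%R l -> sorted >=%R m ->
  (forall v, `|dotv (v *m (A - B)) v| <= eta * dotv v v) ->
  forall k, (k < n)%N -> m`_k - eta <= l`_k.
Proof.
move=> AT BT sl sm cA cB ol om AB k kn.
have [Q [QQ AE]] := spectral_theorem AT sl cA.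
have [P [PP BE]] := spectral_theorem BT sm cB.
rewrite ge_nth_sorted ?sl//.
have : (k < count (>= (m`_k)%R) m)%N by rewrite -ge_nth_sorted ?sm.
move=> /leq_trans; apply; rewrite -(card_nth _ sm).
set I := [set i | _]; pose f (j : 'I_#|I|) : 'I_n := enum_val j.
have PI c (v : 'rV_n) : v = c *m rowsub f P ->
    forall i, i \notin I -> (v *m P^T) 0 i = 0.
  move=> -> i iI; rewrite -mulmxA mul_rowsub_mx PP mxE big1// => j _.
  rewrite !mxE; case: eqP => [ji|]; last by rewrite mulr0.
  by move: iI; rewrite -ji enum_valP.
apply: (count_ge_ge QQ AE sl (U := rowsub f P)).
  apply: inj_row_free => c cP; apply/rowP => j.
  have := congr1 (fun v : 'rV_n => (v *m P^T) 0 (f j)) cP.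
  rewrite -mulmxA mul_rowsub_mx PP mul0mx [X in _ = X -> _]mxE [X in _ -> _ = X]mxE => <-.
  rewrite mxE (bigD1 j)//= !mxE eqxx mulr1 big1 ?addr0// => i /negPf ij.
  by rewrite !mxE (inj_eq enum_val_inj) ij mulr0.
move=> c v /PI vI; rewrite -(subrK B A) quadD mulrBl addrC lerD//.
  by have := AB v; rewrite ler_norml => /andP[].
rewrite -subr_ge0 (quad_spectralB PP BE); apply: sumr_ge0 => i _.
have [|/vI ->] := boolP (i \in I); last by rewrite expr0n mulr0.
by rewrite inE => ?; rewrite mulr_ge0 ?sqr_ge0// subr_ge0.
Qed.

End RealSymmetric.

Local Open Scope classical_set_scope.
Local Open Scope ring_scope.

(** * Expectations of bounded random variables *)

Section Expectation.
Context (R : realType) (d : measure_display) (T : measurableType d).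
Variable P : probability T R.
Implicit Types (f g : T -> R) (A B : set T).

Definition pr A : R := fine (P A).
(** Bounded measurable functions are closed under sums and products and are integrable, so [Ex] is
    linear on them without side conditions. Truncation brings the moment estimates into this
    class. *)
Definition bmeas f := measurable_fun setT f /\ exists M : R, forall w, `|f w| <= M.
Definition Ex f : R := \int[P]_w f w.

Lemma prE A : measurable A -> P A = (pr A)%:E.
Proof. by move=> mA; rewrite /pr fineK// fin_num_measure. Qed.

Lemma pr_ge0 A : 0 <= pr A. Proof. by rewrite fine_ge0. Qed.

Lemma pr_le1 A : measurable A -> pr A <= 1.
Proof. by move=> mA; rewrite -lee_fin -prE// probability_le1. Qed.

Lemma le_pr A B : measurable A -> measurable B -> A `<=` B -> pr A <= pr B.
Proof. by move=> mA mB AB; rewrite -lee_fin -!prE// le_measure// inE. Qed.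

Lemma prU A B : measurable A -> measurable B -> pr (A `|` B) <= pr A + pr B.
Proof.
move=> mA mB; rewrite -lee_fin EFinD -!prE//; first exact: measureU2.
exact: measurableU.
Qed.

Lemma prC A : measurable A -> pr (~` A) = 1 - pr A.
Proof.
move=> mA; apply: EFin_inj; rewrite EFinB -!prE ?probability_setC//.
exact: measurableC.
Qed.

Lemma pr_setID A B : measurable A -> measurable B ->
  pr A = pr (A `&` B) + pr (A `&` ~` B).
Proof.
move=> mA mB; have m1 : measurable (A `&` B) by exact: measurableI.
have m2 : measurable (A `&` ~` B) by apply: measurableI => //; exact: measurableC.
apply: EFin_inj; rewrite EFinD -!prE// -measureU//.
  by rewrite -setIUr setUv setIT.
by rewrite setIACA setICr setI0.
Qed.

Lemma bmeas_integrable f : bmeas f -> P.-integrable setT (EFin \o f).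
Proof.
case=> mf [M fM]; apply: measurable_bounded_integrable => //.
  by rewrite (le_lt_trans (probability_le1 _ _))// ltry.
exists M; split; first by rewrite num_real.
by move=> x Mx w _ /=; apply: (le_trans (fM w)); rewrite ltW.
Qed.

Lemma bmeas_cst c : bmeas (fun=> c).
Proof. by split; [exact: measurable_cst | exists `|c|]. Qed.

Lemma bmeasD f g : bmeas f -> bmeas g -> bmeas (fun w => f w + g w).
Proof.
move=> [mf [M fM]] [mg [N gN]]; split; first exact: measurable_funD.
by exists (M + N) => w; rewrite (le_trans (ler_normD _ _))// lerD.
Qed.

Lemma bmeasM f g : bmeas f -> bmeas g -> bmeas (fun w => f w * g w).
Proof.
move=> [mf [M fM]] [mg [N gN]]; split; first exact: measurable_funM.
by exists (M * N) => w; rewrite normrM ler_pM.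
Qed.

Lemma bmeasZ c f : bmeas f -> bmeas (fun w => c * f w).
Proof. by move=> bf; apply: bmeasM => //; exact: bmeas_cst. Qed.

Lemma bmeasB f g : bmeas f -> bmeas g -> bmeas (fun w => f w - g w).
Proof.
move=> bf bg; have := bmeasD bf (bmeasZ (-1) bg).
by under eq_fun do rewrite mulN1r.
Qed.

Lemma bmeas_norm f : bmeas f -> bmeas (fun w => `|f w|).
Proof.
move=> [mf [M fM]]; split; first by apply: measurableT_comp => //; exact: normr_measurable.
by exists M => w; rewrite normr_id.
Qed.

Lemma bmeas_indic A : measurable A -> bmeas \1_A.
Proof.
move=> mA; split; first exact: measurable_indic.
by exists 1 => w; rewrite indicE; case: (_ \in _); rewrite ?normr1 ?normr0.
Qed.

Lemma bmeas_sum I (r : seq I) (Q : pred I) (F : I -> T -> R) :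
  (forall i, Q i -> bmeas (F i)) -> bmeas (fun w => \sum_(i <- r | Q i) F i w).
Proof.
move=> bF; elim: r => [|i r IH].
  under eq_fun do rewrite big_nil.
  exact: bmeas_cst.
under eq_fun do rewrite big_cons.
case Qi: (Q i) => //.
exact: bmeasD (bF i Qi) IH.
Qed.

Lemma bmeas_prod I (r : seq I) (Q : pred I) (F : I -> T -> R) :
  (forall i, Q i -> bmeas (F i)) -> bmeas (fun w => \prod_(i <- r | Q i) F i w).
Proof.
move=> bF; elim: r => [|i r IH].
  under eq_fun do rewrite big_nil.
  exact: bmeas_cst.
under eq_fun do rewrite big_cons.
case Qi: (Q i) => //.
exact: bmeasM (bF i Qi) IH.
Qed.

Lemma bmeasX f k : bmeas f -> bmeas (fun w => f w ^+ k).
Proof.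
move=> bf; elim: k => [|k IH]; first exact: (bmeas_cst 1).
under eq_fun do rewrite exprS.
exact: bmeasM.
Qed.

Lemma eq_Ex f g : f =1 g -> Ex f = Ex g.
Proof. by move=> /funext ->. Qed.

Lemma Ex_cst c : Ex (fun=> c) = c.
Proof. by rewrite /Ex Rintegral_cst// [X in fine X]probability_setT mulr1. Qed.

Lemma ExD f g : bmeas f -> bmeas g -> Ex (fun w => f w + g w) = Ex f + Ex g.
Proof. by move=> bf bg; rewrite /Ex RintegralD//; exact: bmeas_integrable. Qed.

Lemma ExZ c f : bmeas f -> Ex (fun w => c * f w) = c * Ex f.
Proof. by move=> bf; rewrite /Ex RintegralZl//; exact: bmeas_integrable. Qed.

Lemma ExB f g : bmeas f -> bmeas g -> Ex (fun w => f w - g w) = Ex f - Ex g.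
Proof. by move=> bf bg; rewrite /Ex RintegralB//; exact: bmeas_integrable. Qed.

Lemma Ex_sum I (r : seq I) (Q : pred I) (F : I -> T -> R) :
  (forall i, Q i -> bmeas (F i)) ->
  Ex (fun w => \sum_(i <- r | Q i) F i w) = \sum_(i <- r | Q i) Ex (F i).
Proof.
move=> bF; elim: r => [|i r IH].
  by rewrite big_nil -[RHS](Ex_cst 0); apply: eq_Ex => w; rewrite big_nil.
rewrite big_cons -IH; case: ifP => Qi.
  by rewrite -ExD; [apply: eq_Ex => w; rewrite big_cons Qi| exact: bF | exact: bmeas_sum].
by apply: eq_Ex => w; rewrite big_cons Qi.
Qed.

Lemma Ex_indic A : measurable A -> Ex \1_A = pr A.
Proof. by move=> mA; rewrite /Ex /Rintegral integral_indic// setIT. Qed.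

Lemma le_Ex f g : bmeas f -> bmeas g -> (forall w, f w <= g w) -> Ex f <= Ex g.
Proof. by move=> bf bg fg; apply: le_Rintegral => //; exact: bmeas_integrable. Qed.

Lemma Ex_norm f : bmeas f -> `|Ex f| <= Ex (fun w => `|f w|).
Proof. by move=> bf; apply: le_normr_Rintegral => //; exact: bmeas_integrable. Qed.

Lemma Ex_le_bound f c : bmeas f -> (forall w, `|f w| <= c) -> `|Ex f| <= c.
Proof.
move=> bf fc; apply: (le_trans (Ex_norm bf)); rewrite -[leRHS](Ex_cst c).
by apply: le_Ex => //; [exact: bmeas_norm | exact: bmeas_cst].
Qed.

Lemma markov_ineq f c : 0 < c -> bmeas f -> (forall w, 0 <= f w) ->
  pr [set w | c <= f w] <= Ex f / c.
Proof.
move=> c0 bf f0; have mA : measurable [set w | c <= f w].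
  rewrite -[X in measurable X]setTI.
  exact: (measurable_fun_le measurableT (measurable_cst c) bf.1).
rewrite ler_pdivlMr// mulrC -Ex_indic// -ExZ; last exact: bmeas_indic.
apply: le_Ex => //; first by apply: bmeasZ; exact: bmeas_indic.
move=> w; rewrite indicE; case: (boolP (w \in _)) => [|_]; last by rewrite mulr0.
by rewrite inE mulr1.
Qed.

Lemma bmeas_comp (g : R -> R) (X : T -> R) : measurable_fun setT g ->
  (exists M : R, forall x, `|g x| <= M) -> measurable_fun setT X ->
  bmeas (fun w => g (X w)).
Proof.
move=> mg [M gM] mX; split; last by exists M.
exact: measurableT_comp.
Qed.

Lemma simple_approx (g : R -> R) (M eps : R) : 0 < eps ->
  measurable_fun setT g -> (forall x, `|g x| <= M) ->
  exists (K : nat) (b : nat -> R) (B : nat -> set R),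
  (forall j, measurable (B j)) /\
  forall x, `|g x - \sum_(j < K) b j * \1_(B j) x| <= eps.
Proof.
move=> e0 mg gM; pose b (j : nat) := - M + j%:R * eps.
pose B (j : nat) := g @^-1` `[b j, b j.+1[%classic.
have M0 : 0 <= M by apply: le_trans (gM 0).
exists (Num.truncn (2 * M / eps)).+1, b, B; split.
  by move=> j; rewrite -[B j]setTI; apply: mg => //; exact: measurable_itv.
move=> x; have /andP[gx1 gx2] : - M <= g x <= M by rewrite -ler_norml.
have y0 : 0 <= (g x + M) / eps by apply: divr_ge0 (ltW e0); lra.
have /andP[t1 t2] := truncn_itv y0; set j := Num.truncn _ in t1 t2.
have gj : b j <= g x < b j.+1.
  move: t1 t2; rewrite ler_pdivlMr// ltr_pdivrMr// /b => *; apply/andP; split; lra.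
have jK : (j < (Num.truncn (2 * M / eps)).+1)%N.
  by rewrite ltnS le_truncn// ler_pM2r ?invr_gt0//; lra.
rewrite (bigD1 (Ordinal jK))//= big1 ?addr0.
  rewrite indicE mem_set ?mulr1; last by rewrite /B/= in_itv.
  move: gj => /andP[? h]; rewrite ger0_norm ?subr_ge0//.
  have -> : eps = b j.+1 - b j by rewrite /b -natr1; ring.
  by rewrite lerB// ltW.
move=> i /negP ij; rewrite indicE memNset ?mulr0// /B/= in_itv/= => /andP[h1 h2].
apply: ij; apply/eqP/val_inj => /=; apply/eqP; rewrite eqn_leq.
move: gj => /andP[h3 h4].
have h5 := le_lt_trans h1 h4; have h6 := le_lt_trans h3 h2.
move: h5 h6; rewrite /b !ltrD2l !ltr_pM2r// !ltr_nat !ltnS => -> ->.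
by [].
Qed.

(** Both sides are continuous in [g] for uniform convergence, so step functions suffice. It is used
    twice: with [W = 1] for equality in law, and with [W] a product of other variables for
    independence. *)
Lemma Ex_transfer (X Y W : T -> R) (c : R) (g : R -> R) :
  measurable_fun setT X -> measurable_fun setT Y -> bmeas W ->
  (forall B : set R, measurable B ->
    Ex (fun w => \1_B (X w) * W w) = c * Ex (fun w => \1_B (Y w))) ->
  measurable_fun setT g -> (exists M : R, forall x, `|g x| <= M) ->
  Ex (fun w => g (X w) * W w) = c * Ex (fun w => g (Y w)).
Proof.
move=> mX mY bW XY mg [M gM]; have [N WN] := bW.2.
have bind (B : set R) Z : measurable B -> measurable_fun setT Z -> bmeas (fun w => \1_B (Z w)).
  move=> mB mZ; apply: bmeas_comp => //.
  by exists 1 => x; rewrite indicE; case: (_ \in _); rewrite ?normr1 ?normr0.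
have N0 : 0 <= N by apply: le_trans (WN point).
have bgX : bmeas (fun w => g (X w)) by apply: bmeas_comp => //; exists M.
have bgY : bmeas (fun w => g (Y w)) by apply: bmeas_comp => //; exists M.
have close e : 0 < e ->
    `|Ex (fun w => g (X w) * W w) - c * Ex (fun w => g (Y w))| <= e * (N + `|c|).
  move=> e0; have [K [b [B [mB gB]]]] := simple_approx e0 mg gM.
  pose s x := \sum_(j < K) b j * \1_(B j) x.
  have bs Z : measurable_fun setT Z -> bmeas (fun w => s (Z w)).
    by move=> mZ; apply: bmeas_sum => j _; apply: bmeasZ; exact: bind.
  have sE : Ex (fun w => s (X w) * W w) = c * Ex (fun w => s (Y w)).
    transitivity (\sum_(j < K) b j * (c * Ex (fun w => \1_(B j) (Y w)))).
      rewrite -[RHS](@eq_bigr _ _ _ _ _ _ (fun j : 'I_K =>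
        Ex (fun w => b j * (\1_(B j) (X w) * W w)))); last first.
        by move=> j _; rewrite ExZ ?XY//; apply: bmeasM => //; exact: bind.
      rewrite -Ex_sum; last first.
        by move=> j _; apply: bmeasZ; apply: bmeasM => //; exact: bind.
      by apply: eq_Ex => w; rewrite mulr_suml; apply: eq_bigr => j _; rewrite mulrA.
    rewrite Ex_sum ?mulr_sumr; last by move=> j _; apply: bmeasZ; exact: bind.
    by apply: eq_bigr => j _; rewrite ExZ 1?mulrCA//; exact: bind.
  have -> : Ex (fun w => g (X w) * W w) - c * Ex (fun w => g (Y w)) =
    Ex (fun w => (g (X w) - s (X w)) * W w) - c * Ex (fun w => g (Y w) - s (Y w)).
    have -> : Ex (fun w => (g (X w) - s (X w)) * W w) =
        Ex (fun w => g (X w) * W w) - Ex (fun w => s (X w) * W w).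
      rewrite -ExB; [by apply: eq_Ex => w; rewrite mulrBl | exact: bmeasM |].
      by apply: bmeasM => //; exact: bs.
    by rewrite sE ExB ?mulrBr//; [ring | exact: bs].
  rewrite (le_trans (ler_normB _ _))// mulrDr lerD//.
    apply: Ex_le_bound; first by apply: bmeasM => //; apply: bmeasB => //; exact: bs.
    by move=> w; rewrite normrM ler_pM.
  rewrite normrM mulrC ler_wpM2r// Ex_le_bound//.
  by apply: bmeasB => //; exact: bs.
apply/eqP; rewrite -subr_eq0 -normr_le0; apply/ler_addgt0Pr => e e0.
have Nc : 0 < N + `|c| + 1 by rewrite ltr_wpDl ?addr_ge0.
rewrite add0r (le_trans (close (e / (N + `|c| + 1)) _)) ?divr_gt0//.
by rewrite mulrAC ler_pdivrMr// ler_pM2l// lerDl.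
Qed.

End Expectation.

Section IndependentProduct.
Context (R : realType) (d : measure_display) (T : measurableType d).
Variable P : probability T R.
Context (I : choiceType) (D : set I) (X : I -> T -> R).
Hypothesis mX : forall i, measurable_fun setT (X i).
Hypothesis indep : mutually_independent P D (X : I -> T -> R).

Let indic_prod (J : seq I) (B : I -> set R) (w : T) :
  \prod_(i <- J) \1_(B i) (X i w) = \1_(\bigcap_(i in [set` J]) X i @^-1` B i) w :> R.
Proof.
rewrite indicE; elim: J => [|i J IH].
  by rewrite big_nil mem_set// => i.
rewrite big_cons IH indicE.
have -> : (w \in \bigcap_(i0 in [set` i :: J]) X i0 @^-1` B i0) =
    (X i w \in B i) && (w \in \bigcap_(i0 in [set` J]) X i0 @^-1` B i0).
  apply/idP/andP => [/set_mem h|[/set_mem h1 /set_mem h2]].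
    by split; apply/mem_set; [apply: (h i); rewrite /= mem_head |
      move=> j /= jJ; apply: (h j); rewrite /= in_cons jJ orbT].
  by apply/mem_set => j /=; rewrite in_cons => /predU1P[->//|]; exact: h2.
by case: (_ \in _); case: (_ \in _); rewrite ?mulr1 ?mulr0.
Qed.

Let preim_measurable i (B : set R) : measurable B -> measurable (X i @^-1` B).
Proof. by move=> mB; rewrite -[X in measurable X]setTI; exact: mX. Qed.

Let bind i (B : set R) : measurable B -> bmeas (fun w => \1_B (X i w) : R).
Proof.
move=> mB; apply: bmeas_comp => //.
by exists 1 => x; rewrite indicE; case: (_ \in _); rewrite ?normr1 ?normr0.
Qed.

Let Ex_indic_prod (J : seq I) (B : I -> set R) : uniq J ->
  (forall i, i \in J -> D i) -> (forall i, measurable (B i)) ->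
  Ex P (fun w => \prod_(i <- J) \1_(B i) (X i w)) =
  \prod_(i <- J) Ex P (fun w => \1_(B i) (X i w)).
Proof.
move=> uJ JD mB.
have mcap : measurable (\bigcap_(i in [set` J]) X i @^-1` B i).
  by apply: fin_bigcap_measurable => // i _; exact: preim_measurable.
under eq_Ex do rewrite indic_prod.
rewrite Ex_indic//; apply: EFin_inj; rewrite -prE//.
rewrite (indep uJ JD mB) (big_morph EFin (@EFinM R) erefl); apply: eq_bigr => i _.
rewrite prE; last exact: preim_measurable.
congr EFin; rewrite -Ex_indic; last exact: preim_measurable.
by apply: eq_Ex => w; rewrite !indicE.
Qed.

(** Interpolates between the product rule for indicators ([J1] empty) and the one for bounded
    functions ([J2] empty): indices change sides one at a time, [Ex_transfer] replacing the
    indicators of one variable by a bounded function of it. *)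
Let Ex_mixed_prod (J1 J2 : seq I) (g : I -> R -> R) (B : I -> set R) :
  uniq (J1 ++ J2) -> (forall i, i \in J1 ++ J2 -> D i) ->
  (forall i, measurable (B i)) -> (forall i, measurable_fun setT (g i)) ->
  (forall i, exists M : R, forall x, `|g i x| <= M) ->
  Ex P (fun w => (\prod_(i <- J1) g i (X i w)) * \prod_(i <- J2) \1_(B i) (X i w)) =
  (\prod_(i <- J1) Ex P (fun w => g i (X i w))) *
  \prod_(i <- J2) Ex P (fun w => \1_(B i) (X i w)).
Proof.
move=> uJ JD mB mg bg.
elim: J1 J2 B uJ JD mB => [|i J1 IH] J2 B uJ JD mB.
  rewrite big_nil mul1r -Ex_indic_prod//.
  by apply: eq_Ex => w; rewrite big_nil mul1r.
rewrite big_cons -mulrA mulrC.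
pose W w := (\prod_(i <- J1) g i (X i w)) * \prod_(i <- J2) \1_(B i) (X i w).
have bW : bmeas W.
  by apply: bmeasM; apply: bmeas_prod => j _; [exact: bmeas_comp | exact: bind].
under eq_Ex do rewrite big_cons -mulrA -/(W _).
apply: Ex_transfer => // C mC.
move: uJ; rewrite cons_uniq mem_cat negb_or -andbA => /and3P[iJ1 iJ2 uJ].
pose B' j := if j == i then C else B j.
have mB' j : measurable (B' j) by rewrite /B'; case: ifP.
have B'E (F : set R -> I -> R) : \prod_(j <- J2) F (B' j) j = \prod_(j <- J2) F (B j) j.
  rewrite big_seq [RHS]big_seq; apply: eq_bigr => j jJ; rewrite /B'; case: eqP => // ji.
  by rewrite -ji jJ in iJ2.
have B'i : B' i = C by rewrite /B' eqxx.
transitivity (Ex P (fun w => (\prod_(j <- J1) g j (X j w)) *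
    \prod_(j <- i :: J2) \1_(B' j) (X j w))).
  by apply: eq_Ex => w; rewrite big_cons B'i (B'E (fun C j => \1_C (X j w))) mulrCA.
rewrite IH//.
- rewrite big_cons B'i (B'E (fun C j => Ex P (fun w => \1_C (X j w)))).
  by rewrite mulrCA mulrC.
- by rewrite uniq_catC /= mem_cat negb_or iJ1 iJ2 uniq_catC.
- by move=> j; rewrite mem_cat in_cons orbCA -mem_cat -in_cons; exact: JD.
Qed.

Lemma Ex_indep_prod (J : seq I) (g : I -> R -> R) :
  uniq J -> (forall i, i \in J -> D i) ->
  (forall i, measurable_fun setT (g i)) ->
  (forall i, exists M : R, forall x, `|g i x| <= M) ->
  Ex P (fun w => \prod_(i <- J) g i (X i w)) =
  \prod_(i <- J) Ex P (fun w => g i (X i w)).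
Proof.
move=> uJ JD mg bg.
have := @Ex_mixed_prod J [::] g (fun=> setT); rewrite cats0 big_nil mulr1.
move=> /(_ uJ JD (fun=> measurableT) mg bg) <-.
by apply: eq_Ex => w; rewrite big_nil mulr1.
Qed.

End IndependentProduct.

(** * Moments of traces *)

Section Walks.
Variable n : nat.

Fixpoint walks q : seq (seq 'I_n) :=
  if q is q'.+1 then [seq x :: s | x <- enum 'I_n, s <- walks q'] else [:: [::]].

Definition edge (i j : 'I_n) : nat * nat := (minn i j, maxn i j).

Lemma big_walks (V : nmodType) q (Q : pred (seq 'I_n)) (F : seq 'I_n -> V) :
  \sum_(s <- walks q.+1 | Q s) F s =
  \sum_(x < n) \sum_(s <- walks q | Q (x :: s)) F (x :: s).
Proof.
rewrite /= big_mkcond big_allpairs_dep big_enum/=.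
by apply: eq_bigr => x _; rewrite [RHS]big_mkcond.
Qed.

Lemma expmx_walks (R : comNzRingType) (M : 'M[R]_n) q i j :
  (M ^+ q) i j =
  \sum_(s <- walks q | last i s == j) \prod_(x <- pairmap (fun a b => M a b) i s) x.
Proof.
elim: q i => [|q IH] i.
  rewrite expr0 big_mkcond /= big_seq1 mxE big_nil.
  by case: eqP.
rewrite exprS mxE big_walks; apply: eq_bigr => x _.
rewrite IH mulr_sumr; apply: eq_bigr => s _.
by rewrite /= big_cons.
Qed.

Lemma mem_pairmap_edge i s e : e \in pairmap edge i s ->
  exists u v, [/\ u \in i :: s, v \in i :: s & e = edge u v].
Proof.
elim: s i => [|x s IH] i //=; rewrite in_cons => /predU1P[->|/IH].
  by exists i, x; rewrite !in_cons !eqxx !orbT.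
by move=> [u [v [us vs ->]]]; exists u, v; split => //; rewrite in_cons ?us ?vs orbT.
Qed.

Lemma edge_le i s e : e \in pairmap edge i s -> (e.1 <= e.2)%N.
Proof. by move=> /mem_pairmap_edge[u [v [_ _ ->]]]; rewrite /edge/=; lia. Qed.

(** A walk is connected, so it visits at most one vertex more than it has distinct edges. In the
    induction, a starting vertex that never recurs makes the first edge new. *)
Lemma size_undup_walk i s :
  (size (undup (i :: s)) <= (size (undup (pairmap edge i s))).+1)%N.
Proof.
have undupE (U : eqType) (y : U) r :
  size (undup (y :: r)) = ((y \notin r) + size (undup r))%N by rewrite /=; case: ifP.
elim: s i => [|x s IH] i //; rewrite [pairmap _ _ _]/= [X in (X <= _)%N]undupE [X in (_ <= X.+1)%N]undupE.
have := IH x; set a := size _; set b := size _ => ab.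
case: (boolP (i \in x :: s)) => is_; first by rewrite (leq_trans ab)// ltnS leq_addl.
rewrite /= add1n ltnS (leq_trans ab)//; case: (boolP (_ \in _)) => //=.
move=> /mem_pairmap_edge[u [v [us vs]]] [e1 e2]; case/negP: is_.
by have [/val_inj ->|/val_inj ->] : i = u :> nat \/ i = v :> nat by lia.
Qed.

(* A walk with [v] visited vertices either returns to one of them or uses a new
   vertex, hence a new edge, which costs a factor [r <= 1 / n]. *)
Fixpoint walk_cst v q := if q is q'.+1 then (v.+1 * walk_cst v.+1 q')%N else 1%N.

Lemma sum_walks_weight (R : realFieldType) (r : R) q (V : seq 'I_n) :
  0 <= r -> n%:R * r <= 1 ->
  \sum_(s <- walks q) r ^+ size (undup (s ++ V)) <=
  (walk_cst (size V) q)%:R * r ^+ size (undup V).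
Proof.
move=> r0 nr; elim: q V => [|q IH] V; first by rewrite big_seq1 mul1r.
rewrite big_walks.
apply: (@le_trans _ _ (\sum_(x < n)
    (walk_cst (size V).+1 q)%:R * r ^+ size (undup (x :: V)))).
  apply: ler_sum => x _; rewrite -[(size V).+1]/(size (x :: V)).
  apply: le_trans (IH (x :: V)); rewrite le_eqVlt; apply/orP; left; apply/eqP.
  apply: eq_bigr => s _; congr (_ ^+ _); apply: perm_size; apply: perm_undup.
  by move=> y; rewrite !(mem_cat, in_cons) -orbA orbCA.
rewrite -mulr_sumr [walk_cst (size V) q.+1]/= natrM mulrC -mulrA mulrCA mulrC.
rewrite [X in _ <= X]mulrCA [X in _ <= X]mulrC -[X in _ <= X]mulrA ler_wpM2l//.
(* The next vertex is old, at no cost and with at most [size V] choices, or new, at the cost [r] and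
   with at most [n] choices; as [n * r <= 1], this totals [size V + 1]. *)
have splitx (x : 'I_n) : r ^+ size (undup (x :: V)) <=
    r ^+ size (undup V) * ((x \in V)%:R + r).
  rewrite /=; case: ifP => _ /=; last by rewrite add0r exprSr.
  by rewrite ler_peMr ?exprn_ge0// lerDl.
apply: (le_trans (ler_sum _ (fun x _ => splitx x))).
rewrite -mulr_sumr ler_wpM2l ?exprn_ge0// big_split/= sumr_const card_ord.
rewrite -natr1 lerD//; last by rewrite -mulr_natl.
rewrite -natr_sum ler_nat; apply: leq_trans (size_undup V).
rewrite -(card_uniqP (undup_uniq V)) -sum1_card [X in (_ <= X)%N]big_mkcond /=.
by apply: leq_sum => x _; rewrite mem_undup; case: (x \in V).
Qed.

End Walks.

Section TraceMoment.
Context (R : realType) (d : measure_display) (T : measurableType d).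
Variable P : probability T R.
Variable X : nat * nat -> T -> R.
Hypothesis mX : forall p, measurable_fun setT (X p).
Hypothesis indep :
  mutually_independent P [set p : nat * nat | (p.1 <= p.2)%N] (X : _ -> T -> R).
Variables (n : nat) (g : R -> R) (rho : R).
Hypothesis n0 : (0 < n)%N.
Hypothesis mg : measurable_fun setT g.
Hypothesis grho : forall x, `|g x| <= rho.
Hypothesis g_mean : forall p, (p.1 <= p.2)%N -> Ex P (fun w => g (X p w)) = 0.
Hypothesis g_var : forall p, (p.1 <= p.2)%N ->
  n%:R * Ex P (fun w => g (X p w) ^+ 2) <= rho ^+ 2.

Definition sym_rv w : 'M[R]_n := \matrix_(i, j) g (X (edge i j) w).

Let rho0 : 0 <= rho. Proof. exact: le_trans (grho 0). Qed.

Let bg p : bmeas (fun w => g (X p w)).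
Proof. by apply: bmeas_comp => //; exists rho. Qed.

(** Each distinct edge of a walk costs a factor [1 / n]: a single traversal has mean 0, and in a
    higher power all factors but two are bounded by [rho], which leaves a second moment of at most
    [rho ^ 2 / n]. *)
Let moment_le p m : (p.1 <= p.2)%N -> (0 < m)%N ->
  `|Ex P (fun w => g (X p w) ^+ m)| <= rho ^+ m * n%:R^-1.
Proof.
move=> pp; case: m => // -[_|m _].
  under eq_Ex do rewrite expr1.
  by rewrite g_mean// normr0 mulr_ge0 ?exprn_ge0// invr_ge0.
apply: (le_trans (Ex_norm _ (bmeasX m.+2 (bg p)))).
apply: (@le_trans _ _ (Ex P (fun w => rho ^+ m * g (X p w) ^+ 2))).
  apply: le_Ex; [exact/bmeas_norm/bmeasX | exact/bmeasZ/bmeasX |].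
  move=> w; rewrite -(addn2 m) exprD normrM [X in _ * X]ger0_norm ?sqr_ge0//.
  by rewrite ler_wpM2r ?sqr_ge0// normrX lerXn2r// ?nnegrE.
rewrite ExZ; last exact: bmeasX.
rewrite -(addn2 m) exprD -mulrA ler_wpM2l ?exprn_ge0// ler_pdivlMr ?ltr0n//.
by rewrite mulrC g_var.
Qed.

Let walk_le i (s : seq 'I_n) : let E := pairmap (@edge n) i s in
  `|Ex P (fun w => \prod_(e <- E) g (X e w))| <= rho ^+ size s * n%:R^-1 ^+ size (undup E).
Proof.
move=> /=; set E := pairmap _ i s.
have Ele e : e \in E -> (e.1 <= e.2)%N by exact: edge_le.
pose h (e : nat * nat) (x : R) := g x ^+ count_mem e E.
have hb e : exists M : R, forall x, `|h e x| <= M.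
  by exists (rho ^+ count_mem e E) => x; rewrite normrX lerXn2r ?nnegrE.
have mh e : measurable_fun setT (h e).
  exact: measurable_funX.
rewrite (@eq_Ex _ _ _ P _ (fun w => \prod_(e <- undup E) h e (X e w))); last first.
  by move=> w; rewrite (prodr_undup_exp_count E predT).
rewrite (Ex_indep_prod mX indep) ?undup_uniq//; last first.
  by move=> e; rewrite mem_undup => /Ele.
have -> : rho ^+ size s = \prod_(e <- undup E) rho ^+ count_mem e E.
  rewrite (prodr_undup_exp_count E predT (fun=> rho)) big_const_seq count_predT.
  by rewrite /E size_pairmap iter_mulr mulr1.
have -> : n%:R^-1 ^+ size (undup E) = \prod_(e <- undup E) n%:R^-1 :> R.
  by rewrite big_const_seq count_predT iter_mulr mulr1.
rewrite -big_split/= normr_prod big_seq [X in _ <= X]big_seq.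
apply: ler_prod => e; rewrite mem_undup => eE; rewrite normr_ge0/=.
by apply: moment_le; [exact: Ele | rewrite -has_count has_pred1].
Qed.

(** A walk through [k] vertices has at least [k - 1] distinct edges, so its expectation is at most
    [rho ^ q * n * n ^ (- k)]. The sum of [n ^ (- k)] over the walks from a given start is at most
    [walk_cst 1 q / n], and there are [n] starts. *)
Lemma trace_moment q :
  Ex P (fun w => \tr (sym_rv w ^+ q)) <= rho ^+ q * (n * walk_cst 1 q)%:R.
Proof.
have bprod i (s : seq 'I_n) : bmeas (fun w => \prod_(e <- pairmap (@edge n) i s) g (X e w)).
  by apply: bmeas_prod => e _.
rewrite (@eq_Ex _ _ _ P _ (fun w => \sum_i \sum_(s <- walks n q | last i s == i)
    \prod_(e <- pairmap (@edge n) i s) g (X e w))); last first.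
  move=> w; apply: eq_bigr => i _; rewrite expmx_walks; apply: eq_bigr => s _.
  elim: s i => [|x s IH] j /=; first by rewrite !big_nil.
  by rewrite !big_cons IH mxE.
rewrite Ex_sum; last by move=> i _; apply: bmeas_sum => s _.
have n1 : 0 <= n%:R^-1 :> R by rewrite invr_ge0.
have nn1 : n%:R * n%:R^-1 = 1 :> R by rewrite divff// pnatr_eq0 -lt0n.
rewrite natrM mulrCA.
apply: (@le_trans _ _ (\sum_(i < n) (rho ^+ q * (walk_cst 1 q)%:R))); last first.
  by rewrite sumr_const card_ord mulr_natl.
apply: ler_sum => i _; rewrite Ex_sum//.
apply: (@le_trans _ _ (\sum_(s <- walks n q)
   rho ^+ q * (n%:R * n%:R^-1 ^+ size (undup (s ++ [:: i]))))).
  rewrite big_mkcond big_seq [X in _ <= X]big_seq; apply: ler_sum => s sq.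
  have szs : size s = q.
    elim: q s sq => [|q IH] s /=; first by rewrite inE => /eqP ->.
    by move=> /allpairsP[[x t] [_ /IH /= <- ->]].
  have wpos : 0 <= rho ^+ q * (n%:R * n%:R^-1 ^+ size (undup (s ++ [:: i]))).
    by rewrite !mulr_ge0 ?exprn_ge0.
  case: ifP => // _; apply: (le_trans (ler_norm _)).
  apply: (le_trans (walk_le i s)); rewrite szs ler_wpM2l ?exprn_ge0//.
  have := size_undup_walk i s.
  rewrite (_ : size (undup (i :: s)) = size (undup (s ++ [:: i]))); last first.
    by apply: perm_size; apply: perm_undup => y; rewrite mem_cat mem_seq1 in_cons orbC.
  have : (0 < size (undup (s ++ [:: i])))%N.
    rewrite -has_predT; apply/hasP; exists i => //.
    by rewrite mem_undup mem_cat inE eqxx orbT.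
  case: (size _) => // k _ kE; rewrite exprS mulrA nn1 mul1r.
  by rewrite ler_wiXn2l// -(ler_pM2l (_ : 0 < n%:R)) ?ltr0n// nn1 mulr1 ler1n.
rewrite -mulr_sumr ler_wpM2l ?exprn_ge0// -mulr_sumr.
have := @sum_walks_weight n R n%:R^-1 q [:: i] n1; rewrite nn1 lexx => /(_ isT) h.
apply: (le_trans (ler_wpM2l (ler0n _ n) h)).
by rewrite /= expr1 mulrCA nn1 mulr1.
Qed.

End TraceMoment.

(** * Regular variation *)

Lemma leq_add_split (n1 n2 n : nat) : (n1 + n2 + 1 <= n)%N ->
  [/\ (n1 <= n)%N, (n2 <= n)%N & (0 < n)%N].
Proof. by move=> h; split; lia. Qed.

Section Powers.
Variable R : realType.
Implicit Types x y a b r s : R.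

Lemma powR_add x r s : 0 < x -> x `^ (r + s) = x `^ r * x `^ s.
Proof. by move=> x0; rewrite powRD //; apply/implyP => _; rewrite gt_eqF. Qed.

Lemma le_powR_exp x r s : 1 <= x -> r <= s -> x `^ r <= x `^ s.
Proof. by move=> x1 rs; apply: ler_powR. Qed.

Lemma lt_powR_exp x r s : 1 < x -> r < s -> x `^ r < x `^ s.
Proof.
move=> x1 rs; have x0 : 0 < x by rewrite (lt_trans ltr01).
rewrite -(subrK r s) addrC powR_add// ltr_pMr ?powR_gt0//.
have -> : 1 = 1 `^ (s - r) :> R by rewrite powR1.
by apply: gt0_ltr_powR; rewrite ?subr_gt0 ?nnegrE// ltW.
Qed.

Lemma le_powR_base x y r : 0 < x -> x <= y -> 0 <= r -> x `^ r <= y `^ r.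
Proof.
move=> x0 xy r0; apply: ge0_ler_powR => //; rewrite nnegrE ltW//.
exact: lt_le_trans xy.
Qed.

Lemma ge_powR_base x y r : 0 < x -> x <= y -> r <= 0 -> y `^ r <= x `^ r.
Proof.
move=> x0 xy r0; rewrite -(opprK r) ![_ `^ - - r]powRN.
rewrite lef_pV2 ?posrE ?powR_gt0//; last exact: lt_le_trans xy.
by apply: le_powR_base => //; rewrite oppr_ge0.
Qed.

Lemma powR_continuous x r : 0 < x -> {for x, continuous (fun y => y `^ r)}.
Proof.
move=> x0; apply: differentiable_continuous; apply/derivable1_diffP.
by apply: derivable_powR; rewrite in_itv/= x0.
Qed.

Lemma powR_ge_eventually r M : 0 < r ->
  exists n0 : nat, forall n, (n0 <= n)%N -> M <= n%:R `^ r.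
Proof.
move=> r0; pose K := Num.max M 1.
have K0 : 0 < K by rewrite lt_max ltr01 orbT.
exists (Num.truncn (K `^ r^-1)).+1 => n nn.
have K1 : K `^ r^-1 <= n%:R.
  by apply: ltW; apply: (lt_le_trans (truncnS_gt _)); rewrite ler_nat.
apply: (@le_trans _ _ K); first by rewrite le_max lexx.
have -> : K = (K `^ r^-1) `^ r.
  by rewrite -powRrM mulVf ?gt_eqF// powRr1// ltW.
by apply: le_powR_base => //; [rewrite powR_gt0 | exact: ltW].
Qed.

Lemma powR_natN_cvg0 C r : 0 < r -> C * n%:R `^ (- r) @[n --> \oo] --> (0 : R).
Proof.
move=> r0; apply/cvgrPdist_le => e e0.
have [n0 h] := powR_ge_eventually (`|C| / e) r0.
exists (n0 + 1)%N => // n /= nn.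
have n1 : (0 < n)%N by lia.
have y0 : 0 < n%:R `^ r by rewrite powR_gt0// ltr0n.
rewrite sub0r normrN normrM powRN [X in _ * X]gtr0_norm ?invr_gt0//.
rewrite ler_pdivrMr// mulrC -ler_pdivrMr//; apply: h; lia.
Qed.

(** Carries an estimate from one dyadic block to all larger arguments. Growth bounds for regularly
    varying tails and for truncated moments then follow from the single scale factor 2. *)
Lemma dyadic_ind (Q : R -> Prop) (x0 : R) : 0 < x0 ->
  (forall x, x0 <= x -> x <= 2 * x0 -> Q x) ->
  (forall x, x0 <= x -> Q x -> Q (2 * x)) -> forall x, x0 <= x -> Q x.
Proof.
move=> p0 base step x xx.
suff H k : forall x, x0 <= x -> x <= 2 ^+ k * x0 -> Q x.
  apply: (H (Num.truncn (x / x0)).+1) => //.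
  rewrite -ler_pdivrMr//; apply: (le_trans (ltW (truncnS_gt _))).
  by rewrite -natrX ler_nat ltnW// ltn_expl.
elim: k => [|k IH] {xx}{}x x1 x2.
  by apply: base => //; rewrite (le_trans x2)// expr0 ler_pM2r// ler1n.
have [|x3] := leP x (2 * x0); first exact: base.
have -> : x = 2 * (x / 2) by field.
apply: step; first lra.
by apply: IH; [lra | move: x2; rewrite exprS => *; lra].
Qed.

End Powers.

Section RegularVariation.
Variables (R : realType) (G : R -> R) (alpha : R).
Implicit Types x y t delta beta : R.
Hypothesis alpha0 : 0 < alpha.
Hypothesis Gmono : forall x y, x <= y -> G y <= G x.
Hypothesis Gpos : forall x, 0 < G x.
Hypothesis Gle1 : forall x, G x <= 1.
Hypothesis Gvar : forall t, 0 < t -> G (t * x) / G x @[x --> +oo] --> t `^ (- alpha).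

Lemma eventually_pinfty (Q : R -> Prop) : (\forall x \near +oo, Q x) ->
  exists x0, 1 <= x0 /\ forall x, x0 <= x -> Q x.
Proof.
move=> [M [_ MQ]]; exists (Num.max 1 (M + 1)); split; first by rewrite le_max lexx.
move=> x; rewrite ge_max => /andP[_ h]; apply: MQ; lra.
Qed.

(** Potter bound: eventually [G (2 * x) <= 2 ^ (- (alpha - delta)) * G x], and doubling preserves
    the claim. *)
Lemma tail_upper delta : 0 < delta -> exists C x0, [/\ 0 < C, 1 <= x0 &
  forall x, x0 <= x -> G x <= C * x `^ (- (alpha - delta))].
Proof.
move=> d0; have lt2 : 2 `^ (- alpha) < 2 `^ (- (alpha - delta)) :> R.
  by apply: lt_powR_exp; rewrite ?ltr1n//; lra.
have [x0 [x1 hx]] := eventually_pinfty (cvgr_lt _ (Gvar (ltr0Sn _ 1)) _ lt2).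
have p0 : 0 < x0 by rewrite (lt_le_trans ltr01).
set e := - (alpha - delta) in lt2 hx *.
(* The sign of [e] is open, as [delta] may exceed [alpha]; the minimum of [x ^ e] on [[x0, 2 x0]]
   may therefore sit at either end. *)
pose C := Num.max ((2 * x0) `^ e)^-1 (x0 `^ e)^-1.
have C1 : ((2 * x0) `^ e)^-1 <= C by rewrite le_max lexx.
have C2 : (x0 `^ e)^-1 <= C by rewrite le_max lexx orbT.
have C0 : 0 < C by rewrite (lt_le_trans _ C2)// invr_gt0 powR_gt0.
exists C, x0; split => //; apply: (@dyadic_ind _ _ x0) => // x xx.
  move=> x2; apply: (le_trans (Gle1 x)).
  have xp : 0 < x by rewrite (lt_le_trans p0).
  rewrite -ler_pdivrMr ?powR_gt0// mul1r.
  have [e0|e0] := leP 0 e.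
    by apply: le_trans C2; rewrite lef_pV2 ?posrE ?powR_gt0// le_powR_base.
  apply: le_trans C1; rewrite lef_pV2 ?posrE ?powR_gt0//; last by lra.
  by rewrite ge_powR_base// ltW.
move=> Gx; have := hx x xx => /ltW; rewrite ler_pdivrMr// => /le_trans; apply.
have xp : 0 <= x by rewrite (le_trans (ltW p0)).
by rewrite powRM// mulrCA ler_wpM2l ?powR_ge0//.
Qed.

Lemma tail_lower delta : 0 < delta -> exists c x0, [/\ 0 < c, 1 <= x0 &
  forall x, x0 <= x -> c * x `^ (- (alpha + delta)) <= G x].
Proof.
move=> d0; have lt2 : 2 `^ (- (alpha + delta)) < 2 `^ (- alpha) :> R.
  by apply: lt_powR_exp; rewrite ?ltr1n//; lra.
have [x0 [x1 hx]] := eventually_pinfty (cvgr_gt _ (Gvar (ltr0Sn _ 1)) _ lt2).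
have p0 : 0 < x0 by rewrite (lt_le_trans ltr01).
set e := - (alpha + delta) in lt2 hx *.
have e0 : e <= 0 by rewrite oppr_le0 addr_ge0 ?ltW.
exists (G (2 * x0) / x0 `^ e), x0; split => //; first by rewrite divr_gt0 ?powR_gt0.
apply: (@dyadic_ind _ _ x0) => // x xx.
  move=> x2; apply: le_trans (Gmono x2).
  rewrite mulrAC ler_pdivrMr ?powR_gt0// ler_wpM2l ?(ltW (Gpos _))//.
  exact: ge_powR_base.
move=> Gx; have := hx x xx => /ltW; rewrite ler_pdivlMr//; apply: le_trans.
have xp : 0 <= x by rewrite (le_trans (ltW p0)).
by rewrite powRM// mulrCA ler_wpM2l ?powR_ge0//.
Qed.

Variable b : nat -> R.
Let N n : R := (n * n.+1)%:R / 2.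
Hypothesis b_lt : forall n x, (1 < n)%N -> x < b n -> (N n)^-1 < G x.
Hypothesis b_gt : forall n x, (0 < n)%N -> b n < x -> G x <= (N n)^-1.

Lemma N_gt0 n : (0 < n)%N -> 0 < N n.
Proof. by move=> n0; rewrite /N divr_gt0// ltr0n muln_gt0 n0. Qed.

Lemma N_ge n : n%:R ^+ 2 / 2 <= N n.
Proof. by rewrite /N ler_pM2r ?invr_gt0// expr2 -natrM ler_nat leq_mul. Qed.

(** Were [b n] below [n ^ beta], the tail at [n ^ beta] would be at most [2 / n ^ 2], whereas
    [tail_lower] keeps it above a multiple of [n ^ (- beta * (alpha + delta))], whose exponent is
    larger than [- 2]. *)
Lemma b_ge_pow beta : 0 < beta -> beta < 2 / alpha ->
  exists n0 : nat, forall n, (n0 <= n)%N -> n%:R `^ beta <= b n.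
Proof.
move=> beta0; rewrite ltr_pdivlMr// => ba.
(* Halves the available room: [2 - beta * (alpha + delta)] becomes [(2 - beta * alpha) / 2]. *)
pose delta := (2 - beta * alpha) / (2 * beta).
have d0 : 0 < delta by rewrite divr_gt0//; lra.
have [c [x0 [c0 x1 hx]]] := tail_lower d0.
have e0 : 0 < 2 - beta * (alpha + delta).
  have -> : 2 - beta * (alpha + delta) = (2 - beta * alpha) / 2 by rewrite /delta; field; lra.
  lra.
have [n1 h1] := powR_ge_eventually x0 beta0.
have [n2 h2] := powR_ge_eventually (2 / c + 1) e0.
exists (n1 + n2 + 1)%N => n /leq_add_split[nn1 nn2 n0].
rewrite leNgt; apply/negP => bn.
have y0 : 0 < n%:R :> R by rewrite ltr0n.
have Gb := b_gt n0 bn; have := hx _ (h1 n nn1).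
rewrite -powRrM => /le_trans /(_ Gb); rewrite leNgt => /negP; apply.
have := h2 n nn2; rewrite powR_add// -mulrN (_ : n%:R `^ 2 = n%:R ^+ 2); last by rewrite powR_mulrn// ltW.
have := N_ge n; have := N_gt0 n0; set X := n%:R `^ _; set Y := n%:R ^+ 2 => Np NY.
have Y0 : 0 < Y by rewrite exprn_gt0.
have X0 : 0 < X by rewrite powR_gt0.
move=> h; rewrite -(ltr_pM2r Np) mulVf ?gt_eqF//.
have : 2 / c < Y * X by apply: lt_le_trans h; rewrite ltrDl.
rewrite ltr_pdivrMr// => h3.
apply: (@lt_le_trans _ _ (c * X * (Y / 2))); last by rewrite ler_pM2l// mulr_gt0.
by rewrite mulrA ltr_pdivlMr// mul1r -mulrA mulrC [X * Y]mulrC.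
Qed.

Lemma b_cvgy (M : R) : exists n0 : nat, forall n, (n0 <= n)%N -> M <= b n.
Proof.
have b0 : 0 < alpha^-1 by rewrite invr_gt0.
have [|n1 h1] := @b_ge_pow alpha^-1 b0; first by rewrite -[ltLHS]mul1r ltr_pM2r// ltr1n.
have [n2 h2] := powR_ge_eventually M b0.
exists (n1 + n2 + 1)%N => n /leq_add_split[nn1 nn2 _].
exact: (le_trans (h2 n nn2) (h1 n nn1)).
Qed.

(** [G (b n)] may differ from [1 / N n], since [G] can jump at [b n]. But [G ((1 + r') * b n) <= 1 /
    N n < G ((1 - r') * b n)], so [N n * G (x * b n)] lies between two ratios whose limits are
    within [e / 2] of [x ^ (- alpha)] once [r'] is small. *)
Lemma tail_cvg (x : R) : 0 < x -> N n * G (x * b n) @[n --> \oo] --> x `^ (- alpha).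
Proof.
move=> x0; have ratio t : 0 < t -> G (x * b n) / G (t * b n) @[n --> \oo] --> (x / t) `^ (- alpha).
  move=> t0; have tb : t * b n @[n --> \oo] --> +oo.
    apply/cvgryPge => M; have [n0 h] := b_cvgy (M / t); exists n0 => // n /= /h.
    by rewrite ler_pdivrMr// mulrC.
  have := cvg_comp _ _ tb (Gvar (divr_gt0 x0 t0)).
  apply: cvg_trans; apply: near_eq_cvg; near=> n => /=.
  by rewrite mulrA divfK// gt_eqF.
have bpos : \forall n \near \oo, 0 < b n /\ (1 < n)%N.
  have [n0 h] := b_cvgy 1; exists n0.+2 => // n /= nn; split; last exact: leq_trans nn.
  by apply: (lt_le_trans ltr01); apply: h; apply: leq_trans nn; rewrite -addn2 leq_addr.
apply/cvgrPdist_le => e e0.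
set l := x `^ (- alpha).
have cont : (x / t) `^ (- alpha) @[t --> (1 : R)] --> l.
  have -> : l = (x / 1) `^ (- alpha) by rewrite divr1.
  apply: (@cvg_comp _ _ _ (fun t : R => x / t) (fun y => y `^ (- alpha)) _ (nbhs (x / 1))).
    by apply: cvgM; [exact: cvg_cst | apply: cvgV; [exact: oner_neq0 | exact: cvg_id]].
  by apply: powR_continuous; rewrite divr1.
have near1 : \forall t \near (1 : R), `|l - (x / t) `^ (- alpha)| < e / 2.
  by have /cvgrPdist_lt := cont; apply; rewrite divr_gt0.
move: near1 => -[r /= r0 hr].
pose r' := Num.min (r / 2) (1 / 2).
have r'0 : 0 < r' by rewrite lt_min !divr_gt0.
have r'1 : r' <= 1 / 2 by rewrite ge_min lexx orbT.
have r'r : r' < r by rewrite gt_min; apply/orP; left; lra.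
have up := hr (1 + r'); have lo := hr (1 - r').
have {}up : `|l - (x / (1 + r')) `^ (- alpha)| < e / 2.
  by apply: up; rewrite /= opprD addrA subrr sub0r normrN gtr0_norm.
have {}lo : `|l - (x / (1 - r')) `^ (- alpha)| < e / 2.
  by apply: lo; rewrite /= opprB addrC subrK gtr0_norm.
have t1 : 0 < 1 + r' by lra.
have t2 : 0 < 1 - r' by lra.
have /cvgrPdist_lt/(_ _ (divr_gt0 e0 (ltr0Sn _ 1))) r1 := ratio _ t1.
have /cvgrPdist_lt/(_ _ (divr_gt0 e0 (ltr0Sn _ 1))) r2 := ratio _ t2.
near=> n.
have [bn n1] : 0 < b n /\ (1 < n)%N by near: n.
have nn := ltnW n1.
have h1 : `|(x / (1 + r')) `^ (- alpha) - G (x * b n) / G ((1 + r') * b n)| < e / 2 by near: n.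
have h2 : `|(x / (1 - r')) `^ (- alpha) - G (x * b n) / G ((1 - r') * b n)| < e / 2 by near: n.
have N0 := N_gt0 nn.
have u : N n * G (x * b n) <= G (x * b n) / G ((1 + r') * b n).
  rewrite mulrC ler_wpM2l ?(ltW (Gpos _))// -[N n]invrK lef_pV2 ?posrE ?invr_gt0//.
  by apply: b_gt => //; rewrite ltr_pMl//; lra.
have v : G (x * b n) / G ((1 - r') * b n) <= N n * G (x * b n).
  rewrite [leRHS]mulrC ler_wpM2l ?(ltW (Gpos _))// -[N n]invrK lef_pV2 ?posrE ?invr_gt0//.
  apply: ltW; apply: b_lt => //; rewrite gtr_pMl//; lra.
move: lo up h1 h2; rewrite !ltr_distl ler_distl => *; lra.
Unshelve. all: by end_near.
Qed.

End RegularVariation.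

(** * Truncated moments *)

Section Truncation.
Context (R : realType) (d : measure_display) (T : measurableType d).
Variables (P : probability T R) (X : T -> R).
Hypothesis mX : measurable_fun setT X.
Implicit Types x y s : R.

Definition cut x y : R := if `|y| <= x then y else 0.
Let G x := pr P [set w | x < `|X w|].

Lemma measurable_cut x : measurable_fun setT (cut x).
Proof.
apply: measurable_fun_ifT => //.
by apply: measurable_fun_ler => //; exact: measurableT_comp.
Qed.

Lemma cut_le x y : 0 <= x -> `|cut x y| <= x.
Proof. by rewrite /cut; case: ifP => // _; rewrite normr0. Qed.

Lemma bmeas_cut x : 0 <= x -> bmeas (fun w => cut x (X w)).
Proof.
move=> x0; apply: bmeas_comp => //; first exact: measurable_cut.
by exists x => y; exact: cut_le.
Qed.

Lemma measurable_gt x : measurable [set w | x < `|X w|].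
Proof.
rewrite (_ : [set w | _] = setT `&` (fun w => `|X w|) @^-1` `]x, +oo[); last first.
  by apply/seteqP; split => w /=; rewrite in_itv/= andbT; [split | case].
by apply: (measurableT_comp (@normr_measurable R setT) mX) => //; exact: measurable_itv.
Qed.

Lemma second_moment_double x : 0 <= x ->
  Ex P (fun w => cut (2 * x) (X w) ^+ 2) <=
  Ex P (fun w => cut x (X w) ^+ 2) + 4 * x ^+ 2 * G x.
Proof.
move=> x0; have b1 := bmeasX 2 (bmeas_cut x0).
have b2 : bmeas (fun w => cut (2 * x) (X w) ^+ 2).
  by apply: bmeasX; apply: bmeas_cut; rewrite mulr_ge0.
have b3 : bmeas (\1_[set w | x < `|X w|] : T -> R) by apply: bmeas_indic; exact: measurable_gt.
rewrite /G -Ex_indic; last exact: measurable_gt.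
rewrite -ExZ// -ExD//; last exact: bmeasZ.
apply: le_Ex => //; first by apply: bmeasD => //; exact: bmeasZ.
move=> w; rewrite indicE /cut; case: (leP `|X w| x) => Xx.
  have -> : `|X w| <= 2 * x by rewrite (le_trans Xx)// ler_peMl// ler1n.
  by rewrite lerDl mulr_ge0// mulr_ge0// sqr_ge0.
rewrite mem_set// mulr1; case: ifP => // h; last first.
  by rewrite expr0n/= add0r mulr_ge0// sqr_ge0.
rewrite expr0n/= add0r -real_normK ?num_real// (_ : 4 * x ^+ 2 = (2 * x) ^+ 2); last by ring.
by rewrite lerXn2r// nnegrE// mulr_ge0.
Qed.

Lemma truncated_mean_double x : 0 <= x ->
  `|Ex P (fun w => cut (2 * x) (X w)) - Ex P (fun w => cut x (X w))| <= 2 * x * G x.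
Proof.
move=> x0; have b1 := bmeas_cut x0.
have x20 : 0 <= 2 * x by rewrite mulr_ge0.
have b2 := bmeas_cut x20.
have b3 : bmeas (\1_[set w | x < `|X w|] : T -> R) by apply: bmeas_indic; exact: measurable_gt.
rewrite /G -Ex_indic; last exact: measurable_gt.
rewrite -ExZ// -ExB// (le_trans (Ex_norm _ (bmeasB b2 b1)))//.
apply: le_Ex; [exact/bmeas_norm/bmeasB | exact: bmeasZ |].
move=> w; rewrite indicE /cut; case: (leP `|X w| x) => Xx.
  have -> : `|X w| <= 2 * x by rewrite (le_trans Xx)// ler_peMl// ler1n.
  by rewrite subrr normr0 mulr_ge0.
rewrite mem_set// mulr1 subr0; case: ifP => // _.
by rewrite normr0.
Qed.

Section TailBound.
Variables (p C x0 : R).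
Hypotheses (x01 : 1 <= x0) (C0 : 0 < C).
Hypothesis GC : forall x, x0 <= x -> G x <= C * x `^ (- p).

Let x00 : 0 < x0. Proof. exact: lt_le_trans x01. Qed.

(** Karamata-type estimate: each doubling of [x] adds at most [4 C x ^ (2 - p)], hence at most
    [4 C x ^ s]; as [s > 0], these increments grow geometrically and the last one dominates. *)
Lemma second_moment_bound s : 0 < s -> 2 - p <= s -> exists2 K, 0 < K &
  forall x, x0 <= x -> Ex P (fun w => cut x (X w) ^+ 2) <= K * x `^ s.
Proof.
move=> s0 ps; have lt1 : 1 < 2 `^ s :> R.
  by rewrite -[ltLHS](powRr0 2); apply: lt_powR_exp => //; rewrite ltr1n.
(* The first bound covers [[x0, 2 x0]]; the second solves [K + 4 C <= K * 2 ^ s], the induction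
   step. *)
pose K := Num.max ((2 * x0) ^+ 2) (4 * C / (2 `^ s - 1)).
have K1 : (2 * x0) ^+ 2 <= K by rewrite le_max lexx.
have K2 : 4 * C / (2 `^ s - 1) <= K by rewrite le_max lexx orbT.
have K0 : 0 < K by apply: lt_le_trans K1; rewrite exprn_gt0// mulr_gt0.
exists K => //; apply: (dyadic_ind x00) => x xx.
  move=> x2; have xp : 0 <= x by rewrite (le_trans (ltW x00)).
  have x1 : 1 <= x `^ s.
    by rewrite -[leLHS](powRr0 x); apply: le_powR_exp; [exact: le_trans xx | exact: ltW].
  apply: (@le_trans _ _ K); last by rewrite ler_peMr// ltW.
  apply: le_trans K1; apply: (@le_trans _ _ (x ^+ 2)).
    rewrite -[leRHS](Ex_cst P); apply: le_Ex.
    - exact/bmeasX/bmeas_cut.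
    - exact: bmeas_cst.
    - by move=> w; rewrite -real_normK ?num_real// lerXn2r// ?nnegrE// cut_le.
  by rewrite lerXn2r// nnegrE mulr_ge0// ltW.
have xp : 0 < x by rewrite (lt_le_trans x00).
move=> IH; apply: (le_trans (second_moment_double (ltW xp))).
rewrite powRM//; last exact: ltW.
have hG : 4 * x ^+ 2 * G x <= 4 * C * x `^ s.
  rewrite -(mulrA 4 (x ^+ 2)) -(mulrA 4 C) ler_wpM2l//.
  apply: (@le_trans _ _ (x ^+ 2 * (C * x `^ (- p)))).
    by rewrite ler_wpM2l ?GC// sqr_ge0.
  rewrite mulrCA ler_wpM2l ?(ltW C0)// -powR_mulrn; last exact: ltW.
  rewrite -powR_add//; apply: le_powR_exp => //; first exact: le_trans xx.
apply: (le_trans (lerD IH hG)).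
rewrite -mulrDl mulrA ler_wpM2r ?powR_ge0//.
have : 4 * C <= K * (2 `^ s - 1) by rewrite -ler_pdivrMr// subr_gt0.
by rewrite mulrBr mulr1 lerBrDl.
Qed.

Hypothesis p1 : 1 < p.

(** Each doubling changes the truncated mean by at most [2 C x ^ (1 - p)]. As [p > 1], these changes
    decrease geometrically, and [K] is [2 C] times the sum of the series. *)
Lemma truncated_mean_dyadic : exists2 K, 0 < K & forall J x, x0 <= x ->
  `|Ex P (fun w => cut (2 ^+ J * x) (X w)) - Ex P (fun w => cut x (X w))| <=
  K * x `^ (1 - p).
Proof.
have lt1 : 2 `^ (1 - p) < 1 :> R.
  by rewrite -[ltRHS](powRr0 2); apply: lt_powR_exp; rewrite ?ltr1n// subr_lt0.
pose K := 2 * C / (1 - 2 `^ (1 - p)).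
have KE : K * (1 - 2 `^ (1 - p)) = 2 * C by rewrite divfK// subr_eq0 gt_eqF.
have K0 : 0 < K by rewrite divr_gt0// ?mulr_gt0// subr_gt0.
exists K => //; elim=> [|J IH] x xx.
  by rewrite expr0 mul1r subrr normr0 mulr_ge0 ?powR_ge0// ltW.
have xp : 0 < x by rewrite (lt_le_trans x00).
rewrite -(subrKA (Ex P (fun w => cut (2 * x) (X w)))).
apply: (le_trans (ler_normD _ _)).
have h1 := IH (2 * x) (le_trans xx (ler_peMl (ltW xp) (ler1n R 2))).
rewrite mulrA -exprSr in h1.
have h2 := truncated_mean_double (ltW xp).
have h3 : 2 * x * G x <= 2 * C * x `^ (1 - p).
  rewrite -!mulrA ler_wpM2l// mulrC.
  apply: (@le_trans _ _ (C * x `^ (- p) * x)); first by rewrite ler_pM2r// GC.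
  by rewrite -mulrA ler_wpM2l ?(ltW C0)// addrC powR_add// powRr1// ltW.
apply: (le_trans (lerD h1 (le_trans h2 h3))).
rewrite powRM//; last exact: ltW.
by rewrite -KE mulrA -mulrDl mulrBr mulr1 addrCA subrr addr0.
Qed.

(** Lets [J] tend to infinity in [truncated_mean_dyadic]: by dominated convergence the truncated
    means tend to the mean, which is 0. *)
Lemma truncated_mean_bound : ('E_P[X] = 0)%E -> exists2 K, 0 < K & forall x, x0 <= x ->
  `|Ex P (fun w => cut x (X w))| <= K * x `^ (1 - p).
Proof.
(* Integrability is extracted from the value of the expectation: with an infinite positive or
   negative part the difference would be infinite, [+oo - +oo] being [-oo], and not 0. *)
move=> EX; have iX : P.-integrable setT (EFin \o X).
  apply/integrableP; split; first exact/measurable_EFinP.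
  move: EX; rewrite unlock integralE => EX.
  have [fp fn] : (\int[P]_x ((EFin \o X)^\+ x))%E \is a fin_num /\
      (\int[P]_x ((EFin \o X)^\- x))%E \is a fin_num.
    have : ((\int[P]_x ((EFin \o X)^\+ x)) - (\int[P]_x ((EFin \o X)^\- x)))%E \is a fin_num.
      by rewrite EX.
    by rewrite fin_numB => /andP[].
  have mE : measurable_fun setT (EFin \o X) by exact/measurable_EFinP.
  rewrite (eq_integral (fun w => (EFin \o X)^\+ w + (EFin \o X)^\- w)%E); last first.
    by move=> w _; rewrite -[RHS]/(((EFin \o X)^\+ \+ (EFin \o X)^\-)%E w) -fune_abse.
  rewrite ge0_integralD//; [|exact: measurable_funepos|exact: measurable_funeneg].
  by apply: lte_add_pinfty; rewrite -ge0_fin_numE// integral_ge0.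
have [K K0 hK] := truncated_mean_dyadic; exists K => // x xx.
have xp : 0 < x by rewrite (lt_le_trans x00).
have cv : Ex P (fun w => cut (2 ^+ J * x) (X w)) @[J --> \oo] --> (0 : R).
  have := @dominated_cvg _ _ _ P setT measurableT
    (fun J w => (cut (2 ^+ J * x) (X w))%:E) (EFin \o X) (fun w => `|X w|%:E).
  move=> /(_ _ _ _ _ _) h.
  have {}h : ((\int[P]_w (cut (2 ^+ J * x) (X w))%:E)%E @[J --> \oo] --> 0%:E)%E.
    have EX' : (\int[P]_w (EFin \o X) w)%E = 0%:E by move: EX; rewrite unlock.
    rewrite -EX'; apply: h => //.
    - by move=> J; apply/measurable_EFinP; apply: measurableT_comp => //; exact: measurable_cut.
    - move=> w _; apply/fine_cvgP; split; first by apply: nearW.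
      apply: cvg_near_cst; exists (Num.truncn (`|X w| / x)).+1 => // J /= JJ.
      rewrite /cut ifT// -ler_pdivrMr//; apply: (le_trans (ltW (truncnS_gt _))).
      by rewrite -natrX ler_nat (leq_trans JJ)// ltnW// ltn_expl.
    - by have := integrable_abse iX.
    - by move=> J w _; rewrite lee_fin /cut; case: ifP => // _; rewrite normr0.
  by have /fine_cvgP[_] := h.
have : `|0 - Ex P (fun w => cut x (X w))| <= K * x `^ (1 - p).
  have cv' : `|Ex P (fun w => cut (2 ^+ J * x) (X w)) - Ex P (fun w => cut x (X w))|
      @[J --> \oo] --> `|0 - Ex P (fun w => cut x (X w))|.
    by apply: cvg_norm; apply: cvgB => //; exact: cvg_cst.
  rewrite -(cvg_lim (@norm_hausdorff _ R) cv'); apply: limr_le; first exact: cvgP cv'.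
  by apply: nearW => J; exact: hK.
by rewrite sub0r normrN.
Qed.

End TailBound.
End Truncation.

(** * Configurations of points *)

Section PointwiseContinuity.
Import ArrowAsProduct.

Lemma ptws_continuous (X : topologicalType) (U : choiceType) (V : topologicalType)
    (W : X -> U -> V) : (forall u, continuous (W ^~ u)) ->
  continuous (W : X -> {ptws U -> V}).
Proof.
move=> h x; apply/cvg_sup => i; move: x; apply/(@continuousP _ (initial_topology (@^~ i))) => A [B oB E].
rewrite -E; have -> : W @^-1` (@^~ i @^-1` B) = (W ^~ i) @^-1` B by [].
by apply: open_comp => // + _; exact: h.
Qed.

Lemma continuous_compose (X Y Z : topologicalType) (f : X -> Y) (g : Y -> Z) :
  continuous f -> continuous g -> continuous (fun x => g (f x)).
Proof. by move=> cf cg x; apply: continuous_comp; [exact: cf | exact: cg]. Qed.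

Lemma continuous_dist (R : realType) (X : topologicalType) (f g : X -> R) :
  continuous f -> continuous g -> continuous (fun x => `|f x - g x|).
Proof.
by move=> cf cg x; apply: cvg_norm; apply: cvgB; [exact: cf | exact: cg].
Qed.

Lemma continuous_bigsum (R : realType) (X : topologicalType) (F : nat -> X -> R) J :
  (forall j, continuous (F j)) -> continuous (fun z => \sum_(j < J) F j z).
Proof.
move=> cF; elim: J => [|J IH].
  have -> : (fun z => \sum_(j < 0) F j z) = cst 0 by apply/funext => z; rewrite big_ord0.
  by move=> z; exact: cvg_cst.
have -> : (fun z => \sum_(j < J.+1) F j z) = (fun z => \sum_(j < J) F j z) \+ F J.
  by apply/funext => z; rewrite big_ord_recr.
by move=> z; apply: cvgD; [exact: IH | exact: cF].
Qed.

End PointwiseContinuity.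

Lemma dist_min_lt (R : realFieldType) (a b c e : R) :
  `|a - b| < e -> `|Num.min a c - Num.min b c| < e.
Proof.
rewrite /Num.min !ltr_norml => /andP[h3 h4].
by apply/andP; split; case: (ltP a c) => h1; case: (ltP b c) => h2; lra.
Qed.

Section TestFunctions.
Variable R : realType.
Local Notation RB := (measurableTypeR R).

Lemma test_support (f : testFun R) :
  exists u v, 0 < u /\ forall x, ~ (u <= x <= v) -> f x = 0.
Proof.
have [K [cK K0 fK]] := tf_supp f.
have [M [_ KM]] := compact_bounded cK.
have clK := compact_closed (@norm_hausdorff _ R) cK.
have nK0 : ~ K 0 by move=> /K0; rewrite /= in_itv/= ltxx.
have [r /= r0 hr] : nbhs (0 : R) (~` K).
  by apply: open_nbhs_nbhs; split => //; exact: closed_openC.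
exists r, (M + 1); split => // x nx; apply: fK => Kx; apply: nx.
have xp : 0 < x by move: (K0 _ Kx); rewrite /= in_itv/= andbT.
apply/andP; split.
  rewrite leNgt; apply/negP => xr; apply: (hr x) => //.
  by rewrite /= sub0r normrN gtr0_norm.
have := KM (M + 1) ltac:(by rewrite ltrDl) x Kx.
by move=> /= /(le_trans (ler_norm x)).
Qed.

Lemma test_measurable (f : testFun R) : measurable_fun [set: RB] (f : RB -> R).
Proof. by apply: (@continuous_measurable_fun R); exact: tf_cont. Qed.

Lemma eq_test_integral (mu nu : {measure set RB -> \bar R}) (f : testFun R) (u v : R) :
  (forall x, ~ (u <= x <= v) -> f x = 0) ->
  (forall A : set RB, measurable A -> A `<=` `[u, v]%classic -> mu A = nu A) ->
  \int[mu]_x f x = \int[nu]_x f x.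
Proof.
move=> f0 mn.
have mD : measurable (`[u, v]%classic : set RB) by exact: measurable_itv.
have fE : f \_ `[u, v]%classic = f :> (RB -> R).
  apply/funext => x; rewrite patchE; case: ifPn => // /negP xuv.
  rewrite f0// => uxv; apply: xuv; apply/mem_set; rewrite /= in_itv/= uxv//.
have H (m : {measure set RB -> \bar R}) : \int[m]_x f x = \int[m]_(x in `[u, v]%classic) f x.
  by rewrite [RHS]Rintegral_mkcond fE.
rewrite !H /Rintegral; congr fine; apply: eq_measure_integral => A mA AD.
exact: mn.
Qed.

Lemma integral_msum_dirac (J : nat) (z : nat -> R) (f : testFun R) :
  \int[msum (fun j => [the measure _ _ of \d_(z j : RB)]) J]_x f x = \sum_(j < J) f (z j).
Proof.
have mf : measurable_fun [set: RB] (EFin \o f) by apply/measurable_EFinP; exact: test_measurable.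
rewrite /Rintegral integralE.
rewrite ge0_integral_measure_sum//; last exact: measurable_funepos.
rewrite ge0_integral_measure_sum//; last exact: measurable_funeneg.
have -> : (\sum_(j < J) \int[\d_(z j : RB)]_x (EFin \o f)^\+ x)%E = (\sum_(j < J) Num.max (f (z j)) 0)%:E.
  rewrite -sumEFin; apply: eq_bigr => j _.
  by rewrite integral_dirac//; [rewrite diracT mul1e funeposE/= -EFin_max | exact: measurable_funepos].
have -> : (\sum_(j < J) \int[\d_(z j : RB)]_x (EFin \o f)^\- x)%E = (\sum_(j < J) Num.max (- f (z j)) 0)%:E.
  rewrite -sumEFin; apply: eq_bigr => j _.
  by rewrite integral_dirac//; [rewrite diracT mul1e funenegE/= -EFin_max | exact: measurable_funeneg].
rewrite -EFinB/= -sumrB; apply: eq_bigr => j _.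
by rewrite /Num.max; case: ltP => h1; case: ltP => h2; lra.
Qed.

End TestFunctions.

Section Configurations.
Variables (R : realType) (c : nat -> R).
Local Notation RB := (measurableTypeR R).
Hypothesis c_small : forall e, 0 < e -> exists J : nat, forall j, (J <= j)%N -> c j < e.

(* The cap makes every configuration locally finite on ]0, +oo[ and the map
   [config] continuous. *)
Let capped (z : nat -> R) j := Num.min (z j) (c j).

Definition config_measure (z : nat -> R) : {measure set RB -> \bar R} :=
  mrestr (mseries (fun j => [the measure _ _ of \d_(capped z j : RB)]) 0)
    (@measurable_pos_half_line R).

Lemma config_measureE z (J : nat) (u : R) (A : set RB) : 0 < u ->
  (forall j, (J <= j)%N -> c j < u) -> (forall x, A x -> u <= x) ->
  config_measure z A = msum (fun j => [the measure _ _ of \d_(capped z j : RB)]) J A.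
Proof.
move=> u0 cJ Au; rewrite /config_measure /= /mrestr (_ : A `&` _ = A); last first.
  apply/seteqP; split => x; first by case.
  by move=> Ax; split => //=; rewrite in_itv/= andbT (lt_le_trans u0)// Au.
rewrite /mseries (nneseries_split 0 J)//= add0n [X in (_ + X)%E]eseries0 ?adde0.
  by rewrite big_mkord.
move=> j Jj _; rewrite diracE memNset// => Az.
have := Au _ Az; rewrite leNgt => /negP; apply.
by apply: le_lt_trans (cJ j Jj); rewrite ge_min lexx orbT.
Qed.

Lemma config_measure_neg z : config_measure z `]-oo, 0]%classic = 0%E.
Proof.
rewrite /config_measure /= /mrestr (_ : _ `&` _ = set0) ?measure0//.
apply/seteqP; split=> x //=; rewrite !in_itv/= andbT => -[x0].
by rewrite ltNge x0.
Qed.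

Lemma config_measure_int z (u v : R) (B : set RB) : 0 < u -> measurable B ->
  B `<=` `[u, v]%classic -> exists k : nat, config_measure z B = (k%:R)%:E.
Proof.
move=> u0 mB BD; have [J hJ] := c_small u0.
rewrite (config_measureE z u0 hJ) /msum; last by move=> x /BD; rewrite /= in_itv => /andP[].
elim: J {hJ} => [|J [k IH]]; first by exists 0%N; rewrite big_ord0.
by rewrite big_ord_recr /= IH /= diracE -EFinD -natrD; eexists.
Qed.

Definition config z : pointMeasure R :=
  PointMeasure (config_measure_neg z) (@config_measure_int z).

Lemma config_test z (f : testFun R) (J : nat) (u v : R) : 0 < u ->
  (forall x, ~ (u <= x <= v) -> f x = 0) -> (forall j, (J <= j)%N -> c j < u) ->
  pm_int_test (config z) f = \sum_(j < J) f (capped z j).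
Proof.
move=> u0 fuv cJ; rewrite -integral_msum_dirac /pm_int_test.
apply: (eq_test_integral fuv) => A mA AD.
by apply: (config_measureE z u0 cJ) => x /AD; rewrite /= in_itv => /andP[].
Qed.

Import ArrowAsProduct.

Lemma coord_continuous j : continuous (fun z : {ptws nat -> R} => z j).
Proof. exact: (@proj_continuous nat (fun=> R) j). Qed.

(** The vague topology is an initial one, so continuity is tested on one [f] at a time. The support
    of [f] stays away from 0 while the caps tend to 0, so the integral involves finitely many
    coordinates. *)
Lemma config_continuous : continuous (config : {ptws nat -> R} -> pointMeasure R).
Proof.
suff H : continuous (fun z : {ptws nat -> R} => (pm_int_test (config z) : {ptws testFun R -> R})).
  exact: (@continuous_comp_initial (pointMeasure R) {ptws nat -> R} {ptws testFun R -> R} (@pm_int_test R) config H).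
apply: (@ptws_continuous {ptws nat -> R} (testFun R) R) => f.
have [u [v [u0 fuv]]] := test_support f; have [J hJ] := c_small u0.
have -> : (fun z : {ptws nat -> R} => pm_int_test (config z) f) =
    (fun z => \sum_(j < J) f (capped z j)).
  by apply/funext => z'; rewrite (config_test _ u0 fuv hJ).
apply: (@continuous_bigsum R {ptws nat -> R} (fun j z => f (capped z j))) => {hJ}J.
move=> z; apply: (@continuous_comp _ _ _ (fun z : {ptws nat -> R} => capped z J) (f : R -> R)); last exact: tf_cont.
apply: (@continuous_comp _ _ _ (fun z : {ptws nat -> R} => z J) (fun x => Num.min x (c J))).
  exact: coord_continuous.
apply/cvgrPdist_lt => e e0; near=> x.
have : `|z J - x| < e by near: x; exists e.
exact: dist_min_lt.
Unshelve. all: by end_near.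
Qed.

(** The initial topology does not separate measures with equal test integrals. This justifies
    replacing [X w] by a configuration that is compared with it through test integrals only. *)
Lemma continuous_pm_eq (Phi : pointMeasure R -> R) (mu nu : pointMeasure R) :
  continuous Phi -> pm_int_test mu = pm_int_test nu -> Phi mu = Phi nu.
Proof.
move=> cP mn; apply/eqP/negPn/negP => neq.
pose e := `|Phi mu - Phi nu|.
have e0 : 0 < e by rewrite normr_gt0 subr_eq0.
have : nbhs mu (Phi @^-1` ball (Phi mu) e) by apply: cP; exact: nbhsx_ballx.
rewrite nbhsE => -[A [[B oB BA] Amu] Asub].
have : A nu by rewrite -BA /= -mn; move: Amu; rewrite -BA.
by move=> /Asub; rewrite /= /ball /= ltxx.
Qed.

(** Uniform continuity on a compact product, stated without a metric. If it failed, there would be a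
    violating pair for every [m]; by Tychonoff these pairs have a cluster point, its two halves
    coincide, and the difference of the values of [Phi] vanishes there by continuity. *)
Lemma uniform_on_box (Phi : pointMeasure R -> R) (eta : R) :
  continuous Phi -> 0 < eta -> exists m : nat, forall z z' : nat -> R,
    (forall j, 0 <= z j <= c j) -> (forall j, 0 <= z' j <= c j) ->
    (forall j, (j < m)%N -> `|z j - z' j| <= m.+1%:R^-1) ->
    `|Phi (config z) - Phi (config z')| <= eta.
Proof.
move=> cP eta0; apply/not_existsP => nex.
have {nex} viol m : exists zz : (nat -> R) * (nat -> R),
    [/\ forall j, 0 <= zz.1 j <= c j, forall j, 0 <= zz.2 j <= c j,
    forall j, (j < m)%N -> `|zz.1 j - zz.2 j| <= m.+1%:R^-1 &
    eta < `|Phi (config zz.1) - Phi (config zz.2)|].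
  apply: contrapT => nz; apply: (nex m) => z z' h1 h2 h3.
  by rewrite leNgt; apply/negP => h4; apply: nz; exists (z, z').
have [Z ZP] := choice viol.
(* The boolean stores the two configurations of a pair in one point of a single product space. *)
pose W m : {ptws (nat * bool)%type -> R} := fun p => if p.2 then (Z m).1 p.1 else (Z m).2 p.1.
have cbox : compact [set f : forall p : nat * bool, R | forall p, `[0, c p.1]%classic (f p)].
  by apply: (@tychonoff (nat * bool)%type (fun=> R) (fun p => `[0, c p.1]%classic)) => p; exact: segment_compact.
have FW : (W @ \oo) [set f : forall p : nat * bool, R | forall p, `[0, c p.1]%classic (f p)].
  exists 0%N => // m _ [j b] /=; rewrite in_itv/= /W /=.
  by have [h1 h2 _ _] := ZP m; case: b.
have [y [_ yW]] := cbox _ _ FW.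
have cont_coord p : continuous (fun f : {ptws (nat * bool)%type -> R} => f p).
  exact: (@proj_continuous (nat * bool)%type (fun=> R) p).
have ysame j : y (j, true) = y (j, false).
  apply/eqP/negPn/negP => neq; pose e := `|y (j, true) - y (j, false)|.
  have e0 : 0 < e by rewrite normr_gt0 subr_eq0.
  have cd : continuous (fun f : {ptws (nat * bool)%type -> R} => `|f (j, true) - f (j, false)|).
    exact: (continuous_dist (cont_coord (j, true)) (cont_coord (j, false))).
  have nb : nbhs (y : {ptws (nat * bool)%type -> R})
      [set f | e / 2 < `|f (j, true) - f (j, false)|].
    by apply: (cvgr_gt _ (cd y)); rewrite ltr_pdivrMr// ltr_pMr// ltr1n.
  (* From [M] on, coordinate [j] is among the controlled ones and the tolerance is at most
     [e / 2]. *)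
  pose M := maxn j.+1 (Num.truncn (2 / e)).+1.
  have FM : (W @ \oo) [set f | exists2 m, (M <= m)%N & f = W m].
    by exists M => // m Mm; exists m.
  have [f [[m Mm ->]]] := yW _ _ FM nb.
  have [_ _ /(_ j) h _] := ZP m; rewrite /= /W /= ltNge => /negP; apply.
  apply: (le_trans (h _)); first by apply: leq_trans Mm; rewrite leq_max ltnSn.
  rewrite -[leRHS]invrK lef_pV2 ?posrE ?ltr0n ?invr_gt0 ?divr_gt0// invf_div.
  apply: (le_trans (ltW (truncnS_gt _))); rewrite ler_nat ltnS.
  by rewrite (leq_trans _ (leq_trans (leq_maxr _ _) Mm)).
pose D (f : {ptws (nat * bool)%type -> R}) :=
  Phi (config (fun j => f (j, true))) - Phi (config (fun j => f (j, false))).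
have sub_cont b : continuous (fun f : {ptws (nat * bool)%type -> R} =>
    (fun j => f (j, b)) : {ptws nat -> R}).
  by apply: ptws_continuous => j; exact: cont_coord.
have Psi_cont b : continuous (fun f : {ptws (nat * bool)%type -> R} =>
    Phi (config (fun j => f (j, b)))).
  exact: (continuous_compose (continuous_compose (sub_cont b) config_continuous) cP).
have cn : continuous (fun f : {ptws (nat * bool)%type -> R} => `|D f|).
  exact: (continuous_dist (Psi_cont true) (Psi_cont false)).
have Dy : D y = 0.
  by rewrite /D (_ : (fun j => y (j, true)) = (fun j => y (j, false))) ?subrr//; exact/funext.
have nb : nbhs (y : {ptws (nat * bool)%type -> R}) [set f | `|D f| < eta].
  by apply: (cvgr_lt _ (cn y)); rewrite Dy normr0.
have FA : (W @ \oo) [set f | exists m, f = W m] by exists 0%N => // m _; exists m.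
have [f [[m ->]]] := yW _ _ FA nb.
by have [_ _ _ h] := ZP m; rewrite /= ltNge /D /W /= (ltW h).
Qed.

End Configurations.

Lemma sum_ltn_ord J k : (\sum_(j < J) (j < k) = minn J k)%N.
Proof. by elim: J => [|J IH]; rewrite ?big_ord0 ?big_ord_recr /= ?IH; lia. Qed.

Section Representation.
Variables (R : realType) (X : pointMeasure R) (K : R -> nat) (C : R).
Local Notation RB := (measurableTypeR R).
Hypothesis XK : forall x, 0 < x -> X `]x, +oo[%classic = ((K x)%:R)%:E.
Hypotheses (C0 : 0 < C) (KC : K C = 0%N).

(* The atom of rank [j] (counted from 0, with multiplicity), or 0 if there are
   at most [j] atoms. *)
Definition point_loc j : R := sup ([set 0] `|` [set x : R | 0 < x /\ (j < K x)%N]).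

Let K_mono x y : 0 < x -> x <= y -> (K y <= K x)%N.
Proof.
move=> x0 xy; rewrite -(ler_nat R) -lee_fin -!XK ?(lt_le_trans x0)//.
apply: le_measure; rewrite ?inE; [exact: measurable_itv | exact: measurable_itv |].
by move=> z /=; rewrite !in_itv/= !andbT; exact: le_lt_trans.
Qed.

Let set_ub j : ubound ([set 0] `|` [set x : R | 0 < x /\ (j < K x)%N]) C.
Proof.
move=> x [->|[x0 jx]]; first exact: ltW.
by rewrite leNgt; apply/negP => Cx; move: (leq_trans jx (K_mono C0 (ltW Cx))); rewrite KC.
Qed.

Let has_sup_set j : has_sup ([set 0] `|` [set x : R | 0 < x /\ (j < K x)%N]).
Proof. by split; [exists 0; left | exists C; exact: set_ub]. Qed.

Lemma point_loc_ge0 j : 0 <= point_loc j.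
Proof. by apply: ub_le_sup; [exists C; exact: set_ub | left]. Qed.

Lemma point_loc_le j : point_loc j <= C.
Proof. by apply: ge_sup; [exists 0; left | exact: set_ub]. Qed.

(** Right continuity of the ray counts: []x, +oo[] is the increasing union of the rays from
    [x + 1 / (k + 1)], and a convergent sequence of integers attains its limit. *)
Let K_right x j : 0 < x -> (j < K x)%N -> exists2 y, x < y & (j < K y)%N.
Proof.
move=> x0 jK; pose F k : set RB := `]x + k.+1%:R^-1, +oo[%classic.
have UF : \bigcup_k F k = `]x, +oo[%classic.
  apply/seteqP; split => y /=.
    move=> [k _]; rewrite /F /= !in_itv/= !andbT; apply: lt_trans.
    by rewrite ltrDl invr_gt0.
  rewrite in_itv/= andbT => xy; have yx : 0 < y - x by rewrite subr_gt0.
  exists (Num.truncn (y - x)^-1) => //; rewrite /F /= in_itv/= andbT -ltrBrDl.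
  by rewrite invf_plt ?posrE// truncnS_gt.
have := @nondecreasing_cvg_mu _ _ _ X F; rewrite UF XK// => /(_ _ _ _) h.
have {}h : X (F k) @[k --> \oo] --> ((K x)%:R)%:E.
  apply: h; [by move=> k; exact: measurable_itv | exact: measurable_itv |].
  apply/nondecreasing_seqP => k; apply/subsetPset => y; rewrite /F /= !in_itv/= !andbT.
  by apply: le_lt_trans; rewrite lerD2l lef_pV2 ?posrE ?ltr0n// ler_nat.
have pos k : 0 < x + k.+1%:R^-1 by rewrite addr_gt0 ?invr_gt0.
have {}h : (K (x + k.+1%:R^-1))%:R @[k --> \oo] --> ((K x)%:R : R).
  have /fine_cvgP[_] := h; apply: cvg_trans; apply: near_eq_cvg; apply: nearW => k /=.
  by rewrite /F XK.
have hj : ((K x)%:R - 2^-1 : R) < (K x)%:R by rewrite ltrBlDr ltrDl invr_gt0.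
have [k _ /(_ k (leqnn k))] := cvgr_gt _ h _ hj => /= hk.
exists (x + k.+1%:R^-1); first by rewrite ltrDl invr_gt0.
have : (K x <= K (x + k.+1%:R^-1))%N; last exact: leq_trans.
rewrite -ltnS -(ltr_nat R) -natr1.
apply: (@lt_trans _ _ ((K (x + k.+1%:R^-1))%:R + 2^-1)); first by rewrite -ltrBlDr.
by rewrite ltrD2l invf_lt1// ltr1n.
Qed.

(** Atoms and ray counts determine each other. From counts to atoms, strictness comes from right
    continuity. *)
Lemma point_loc_gt j x : 0 < x -> (x < point_loc j) = (j < K x)%N.
Proof.
move=> x0; apply/idP/idP => [|jK].
  move=> /(sup_gt (has_sup_set j).1)[y [->|[y0 jy]] xy].
    by move: xy; rewrite ltNge (ltW x0).
  by apply: leq_trans jy _; apply: K_mono => //; exact: ltW.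
have [y xy jy] := K_right x0 jK; apply: (lt_le_trans xy).
apply: ub_le_sup; first by exists C; exact: set_ub.
by right; split => //; exact: lt_trans xy.
Qed.

Variable c : nat -> R.
Hypothesis c_small : forall e, 0 < e -> exists J : nat, forall j, (J <= j)%N -> c j < e.
Hypothesis loc_c : forall j, point_loc j <= c j.

Let config_ray x : 0 < x ->
  config_measure c point_loc `]x, +oo[%classic = ((K x)%:R)%:E.
Proof.
move=> x0; have [J hJ] := c_small x0.
rewrite (config_measureE _ x0 hJ); last by move=> y; rewrite /= in_itv/= andbT => /ltW.
have KJ : (K x <= J)%N.
  rewrite leqNgt; apply/negP => JK; have := hJ J (leqnn J); rewrite ltNge => /negP; apply.
  by apply: le_trans (loc_c J); rewrite ltW// point_loc_gt.
rewrite /msum (eq_bigr (fun j : 'I_J => ((j < K x)%N%:R)%:E)); last first.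
  move=> j _; rewrite /= diracE; congr ((_ : nat)%:R%:E).
  rewrite min_l//; congr nat_of_bool; apply/idP/idP => [/set_mem|jK].
    by rewrite /= in_itv/= andbT point_loc_gt.
  by apply/mem_set; rewrite /= in_itv/= andbT point_loc_gt.
rewrite sumEFin -natr_sum; congr (_%:R%:E).
by rewrite sum_ltn_ord (minn_idPr KJ).
Qed.

(** Both measures agree on rays with positive end, and rays form a pi-system. Restricting to the ray
    [D], which contains the support of [f], makes all masses finite, so uniqueness of measures
    applies. *)
Lemma point_rep : pm_int_test X = pm_int_test (config c_small point_loc).
Proof.
apply/funext => f; have [u [v [u0 fuv]]] := test_support f.
apply: (eq_test_integral fuv) => A mA AD.
pose D : set RB := `]u / 2, +oo[%classic.
have mD : measurable D by exact: measurable_itv.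
have u20 : 0 < u / 2 by rewrite divr_gt0.
pose m1 := mrestr X mD; pose m2 := mrestr (config_measure c point_loc) mD.
have AD' : A `&` D = A.
  apply/seteqP; split => y; [by case | move=> Ay; split => //].
  move: (AD _ Ay); rewrite /D /= !in_itv/= andbT => /andP[uy _].
  by apply: lt_le_trans uy; rewrite gtr_pMr// invf_lt1// ltr1n.
suff : m1 A = m2 A by rewrite /m1 /m2 /= /mrestr AD'.
have rayD x : `]x, +oo[%classic `&` D = `]Num.max x (u / 2), +oo[%classic.
  apply/seteqP; split => y; rewrite /D /= !in_itv/= !andbT gt_max.
    by case=> -> ->.
  by move=> /andP[].
have maxp x : 0 < Num.max x (u / 2) by rewrite lt_max u20 orbT.
apply: (@measure_unique _ _ _ [set B : set RB | exists x, B = `]x, +oo[%classic]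
  (fun k => `](- k%:R)%R, +oo[%classic)) => //.
- exact: RGenOInfty.measurableE.
- move=> B B' [x ->] [y ->]; exists (Num.max x y); apply/seteqP; split => z /=;
    rewrite !in_itv/= !andbT gt_max; [by case=> -> -> | by move=> /andP[]].
- by move=> k; eexists.
- apply/seteqP; split => // y _; exists (Num.truncn `|y|).+1 => //=.
  rewrite in_itv/= andbT ltrNl (le_lt_trans (ler_norm _))// normrN.
  exact: truncnS_gt.
- move=> B [x ->].
  rewrite -[LHS]/(X (`]x, +oo[%classic `&` D)).
  rewrite -[RHS]/(config_measure c point_loc (`]x, +oo[%classic `&` D)).
  by rewrite rayD XK// config_ray.
- move=> k; rewrite -[ltLHS]/(X (`](- k%:R)%R, +oo[%classic `&` D)).
  by rewrite rayD XK// ltry.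
Qed.

End Representation.

(** * A convergence criterion for point processes *)

Section NonmeasurableExpectation.
Context (R : realType) (d : measure_display) (T : measurableType d).
Variable P : probability T R.

(** The integral of a nonnegative function is a supremum over the simple functions below it, hence
    monotone even for nonmeasurable [u] and [v]. *)
Let le_integral_nonneg (u v : T -> \bar R) :
  (forall w, 0 <= u w)%E -> (forall w, u w <= v w)%E ->
  (\int[P]_w u w <= \int[P]_w v w)%E.
Proof.
move=> u0 uv; have v0 w : (0 <= v w)%E by apply: le_trans (uv w).
rewrite !ge0_integralTE//; apply: ereal_sup_le => _ [h hu <-].
by exists h => // w; apply: le_trans (uv w); exact: hu.
Qed.

Let Ex_EFin (g : T -> R) : bmeas g -> (\int[P]_w (g w)%:E)%E = (Ex P g)%:E.
Proof. by move=> bg; rewrite /Ex /Rintegral fineK// integrable_fin_num// bmeas_integrable. Qed.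

Let bmeas_max0 (g : T -> R) : bmeas g -> bmeas (fun w => Num.max (g w) 0).
Proof.
move=> [mg [M gM]]; split; first exact: measurable_funrpos.
exists M => w; apply: le_trans (gM w); rewrite /Num.max; case: ltP => h.
  by rewrite normr0.
by [].
Qed.

Let int_close (f g e : T -> R) : bmeas g -> bmeas e -> (forall w, 0 <= g w) ->
  (forall w, 0 <= f w) -> (forall w, `|f w - g w| <= e w) ->
  exists r, (\int[P]_w (f w)%:E)%E = r%:E /\ `|r - Ex P g| <= Ex P e.
Proof.
move=> bg be g0 f0 fg.
have up : (\int[P]_w (f w)%:E <= (Ex P g + Ex P e)%:E)%E.
  rewrite -ExD// -Ex_EFin; last exact: bmeasD.
  apply: le_integral_nonneg => w; rewrite lee_fin//.
  by have := fg w; rewrite ler_distl => /andP[]; lra.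
have lo : ((Ex P g - Ex P e)%:E <= \int[P]_w (f w)%:E)%E.
  have bmx := bmeas_max0 (bmeasB bg be).
  apply: (@le_trans _ _ (Ex P (fun w => Num.max (g w - e w) 0))%:E).
    rewrite lee_fin -ExB//; apply: le_Ex => //; first exact: bmeasB.
    by move=> w; rewrite le_max lexx.
  rewrite -Ex_EFin//; apply: le_integral_nonneg => w; rewrite lee_fin.
    by rewrite le_max lexx orbT.
  by rewrite ge_max f0 andbT; have := fg w; rewrite ler_distl => /andP[]; lra.
have fin : (\int[P]_w (f w)%:E)%E \is a fin_num.
  rewrite fin_numE; apply/andP; split.
    by apply/eqP => h; rewrite h in lo.
  by apply/eqP => h; rewrite h in up.
exists (fine (\int[P]_w (f w)%:E)%E); rewrite fineK//; split => //.
by move: up lo; rewrite -(fineK fin) !lee_fin /= ler_distl => h1 h2; apply/andP; split; lra.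
Qed.

(* [f] need not be measurable; this avoids a proof that [Phi \o N] is. *)
Lemma expectation_close (f g e : T -> R) : bmeas g -> bmeas e ->
  (forall w, `|f w - g w| <= e w) ->
  exists r, ('E_P[f] = r%:E)%E /\ `|r - Ex P g| <= Ex P e + Ex P e.
Proof.
move=> bg be fg.
have max0_dist (a b c : R) : `|a - b| <= c -> `|Num.max a 0 - Num.max b 0| <= c.
  rewrite !ler_norml /Num.max => /andP[h3 h4].
  by case: (ltP a 0) => h1; case: (ltP b 0) => h2; apply/andP; split; lra.
have bmg := bmeas_max0 bg.
have bmgN : bmeas (fun w => Num.max (- g w) 0).
  have bgN : bmeas (fun w => - g w).
    by have := bmeasZ (-1) bg; under eq_fun do rewrite mulN1r.
  exact: bmeas_max0 bgN.
have max0 (a : R) : 0 <= Num.max a 0 by rewrite le_max lexx orbT.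
have [r1 [E1 h1]] := int_close bmg be (fun w => max0 _) (fun w => max0 _)
  (fun w => max0_dist _ _ _ (fg w)).
have fgN w : `|- f w - - g w| <= e w by rewrite -opprD normrN.
have [r2 [E2 h2]] := int_close bmgN be (fun w => max0 _) (fun w => max0 _)
  (fun w => max0_dist _ _ _ (fgN w)).
have gE : Ex P g = Ex P (fun w => Num.max (g w) 0) - Ex P (fun w => Num.max (- g w) 0).
  rewrite -ExB//; apply: eq_Ex => w.
  by rewrite /Num.max; case: (ltP (g w) 0) => a1; case: (ltP (- g w) 0) => a2; lra.
exists (r1 - r2); split.
  rewrite unlock integralE EFinB -E1 -E2; congr (_ - _)%E; apply: eq_integral => w _.
    by rewrite funeposE -EFin_max.
  by rewrite funenegE -EFinN -EFin_max.
rewrite gE; have -> (a b c' d' : R) : a - b - (c' - d') = (a - c') - (b - d') by ring.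
by rewrite (le_trans (ler_normB _ _))// lerD.
Qed.

End NonmeasurableExpectation.

Lemma cvg_fin_sum (R : realType) (I : Type) (s : seq I) (Q : pred I)
    (F : I -> nat -> R) (l : I -> R) :
  (forall i, Q i -> F i n @[n --> \oo] --> l i) ->
  \sum_(i <- s | Q i) F i n @[n --> \oo] --> \sum_(i <- s | Q i) l i.
Proof.
move=> cF; elim: s => [|i s IH].
  by rewrite big_nil; under eq_fun do rewrite big_nil; exact: cvg_cst.
rewrite big_cons; under eq_fun do rewrite big_cons; case: ifP => // Qi.
by apply: cvgD; [exact: cF | exact: IH].
Qed.

Section Rounding.
Variable R : realType.

(** Counting the grid levels strictly below [z] rounds [z] down with error at most [h]: this is how
    an atom is recovered from ray counts. *)
Lemma rounded_dist (h z : R) (k : nat -> nat) (r j : nat) : 0 < h -> 0 <= z ->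
  (forall l, (l < r)%N -> (j < k l)%N = (l.+1%:R * h < z)) -> z <= r%:R * h ->
  let y := h * (\sum_(l < r) (j < k l))%N%:R in y <= z <= y + h.
Proof.
move=> h0 z0 kz zr /=; set s := (\sum_(l < r) _)%N.
suff H : forall r', (r' <= r)%N -> let s := (\sum_(l < r') (j < k l))%N in
    (r'%:R * h < z -> s = r') /\ (z <= r'%:R * h -> h * s%:R <= z <= h * s%:R + h).
  exact: (H r (leqnn r)).2.
elim=> [|r' IH] rr /=.
  rewrite big_ord0; split => //; rewrite mul0r => z0'.
  by rewrite mulr0 z0 add0r (le_trans z0')// ltW.
rewrite big_ord_recr/= kz//; have [IH1 IH2] := IH (ltnW rr).
have hle : r'%:R * h <= r'.+1%:R * h by rewrite ler_pM2r// ler_nat.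
have [lt|ge] := ltP (r'.+1%:R * h) z.
  by split => // _; rewrite IH1 ?addn1// (le_lt_trans hle).
split => // _; rewrite addn0.
have [lt'|ge'] := ltP (r'%:R * h) z; last exact: IH2.
rewrite IH1// mulrC (ltW lt')/=; apply: le_trans ge _.
by rewrite -natr1 mulrDl mul1r.
Qed.

End Rounding.

Section Criterion.
Variable R : realType.
Local Notation RB := (measurableTypeR R).
Implicit Type x : R.

Definition ray x : set RB := `]x, +oo[%classic.

Definition tail_bad (T : Type) (X : T -> pointMeasure R) x (M : nat) : set T :=
  [set w | ~ exists2 k, (k <= M)%N & X w (ray x) = (k%:R)%:E].

Definition tail_pattern (T : Type) (X : T -> pointMeasure R) h r (k : nat -> nat) : set T :=
  [set w | forall l, (l < r)%N -> X w (ray (l.+1%:R * h)) = ((k l)%:R)%:E].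

Section Measurability.
Context (d : measure_display) (T : measurableType d) (X : T -> pointMeasure R).
Hypothesis pX : point_process X.

Lemma measurable_count (B : set RB) (y : \bar R) : measurable B ->
  measurable [set w | X w B = y].
Proof.
move=> mB; rewrite (_ : [set w | _] = setT `&` (fun w => X w B) @^-1` [set y]); last first.
  by apply/seteqP; split => w /=; [split | case].
by apply: (pX mB) => //; exact: emeasurable_set1.
Qed.

Lemma measurable_ray x : measurable (ray x). Proof. exact: measurable_itv. Qed.

Lemma measurable_tail_bad x M : measurable (tail_bad X x M).
Proof.
rewrite (_ : tail_bad X x M =
  ~` (\bigcup_(k in `I_M.+1) [set w | X w (ray x) = (k%:R)%:E])); last first.
  apply/seteqP; split => w /= h h'; apply: h.
    by case: h' => k /= kM e; exists k.
  by case: h' => k kM e; exists k.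
apply: measurableC; apply: fin_bigcup_measurable => // k _.
by apply: measurable_count; exact: measurable_ray.
Qed.

Lemma measurable_tail_pattern h r k : measurable (tail_pattern X h r k).
Proof.
rewrite (_ : tail_pattern X h r k =
  \bigcap_(l in `I_r) [set w | X w (ray (l.+1%:R * h)) = ((k l)%:R)%:E]).
  apply: fin_bigcap_measurable => // l _.
  by apply: measurable_count; exact: measurable_ray.
by apply/seteqP; split => w /= h' l /= lr; exact: h'.
Qed.

End Measurability.

(** [h], [r], [m] and [Psi] are chosen before the probability space, so the same function of
    finitely many ray counts approximates [Phi] for both processes. Off the bad event the process is
    a configuration in the box given by [c]; its first atoms are rounded by means of the counts, and
    [uniform_on_box] bounds the change of [Phi]. *)
Lemma approx_functional (Phi : pointMeasure R -> R) (B eta : R) (C : nat) (M : nat -> nat) :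
  continuous Phi -> (forall mu, `|Phi mu| <= B) -> 0 < eta -> (0 < C)%N ->
  exists (h : R) (r m : nat) (Psi : {ffun 'I_r -> 'I_m.+1} -> R), 0 < h /\
  forall (d : measure_display) (T : measurableType d) (P : probability T R)
    (X : T -> pointMeasure R), point_process X ->
  pr P (tail_bad X C%:R 0 `|` \bigcup_i tail_bad X i.+1%:R^-1 (M i)) <= eta ->
  exists e, ('E_P[Phi \o X] = e%:E)%E /\
    `|e - \sum_k Psi k * pr P (tail_pattern X h r (fun l => if insub l is Some i then k i else 0%N))| <=
      2 * (eta + 2 * B * eta).
Proof.
move=> cP PB eta0 C0.
have B0 : 0 <= B by apply: le_trans (PB (eig_process 1 [::])).
(* If at most [M i] atoms exceed [1 / (i + 1)], then the atom of rank [j >= M i] is at most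
   [1 / (i + 1)]. [c j] is the best of these bounds with [i < j], and never more than [C]. *)
pose c j : R := \big[Num.min/C%:R]_(i < j | (M i <= j)%N) i.+1%:R^-1.
have c_small (e : R) : 0 < e -> exists J : nat, forall j, (J <= j)%N -> c j < e.
  move=> e0; pose i := Num.truncn e^-1.
  have ie : i.+1%:R^-1 < e by rewrite invf_plt ?posrE// truncnS_gt.
  exists (maxn i.+1 (M i)) => j; rewrite geq_max => /andP[ij Mij].
  by apply: le_lt_trans ie; apply: (@bigmin_le_cond _ _ _ _ (Ordinal ij) (fun i : 'I_j => (M i <= j)%N) (fun i : 'I_j => i.+1%:R^-1 : R)).
have [m hm] := uniform_on_box c_small cP eta0.
(* The mesh is the precision asked for by [uniform_on_box]; [r * h = C] makes the grid reach the top
   of the box. *)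
pose h : R := m.+1%:R^-1; pose r := (C * m.+1)%N.
have h0 : 0 < h by rewrite invr_gt0.
have rh : r%:R * h = C%:R by rewrite /r natrM mulfK// pnatr_eq0.
pose rounded (k : nat -> nat) j : R :=
  if (j < m)%N then h * (\sum_(l < r) (j < k l))%N%:R else 0.
pose ext (k : {ffun 'I_r -> 'I_(M m).+1}) l : nat := if insub l is Some i then k i else 0%N.
pose Psi (k : {ffun 'I_r -> 'I_(M m).+1}) := Phi (config c_small (rounded (ext k))).
exists h, r, (M m), Psi; split => // d T P X pX.
set bad := _ `|` _ => prbad.
have mbad : measurable bad.
  apply: measurableU; first exact: measurable_tail_bad.
  by apply: bigcup_measurable => i _; exact: measurable_tail_bad.
pose A k := tail_pattern X h r (ext k).
have mA k : measurable (A k) by exact: measurable_tail_pattern.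
pose g w := \sum_k Psi k * \1_(A k) w.
have bg : bmeas g by apply: bmeas_sum => k _; apply: bmeasZ; exact: bmeas_indic.
pose e w : R := eta + 2 * B * \1_bad w.
have be : bmeas e.
  by apply: bmeasD; [exact: bmeas_cst | apply: bmeasZ; exact: bmeas_indic].
have extK (k : {ffun 'I_r -> 'I_(M m).+1}) (l : 'I_r) : ext k l = k l.
  by rewrite /ext insubT//= => lr; congr (nat_of_ord (k _)); exact: val_inj.
have gA w k : A k w -> g w = Psi k.
  move=> Akw; rewrite /g (bigD1 k)//= indicE mem_set// mulr1 big1 ?addr0// => k' kk'.
  rewrite indicE memNset ?mulr0// => Ak'w; move/eqP: kk'; apply; apply/ffunP => l.
  apply: val_inj; apply/eqP; rewrite /= -(eqr_nat R) -!extK; apply/eqP; apply: EFin_inj.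
  by rewrite -Ak'w// -Akw.
have fge w : `|Phi (X w) - g w| <= e w.
  rewrite /e indicE; case: (boolP (w \in bad)) => wb.
    rewrite mulr1 (le_trans (ler_normB _ _))//.
    have gB : `|g w| <= B.
      have [[k Akw]|nk] := pselect (exists k, A k w); first by rewrite (gA _ _ Akw) PB.
      rewrite /g big1 ?normr0// => k _; rewrite indicE memNset ?mulr0// => Akw.
      by apply: nk; exists k.
    by have := PB (X w); lra.
  move/negP: wb => wb; have {wb} : ~ bad w by move=> h'; apply: wb; exact/mem_set.
  move=> /not_orP[/contrapT[k0 k00 XC] nbad].
  have {}XC : X w (ray C%:R) = 0%E by rewrite XC; move: k00; rewrite leqn0 => /eqP ->.
  have XM i : exists2 k, (k <= M i)%N & X w (ray i.+1%:R^-1) = (k%:R)%:E.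
    by apply: contrapT => nk; apply: nbad; exists i.
  have XK x : exists k : nat, 0 < x -> X w (ray x) = (k%:R)%:E.
    have [x0|x0] := leP x 0; first by exists 0%N.
    have [Cx|xC] := leP C%:R x.
      exists 0%N => _; have : (X w (ray x) <= X w (ray C%:R))%E.
        apply: le_measure; rewrite ?inE; [exact: measurable_ray | exact: measurable_ray |].
        by move=> y /=; rewrite /ray /= !in_itv/= !andbT; exact: le_lt_trans.
      by rewrite XC => h'; apply/eqP; rewrite eq_le h' measure_ge0.
    have [k hk] : exists k : nat, X w `]x, C%:R]%classic = (k%:R)%:E.
      apply: (@pm_int _ (X w) x C%:R); [by [] | exact: measurable_itv |].
      by move=> y /=; rewrite !in_itv/= => /andP[/ltW -> ->].
    exists k => _; rewrite -hk (_ : ray x = `]x, C%:R]%classic `|` ray C%:R); last first.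
      apply/seteqP; split => y; rewrite /ray /= !in_itv/= !andbT.
        by move=> xy; have [yC|Cy] := leP y C%:R; [left; rewrite xy | right].
      by case=> [/andP[]//|]; exact: lt_trans.
    have dis : `]x, C%:R]%classic `&` ray C%:R = set0.
      apply/seteqP; split => y //=; rewrite /ray /= !in_itv/= andbT => -[/andP[_ yC]].
      by rewrite ltNge yC.
    rewrite (measureU (X w) _ _ dis); [|exact: measurable_itv|exact: measurable_ray].
    by rewrite [X in (_ + X)%E]XC adde0.
  have [K {}XK] := choice XK.
  have KC : K C%:R = 0%N.
    have := XK C%:R; rewrite ltr0n => /(_ C0); rewrite XC => -[] /esym/eqP.
    by rewrite pnatr_eq0 => /eqP.
  have KM i : (K i.+1%:R^-1 <= M i)%N.
    have [k kM] := XM i; rewrite XK ?invr_gt0// => -[] /eqP; rewrite eqr_nat => /eqP ->.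
    by [].
  have Cp : 0 < C%:R :> R by rewrite ltr0n.
  pose z := point_loc K.
  have z_gt j x : 0 < x -> (x < z j) = (j < K x)%N by exact: (point_loc_gt (X := X w) XK Cp KC).
  have z0 j : 0 <= z j by exact: (point_loc_ge0 (X := X w) XK Cp KC).
  have zC j : z j <= C%:R by exact: (point_loc_le (X := X w) XK Cp KC).
  have zc j : z j <= c j.
    apply: le_bigmin => // i Mij; rewrite leNgt z_gt ?invr_gt0//.
    by rewrite -leqNgt (leq_trans (KM i)).
  have -> : Phi (X w) = Phi (config c_small z).
    by apply: continuous_pm_eq => //; exact: (point_rep XK Cp KC).
  (* [h = 1 / (m + 1)] is one of the levels controlled by [M], so all counts on the grid are at most
     [M m]; this gives [Psi] its finite domain. *)
  have Kh l : (l < r)%N -> (K (l.+1%:R * h)%R <= M m)%N.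
    move=> _; apply: leq_trans (KM m).
    have hl : h <= l.+1%:R * h by rewrite ler_peMl ?(ltW h0)// ler1n.
    rewrite -(ler_nat R) -lee_fin -!XK ?invr_gt0// ?mulr_gt0//.
    apply: le_measure; rewrite ?inE; [exact: measurable_ray | exact: measurable_ray |].
    by move=> y /=; rewrite /ray /= !in_itv/= !andbT; exact: le_lt_trans.
  pose k : {ffun 'I_r -> 'I_(M m).+1} := [ffun l : 'I_r => inord (K (l.+1%:R * h))].
  have kE (l : nat) : (l < r)%N -> ext k l = K (l.+1%:R * h).
    by move=> lr; rewrite (extK k (Ordinal lr)) ffunE inordK// ltnS Kh.
  have Ak : A k w.
    by move=> l lr; rewrite kE// XK// mulr_gt0.
  rewrite (gA _ _ Ak) mulr0 addr0; apply: hm.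
  - by move=> j; rewrite z0 zc.
  - move=> j; rewrite /rounded; case: ifP => jm; last by rewrite lexx (le_trans (z0 j)).
    rewrite mulr_ge0 ?(ltW h0)//=; apply: le_trans (zc j).
    have /= := @rounded_dist R h (z j) (ext k) r j h0 (z0 j).
    move=> /(_ _ _)/andP[]//; last by rewrite rh.
    by move=> l lr; rewrite kE// z_gt// mulr_gt0.
  - move=> j jm; rewrite /rounded jm.
    have /= := @rounded_dist R h (z j) (ext k) r j h0 (z0 j).
    move=> /(_ _ _)/andP[]; [by move=> l lr; rewrite kE// z_gt// mulr_gt0 | by rewrite rh |].
    move=> y1 y2; rewrite ger0_norm ?subr_ge0// lerBlDl//.
have [e' [Ee' he']] := expectation_close P bg be fge.
exists e'; split => //.
have Exg : Ex P g = \sum_k Psi k * pr P (A k).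
  rewrite Ex_sum; last by move=> k _; apply: bmeasZ; exact: bmeas_indic.
  by apply: eq_bigr => k _; rewrite ExZ ?Ex_indic//; exact: bmeas_indic.
rewrite -Exg; apply: (le_trans he'); suff : Ex P e <= eta + 2 * B * eta by lra.
rewrite ExD; [|exact: bmeas_cst|by apply: bmeasZ; exact: bmeas_indic].
rewrite Ex_cst ExZ ?Ex_indic//; last exact: bmeas_indic.
by rewrite lerD2l ler_wpM2l// mulr_ge0.
Qed.

(** Expresses the tightness events through patterns with a single level, so that convergence of
    patterns carries them over from [N] to [Ns n]. *)
Lemma pr_tail_bad (d : measure_display) (T : measurableType d) (P : probability T R)
    (X : T -> pointMeasure R) x M : point_process X ->
  pr P (tail_bad X x M) = 1 - \sum_(k < M.+1) pr P (tail_pattern X x 1 (fun=> k)).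
Proof.
move=> pX; pose A (k : nat) := tail_pattern X x 1 (fun=> k).
have mA k : measurable (A k) by exact: measurable_tail_pattern.
have mB := measurable_tail_bad pX x M.
have AE k w : A k w <-> X w (ray x) = (k%:R)%:E.
  rewrite /A /tail_pattern /=; split => [/(_ 0%N (ltnSn _))|h l]; first by rewrite mul1r.
  by rewrite ltnS leqn0 => /eqP ->; rewrite mul1r.
have bA (k : 'I_M.+1) : bmeas (\1_(A k) : T -> R) by exact: bmeas_indic.
rewrite -Ex_indic// -[in RHS](Ex_cst P 1).
rewrite (eq_bigr (fun k : 'I_M.+1 => Ex P \1_(A k))); last by move=> k _; rewrite Ex_indic.
rewrite -Ex_sum// -ExB; [|exact: bmeas_cst|exact: bmeas_sum].
apply: eq_Ex => w; have [[k kM Xk]|nk] := pselect (exists2 k, (k <= M)%N & X w (ray x) = (k%:R)%:E).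
  rewrite indicE memNset; last by apply; exists k.
  rewrite (bigD1 (Ordinal (kM : (k < M.+1)%N)))//= indicE mem_set ?big1 ?addr0 ?subrr//; last exact/AE.
  move=> i ik; rewrite indicE memNset// => /AE; rewrite Xk => -[] /eqP.
  by rewrite eqr_nat => /eqP ki; move/eqP: ik; apply; apply: val_inj.
rewrite indicE mem_set// big1 ?subr0// => i _; rewrite indicE memNset// => /AE Xi.
by apply: nk; exists i => //; rewrite -ltnS.
Qed.

(** The bad event involves infinitely many levels [1 / (i + 1)], so for each level a single [M i]
    must serve all [n] at once. Convergence provides it for large [n]; for the remaining ones,
    [Ns n] has at most [n] points above any positive level. *)
Lemma convergence_criterion (d d' : measure_display) (T : measurableType d)
    (T' : measurableType d') (P : probability T R) (P' : probability T' R)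
    (Ns : nat -> T -> pointMeasure R) (N : T' -> pointMeasure R) :
  (forall n, point_process (Ns n)) -> point_process N ->
  (forall n w x, 0 < x -> exists2 k, (k <= n)%N & Ns n w (ray x) = (k%:R)%:E) ->
  (forall x e, 0 < x -> 0 < e -> exists M, pr P' (tail_bad N x M) <= e) ->
  (forall e, 0 < e -> exists2 C, (0 < C)%N & pr P' (tail_bad N C%:R 0) <= e) ->
  (forall h r k, 0 < h ->
    pr P (tail_pattern (Ns n) h r k) @[n --> \oo] --> pr P' (tail_pattern N h r k)) ->
  converges_in_distribution P Ns P' N.
Proof.
move=> pNs pN Nn tailN topN cvgP; split => // Phi cPhi [B PB].
have B0 : 0 <= B by apply: le_trans (PB (eig_process 1 [::])).
have cvg_bad x M : 0 < x ->
    pr P (tail_bad (Ns n) x M) @[n --> \oo] --> pr P' (tail_bad N x M).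
  move=> x0; rewrite pr_tail_bad//; under eq_fun do rewrite pr_tail_bad//.
  by apply: cvgB; [exact: cvg_cst | apply: cvg_fin_sum => k _; exact: cvgP].
suff H e : 0 < e -> \forall n \near \oo, exists r r',
    [/\ ('E_P[Phi \o Ns n] = r%:E)%E, ('E_P'[Phi \o N] = r'%:E)%E & `|r' - r| <= e].
  have [n0 _ /(_ n0 (leqnn _))[_ [r' [_ E' _]]]] := H 1 ltr01.
  rewrite E'; apply/fine_cvgP; split.
    by apply: filterS (H 1 ltr01) => n [r [_ [-> _ _]]].
  apply/cvgrPdist_le => e e0; apply: filterS (H e e0) => n [r [r'' [Er Er' hr]]] /=.
  by rewrite Er; move: Er'; rewrite E' => -[->].
(* Makes the error [2 * (eta + 2 * B * eta)] of [approx_functional] equal to [e / 4]. It is incurred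
   once per process, and [e / 2] remains for the finite sums. *)
move=> e0; pose eta := e / (8 * (1 + 2 * B)).
have B1 : 0 < 1 + 2 * B by rewrite ltr_wpDr// mulr_ge0.
have eta0 : 0 < eta by rewrite divr_gt0// mulr_gt0.
have eta2 : 0 < eta / 2 by rewrite divr_gt0.
have eta4 : 0 < eta / 2 / 2 by rewrite divr_gt0.
have [C C0 NC] := topN _ eta4.
have Cp : 0 < C%:R :> R by rewrite ltr0n.
have topNs : \forall n \near \oo, pr P (tail_bad (Ns n) C%:R 0) <= eta / 2.
  have lt : pr P' (tail_bad N C%:R 0) < eta / 2.
    by apply: le_lt_trans NC _; rewrite ltr_pdivrMr// ltr_pMr// ltr1n.
  by apply: filterS (cvgr_lt _ (cvg_bad C%:R 0%N Cp) _ lt) => n /ltW.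
have tailM i : exists M, pr P' (tail_bad N i.+1%:R^-1 M) <= eta / 2 / (2 ^ i.+1)%:R /\
    forall n, pr P (tail_bad (Ns n) i.+1%:R^-1 M) <= eta / 2 / (2 ^ i.+1)%:R.
  set x := _^-1; set b := _ / _; have x0 : 0 < x by rewrite invr_gt0.
  have b0 : 0 < b by rewrite divr_gt0// ltr0n expn_gt0.
  have b2 : 0 < b / 2 by rewrite divr_gt0.
  have [M0 hM0] := tailN x _ x0 b2.
  have lt : pr P' (tail_bad N x M0) < b.
    by apply: le_lt_trans hM0 _; rewrite ltr_pdivrMr// ltr_pMr// ltr1n.
  have [n0 _ hn0] := cvgr_lt _ (cvg_bad x M0 x0) _ lt.
  have bad_mono (d1 : measure_display) (T1 : measurableType d1) (P1 : probability T1 R)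
      (X : T1 -> pointMeasure R) M1 M2 : point_process X -> (M1 <= M2)%N ->
      pr P1 (tail_bad X x M2) <= pr P1 (tail_bad X x M1).
    move=> pX M12; apply: le_pr; [exact: measurable_tail_bad | exact: measurable_tail_bad |].
    by move=> w /= nk [k kM Xk]; apply: nk; exists k => //; exact: leq_trans M12.
  exists (maxn M0 n0); split.
    by apply: le_trans (ltW lt); apply: bad_mono => //; exact: leq_maxl.
  move=> n; have [n0n|nn0] := leqP n0 n.
    by apply: le_trans (ltW (hn0 n n0n)); apply: bad_mono => //; exact: leq_maxl.
  rewrite (_ : tail_bad _ _ _ = set0) ?/pr ?measure0//; first exact: ltW.
  apply/seteqP; split => w //= nk; apply: nk.
  have [k kn Xk] := Nn n w x x0; exists k => //.
  by rewrite (leq_trans kn)// (leq_trans (ltnW nn0))// leq_maxr.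
have [M hM] := choice tailM.
have bad_small (d1 : measure_display) (T1 : measurableType d1) (P1 : probability T1 R)
    (X : T1 -> pointMeasure R) : point_process X ->
    pr P1 (tail_bad X C%:R 0) <= eta / 2 ->
    (forall i, pr P1 (tail_bad X i.+1%:R^-1 (M i)) <= eta / 2 / (2 ^ i.+1)%:R) ->
    pr P1 (tail_bad X C%:R 0 `|` \bigcup_i tail_bad X i.+1%:R^-1 (M i)) <= eta.
  move=> pX h1 h2; have mb x m := measurable_tail_bad pX x m.
  have mU : measurable (\bigcup_i tail_bad X i.+1%:R^-1 (M i)) by exact: bigcup_measurable.
  apply: (le_trans (prU P1 (mb _ _) mU)); rewrite [leRHS]splitr lerD//.
  rewrite -lee_fin -prE//.
  apply: (le_trans (@generalized_Boole_inequality _ _ _ P1 _ (fun i => mb _ (M i)) mU)).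
  apply: le_trans (epsilon_trick0 xpredT (ltW eta2)).
  apply: lee_nneseries => // i _.
  by have := h2 i; rewrite -lee_fin -prE.
have [h [r [m [Psi [h0 approx]]]]] := approx_functional M cPhi PB eta0 C0.
have [r' [Er' hr']] := approx _ _ P' N pN (bad_small _ _ P' N pN
  ltac:(by apply: le_trans NC _; rewrite ler_pdivrMr// ler_peMr ?(ltW eta2)// ler1n) (fun i => (hM i).1)).
set S' := \sum_k _ in hr'.
pose S n := \sum_k Psi k * pr P (tail_pattern (Ns n) h r (fun l => if insub l is Some i then k i else 0%N)).
have SS' : S n @[n --> \oo] --> S'.
  by apply: cvg_fin_sum => k _; apply: cvgMr; exact: cvgP.
have e4 : 0 < e / 2 by rewrite divr_gt0.
have nS : \forall n \near \oo, `|S' - S n| <= e / 2.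
  by move/cvgrPdist_le : SS' => /(_ _ e4).
near=> n.
have topn : pr P (tail_bad (Ns n) C%:R 0) <= eta / 2 by near: n.
have [r1 [Er1 hr1]] := approx _ _ P (Ns n) (pNs n) (bad_small _ _ P (Ns n) (pNs n)
  topn (fun i => (hM i).2 n)).
exists r1, r'; split => //.
have hS : `|S' - S n| <= e / 2 by near: n.
have etaE : 2 * (eta + 2 * B * eta) = e / 4.
  by rewrite /eta; field; rewrite gt_eqF.
rewrite -/(S n) etaE in hr1; rewrite etaE in hr'.
have -> : r' - r1 = (r' - S') + (S' - S n) - (r1 - S n) by ring.
apply: (le_trans (ler_normB _ _)); have := ler_normD (r' - S') (S' - S n); lra.
Unshelve. all: by end_near.
Qed.

End Criterion.

(** * Occupied cells *)

Section Vacancies.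
Variables (R : realType) (I : finType).

Section OneProbability.
Context (d : measure_display) (T : measurableType d).
Variables (P : probability T R) (V : T -> {set I}).
Hypothesis mV : forall i, measurable [set w | i \in V w].

Let measurable_eq W : measurable [set w | V w = W].
Proof.
pose E i := if i \in W then [set w | i \in V w] else ~` [set w | i \in V w].
have -> : [set w | V w = W] = \bigcap_(i in [set: I]) E i.
  apply/seteqP; split => w /=; first by move=> VW i _; rewrite /E -VW; case: ifPn => /= [|/negP].
  move=> h; apply/setP => i; have := h i Logic.I; rewrite /E.
  by case: ifPn => /= [|_ /negP/negbTE].
apply: fin_bigcap_measurable => [|i _]; first exact: finite_finset.
by rewrite /E; case: ifP => _; [|apply: measurableC].
Qed.

Lemma measurable_set_pred (A : pred {set I}) : measurable [set w | A (V w)].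
Proof.
have -> : [set w | A (V w)] = \bigcup_(W in [set W | A W]) [set w | V w = W].
  by apply/seteqP; split => w /=; [exists (V w) | case=> W /= AW ->].
by apply: fin_bigcup_measurable => //; exact: finite_finset.
Qed.

Lemma pr_set_pred (A : pred {set I}) :
  pr P [set w | A (V w)] = \sum_(W | A W) pr P [set w | V w = W].
Proof.
rewrite -Ex_indic; last exact: measurable_set_pred.
have b1 W : bmeas (\1_[set w | V w = W] : T -> R) by exact: bmeas_indic.
rewrite (eq_bigr (fun W => Ex P \1_[set w | V w = W])); last by move=> W _; rewrite Ex_indic.
rewrite -Ex_sum//; apply: eq_Ex => w; rewrite indicE.
case: (boolP (A (V w))) => AV.
  rewrite mem_set// (bigD1 (V w))//= indicE mem_set// big1 ?addr0// => W /andP[_ WV].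
  by rewrite indicE memNset//= => VW; rewrite VW eqxx in WV.
rewrite memNset//=; last exact/negP.
by rewrite big1// => W AW; rewrite indicE memNset//= => VW; rewrite VW AW in AV.
Qed.

End OneProbability.

Context (d d' : measure_display) (T : measurableType d) (T' : measurableType d').
Variables (P : probability T R) (P' : probability T' R).
Variables (V : nat -> T -> {set I}) (V' : T' -> {set I}).
Hypotheses (mV : forall n i, measurable [set w | i \in V n w])
  (mV' : forall i, measurable [set w | i \in V' w]).

(* Inclusion-exclusion, run by downward induction on the set of vacant indices. *)
Lemma vacancy_cvg (A : pred {set I}) :
  (forall Z : {set I}, pr P [set w | Z \subset V n w] @[n --> \oo] -->
    pr P' [set w | Z \subset V' w]) ->
  pr P [set w | A (V n w)] @[n --> \oo] --> pr P' [set w | A (V' w)].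
Proof.
move=> cvgZ; suff H W : pr P [set w | V n w = W] @[n --> \oo] --> pr P' [set w | V' w = W].
  rewrite pr_set_pred//; under eq_fun do rewrite pr_set_pred//.
  by apply: cvg_fin_sum => W _.
have [k] := ubnP (#|I| - #|W|)%N; elim: k W => // k IH W; rewrite ltnS => Wk.
have split d1 (T1 : measurableType d1) (P1 : probability T1 R) (V1 : T1 -> {set I}) :
    (forall i, measurable [set w | i \in V1 w]) -> pr P1 [set w | V1 w = W] =
    pr P1 [set w | W \subset V1 w] - \sum_(W' : {set I} | W \proper W') pr P1 [set w | V1 w = W'].
  move=> mV1; rewrite (pr_set_pred _ mV1 (fun Z => W \subset Z)) (bigD1 W)//=.
  rewrite (eq_bigl (fun W' : {set I} => W \proper W')) ?addrK// => W' /=.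
  by rewrite finset.properEneq eq_sym andbC.
rewrite split//; under eq_fun do rewrite split//.
apply: cvgB; first exact: cvgZ.
apply: cvg_fin_sum => W' /proper_card WW'; apply: IH.
by rewrite (leq_trans _ Wk)// ltn_sub2l// (leq_trans WW')// max_card.
Qed.

End Vacancies.

Section Cells.
Variables (R : realType) (tau : nat -> R) (m : nat).
Local Notation RB := (measurableTypeR R).
Hypotheses (tau_gt0 : forall i, 0 < tau i) (tau_mono : forall i j, (i <= j)%N -> tau i <= tau j).

Definition cell (l : nat) : set RB :=
  if (l.+1 < m)%N then `]tau l, tau l.+1]%classic else ray (tau l).

Lemma measurable_cell l : measurable (cell l).
Proof. by rewrite /cell; case: ifP => _; exact: measurable_itv. Qed.

Lemma cell_gt l x : cell l x -> tau l < x.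
Proof. by rewrite /cell /ray; case: ifP => _; rewrite /= in_itv/= ?andbT // => /andP[]. Qed.

Lemma cell_pos l : cell l `<=` `]0, +oo[%classic.
Proof. by move=> x /cell_gt lx; rewrite /= in_itv/= andbT (lt_trans (tau_gt0 l)). Qed.

Lemma trivIset_cell : trivIset [set: 'I_m] (fun l : 'I_m => cell l).
Proof.
suff H (i j : 'I_m) x : (i < j)%N -> cell i x -> ~ cell j x.
  move=> i j _ _ [x [ci cj]]; apply/val_inj => /=.
  by case: (ltngtP i j) => // h; [have := H _ _ x h ci | have := H _ _ x h cj].
move=> ij + /cell_gt xj; rewrite /cell (leq_ltn_trans ij)//= in_itv/= => /andP[_ xi].
by have := lt_le_trans xj (le_trans xi (tau_mono ij)); rewrite ltxx.
Qed.

Lemma ray_cell (mu : {measure set RB -> \bar R}) l : (l.+1 < m)%N ->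
  mu (ray (tau l)) = (mu (cell l) + mu (ray (tau l.+1)))%E.
Proof.
move=> lm; rewrite /cell lm.
have dis : `]tau l, tau l.+1]%classic `&` ray (tau l.+1) = set0.
  apply/seteqP; split => y //=; rewrite /ray /= !in_itv/= andbT => -[/andP[_ y1]].
  by rewrite ltNge y1.
rewrite -(measureU mu _ _ dis); [|exact: measurable_itv|exact: measurable_itv].
congr (mu _); apply/seteqP; split => y; rewrite /ray /= !in_itv/= !andbT.
  by move=> h; have [h'|h'] := leP y (tau l.+1); [left; rewrite h | right].
by case=> [/andP[]//|]; apply: le_lt_trans; exact: tau_mono.
Qed.

Definition vacant (mu : set RB -> \bar R) : {set 'I_m} := [set l : 'I_m | mu (cell l) == 0%E].

(** Reduces ray counts to the set of vacant cells, whose law is governed by void probabilities; the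
    induction peels off one cell at a time from the left. *)
Lemma ray_vacant (mu : {measure set RB -> \bar R}) (i : nat) : (i < m)%N ->
  (forall l, (l < m)%N -> mu (cell l) = 0%E \/ mu (cell l) = 1%E) ->
  mu (ray (tau i)) = (#|[set l : 'I_m | (i <= l)%N && (l \notin vacant mu)]%SET|%:R)%:E.
Proof.
move=> im mu01; have [k] := ubnP (m - i)%N; elim: k i im => // k IH i im; rewrite ltnS => ik.
have mu_cell (l : 'I_m) : mu (cell l) = ((l \notin vacant mu)%:R)%:E.
  by rewrite inE; have [->|->] := mu01 l (ltn_ord l); rewrite ?eqxx ?onee_eq0.
rewrite (finset.cardsD1 (Ordinal im)) inE leqnn /= natrD EFinD -mu_cell.
have [i1m|] := ltnP i.+1 m.
  rewrite ray_cell// IH//; last by lia.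
  congr (_ + (_%:R)%:E)%E; apply: eq_card => l; rewrite !inE -val_eqE /=.
  by rewrite andbA ltn_neqAle (eq_sym (i : nat)).
move=> mi; rewrite /cell ltnNge mi/= (_ : #|_| = 0%N) ?adde0//.
apply/eqP; rewrite cards_eq0; apply/eqP/setP => l; rewrite !inE -val_eqE /=.
by apply/negP => /and3P[li il _]; have := ltn_ord l; lia.
Qed.

Definition doubled (T : Type) (X : T -> pointMeasure R) l : set T :=
  [set w | ~ (X w (cell l) = 0%E \/ X w (cell l) = 1%E)].

Section Process.
Context (d : measure_display) (T : measurableType d) (X : T -> pointMeasure R).
Hypothesis pX : point_process X.

Lemma measurable_doubled l : measurable (doubled X l).
Proof.
rewrite (_ : doubled X l = ~` ([set w | X w (cell l) = 0%E] `|` [set w | X w (cell l) = 1%E])).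
  apply: measurableC; apply: measurableU; apply: measurable_count => //; exact: measurable_cell.
by [].
Qed.

Lemma measurable_vacant (l : 'I_m) : measurable [set w | l \in vacant (X w)].
Proof.
rewrite (_ : [set w | _] = [set w | X w (cell l) = 0%E]).
  by apply: measurable_count => //; exact: measurable_cell.
by apply/seteqP; split => w; rewrite /= inE => /eqP.
Qed.

End Process.

Lemma pr_close (d : measure_display) (T : measurableType d) (P : probability T R)
    (A B D : set T) : measurable A -> measurable B -> measurable D ->
  (forall w, ~ D w -> A w <-> B w) -> `|pr P A - pr P B| <= pr P D.
Proof.
move=> mA mB mD AB.
have AD (A1 B1 : set T) : measurable A1 -> measurable B1 ->
    (forall w, ~ D w -> A1 w <-> B1 w) -> pr P A1 <= pr P B1 + pr P D.
  move=> mA1 mB1 h; apply: le_trans (prU P mB1 mD).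
  apply: le_pr => //; first exact: measurableU.
  by move=> w Aw; have [|Dw] := pselect (D w); [right | left; exact/h].
rewrite ler_distl lerBlDr; apply/andP; split; apply: AD => // w /AB h.
exact: iff_sym.
Qed.

Context (d d' : measure_display) (T : measurableType d) (T' : measurableType d').
Variables (P : probability T R) (P' : probability T' R).
Variables (X : nat -> T -> pointMeasure R) (N : T' -> pointMeasure R).
Hypotheses (pX : forall n, point_process (X n)) (pN : point_process N).
Variables (h : R) (r : nat) (idx : nat -> nat) (D : nat -> R).
Hypothesis idx_tau : forall s, (s < r)%N -> (idx s < m)%N /\ tau (idx s) = s.+1%:R * h.

(** When no cell is doubled, the pattern is a predicate of the vacant set, and [vacancy_cvg] treats
    such predicates. Each of the two processes pays for its doubled cells, whence the factor 2. *)
Lemma pattern_close (k : nat -> nat) (e : R) : 0 < e ->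
  (forall Z : {set 'I_m}, pr P [set w | Z \subset vacant (X n w)] @[n --> \oo] -->
    pr P' [set w | Z \subset vacant (N w)]) ->
  (forall l e', (l < m)%N -> 0 < e' -> \forall n \near \oo, pr P (doubled (X n) l) <= D l + e') ->
  (forall l, pr P' (doubled N l) <= D l) ->
  \forall n \near \oo, `|pr P (tail_pattern (X n) h r k) - pr P' (tail_pattern N h r k)| <=
    2 * (\sum_(l < m) D l) + e.
Proof.
move=> e0 cvgZ dblX dblN.
pose A (W : {set 'I_m}) := [forall s : 'I_r, #|[set l : 'I_m | (idx s <= l)%N && (l \notin W)]%SET| == k s].
pose DX n := \big[setU/set0]_(l < m) doubled (X n) l.
pose DN := \big[setU/set0]_(l < m) doubled N l.
have patE (S : Type) (Y : S -> pointMeasure R) w :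
    ~ (\big[setU/set0]_(l < m) doubled Y l) w ->
    tail_pattern Y h r k w <-> A (vacant (Y w)).
  rewrite -bigcup_mkord => nD; have Y01 l : (l < m)%N -> Y w (cell l) = 0%E \/ Y w (cell l) = 1%E.
    by move=> lm; apply: contrapT => h'; apply: nD; exists l.
  split=> [pat|/forallP hA l lr].
    apply/forallP => s; rewrite -(eqr_nat R) -eqe.
    have [im tauE] := idx_tau (ltn_ord s).
    by rewrite -ray_vacant// tauE pat.
  have [im tauE] := idx_tau lr; rewrite -tauE ray_vacant//.
  by have /eqP -> := hA (Ordinal lr).
have prD d1 (T1 : measurableType d1) (P1 : probability T1 R) (Y : T1 -> pointMeasure R) :
    point_process Y -> measurable (\big[setU/set0]_(l < m) doubled Y l) /\
    pr P1 (\big[setU/set0]_(l < m) doubled Y l) <= \sum_(l < m) pr P1 (doubled Y l).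
  move=> pY; elim: m => [|m' [mIH IH]].
    by rewrite !big_ord0; split => //; rewrite /pr measure0.
  rewrite !big_ord_recr /=; have mD := measurable_doubled pY m'.
  split; first exact: measurableU.
  by apply: le_trans (prU P1 mIH mD) _; rewrite lerD2r.
have mV n (l : 'I_m) := measurable_vacant (pX n) l.
have mV' (l : 'I_m) := measurable_vacant pN l.
have cvgA := @vacancy_cvg _ _ _ _ _ _ P P' _ _ mV mV' A cvgZ.
pose e1 := e / 2 / m.+1%:R; have e10 : 0 < e1 by rewrite !divr_gt0.
have dX : \forall n \near \oo, \sum_(l < m) pr P (doubled (X n) l) <= \sum_(l < m) (D l + e1).
  have : \forall n \near \oo, forall l : 'I_m, pr P (doubled (X n) l) <= D l + e1.
    by apply: filter_forall => l; exact: (dblX _ _ (ltn_ord l) e10).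
  by apply: filterS => n hn; apply: ler_sum => l _; exact: hn.
have cA : \forall n \near \oo,
    `|pr P' [set w | A (vacant (N w))] - pr P [set w | A (vacant (X n w))]| <= e / 2.
  by move/cvgrPdist_le : cvgA; apply; rewrite divr_gt0.
near=> n.
have h1 : \sum_(l < m) pr P (doubled (X n) l) <= \sum_(l < m) (D l + e1) by near: n.
have h2 : `|pr P' [set w | A (vacant (N w))] - pr P [set w | A (vacant (X n w))]| <= e / 2.
  by near: n.
have [mDX h3] := prD _ _ P _ (pX n).
have [mDN h4] := prD _ _ P' _ pN.
have h5 := pr_close P (measurable_tail_pattern (pX n) h r k)
  (measurable_set_pred (mV n) A) mDX (patE _ (X n)).
have h6 := pr_close P' (measurable_tail_pattern pN h r k)
  (measurable_set_pred mV' A) mDN (patE _ N).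
have h7 : \sum_(l < m) pr P' (doubled N l) <= \sum_(l < m) D l.
  by apply: ler_sum => l _; exact: dblN.
have h8 : \sum_(l < m) (D l + e1) <= \sum_(l < m) D l + e / 2.
  rewrite big_split /= lerD2l sumr_const card_ord -[leLHS]mulr_natr /e1.
  have e20 : 0 <= e / 2 by rewrite divr_ge0 ?(ltW e0).
  by rewrite mulrAC ler_pdivrMr// ler_wpM2l// ler_nat.
have := le_trans h5 (le_trans h3 (le_trans h1 h8)).
have := le_trans h6 (le_trans h4 h7).
move: h2; rewrite !ler_norml => /andP[a1 a2] /andP[a3 a4] /andP[a5 a6].
by apply/andP; split; lra.
Unshelve. all: by end_near.
Qed.

End Cells.

(** * Poisson processes with a power intensity *)

Section PowerIntensity.
Variables (R : realType) (alpha : R).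
Hypothesis alpha0 : 0 < alpha.
Local Notation RB := (measurableTypeR R).
Local Notation rho := (fun x : R => alpha / x `^ (1 + alpha)).

Let rhoE : rho = (fun x => alpha * x `^ (- (1 + alpha))).
Proof. by apply/funext => x; rewrite powRN. Qed.

Let rho_ge0 x : 0 <= rho x.
Proof. by rewrite divr_ge0 ?powR_ge0// ltW. Qed.

Let measurable_rho : measurable_fun [set: RB] (fun x : RB => (rho x)%:E).
Proof.
apply/measurable_EFinP; rewrite rhoE; apply: measurable_funM; first exact: measurable_cst.
exact: measurable_powR.
Qed.

Lemma intensity_ray s : 0 < s -> intensity rho (ray s) = (s `^ (- alpha))%:E.
Proof.
move=> s0; rewrite /intensity /ray.
have mrho : measurable_fun [set: RB] (rho : RB -> R) by apply/measurable_EFinP.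
rewrite integral_itv_obnd_cbnd; last first.
  by apply: measurable_funTS.
pose F x : R := - x `^ (- alpha).
have dF (x : R) : 0 < x -> is_derive x 1 F (rho x).
  move=> x0; have := is_derive1_powR (- alpha) x0 => h.
  have := is_deriveN h; rewrite -mulNr opprK; rewrite -powRN opprD addrC //.
have pos x : s <= x -> 0 < x by exact: lt_le_trans.
have Fa : F x @[x --> s^'+] --> F s.
  apply: cvg_at_right_filter; apply: cvgN; exact: powR_continuous.
rewrite (@ge0_continuous_FTC2y R rho F s 0).
- by rewrite /F EFinN oppeK add0e.
- by move=> x _; exact: rho_ge0.
- apply: continuous_in_subspaceT => x; rewrite inE/= in_itv/= andbT => /pos x0.
  rewrite rhoE; apply: cvgM; [exact: cvg_cst | exact: powR_continuous].
- apply/cvgrPdist_le => e e0.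
  pose x1 := e `^ (- alpha^-1); have x10 : 0 < x1 by rewrite powR_gt0.
  near=> x; have x1x : x1 <= x by [].
  rewrite sub0r normrN /F normrN ger0_norm ?powR_ge0//.
  have -> : e = x1 `^ (- alpha).
    by rewrite -powRrM mulrNN mulVf ?gt_eqF// powRr1// ltW.
  by apply: ge_powR_base => //; rewrite oppr_le0 ltW.
- by move=> x sx; have [] := dF x (pos x (ltW sx)).
- exact: Fa.
- move=> x; rewrite in_itv/= andbT => sx.
  by rewrite derive1E; have [] := dF x (pos x (ltW sx)).
Unshelve. all: by end_near.
Qed.

Variables (tau : nat -> R) (m : nat).
Hypotheses (tau_gt0 : forall i, 0 < tau i) (tau_mono : forall i j, (i <= j)%N -> tau i <= tau j).

Definition mass (l : nat) : R :=
  tau l `^ (- alpha) - (if (l.+1 < m)%N then tau l.+1 `^ (- alpha) else 0).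

Lemma mass_ge0 l : 0 <= mass l.
Proof.
rewrite /mass; case: ifP => _; last by rewrite subr0 powR_ge0.
by rewrite subr_ge0; apply: ge_powR_base; rewrite ?tau_mono// oppr_le0 ltW.
Qed.

Lemma intensity_cell l : intensity rho (cell tau m l) = (mass l)%:E.
Proof.
rewrite /mass; have [lm|lm] := ltnP l.+1 m; last by rewrite /cell ltnNge lm/= subr0 intensity_ray.
have := intensity_ray (tau_gt0 l); rewrite /intensity.
have -> : ray (tau l) = cell tau m l `|` ray (tau l.+1).
  rewrite /cell lm; apply/seteqP; split => y; rewrite /ray /= !in_itv/= !andbT.
    by move=> h; have [h'|h'] := leP y (tau l.+1); [left; rewrite h | right].
  by case=> [/andP[]//|]; apply: le_lt_trans; exact: tau_mono.
rewrite ge0_integral_setU//; first last.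
- apply/disj_setPS => y; rewrite /cell lm /ray /= !in_itv/= andbT => -[/andP[_ y1]].
  by rewrite ltNge y1.
- by move=> x _; rewrite lee_fin; exact: rho_ge0.
- exact: measurable_funTS.
- exact: measurable_itv.
- exact: measurable_cell.
have := intensity_ray (tau_gt0 l.+1); rewrite /intensity => ->.
move=> h; rewrite EFinB -h addeK//.
Qed.

Context (d : measure_display) (T : measurableType d) (P : probability T R).
Variable N : T -> pointMeasure R.
Hypothesis hN : Poisson_point_process P N rho.

Let pN : point_process N. Proof. by case: hN. Qed.

Lemma poisson_void (B : set RB) (r : R) (k : nat) : measurable B ->
  B `<=` `]0, +oo[%classic -> intensity rho B = r%:E ->
  pr P [set w | N w B = (k%:R)%:E] = r ^+ k / k`!%:R * expR (- r).
Proof. by case: hN => _ h _ _ mB B0 Br; rewrite /pr (h B r). Qed.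

Lemma poisson_vacant (Z : {set 'I_m}) :
  pr P [set w | Z \subset vacant tau m (N w)] = expR (- \sum_(l in Z) mass l).
Proof.
pose B : set RB := \big[setU/set0]_(l in Z) cell tau m l.
have mC (l : 'I_m) : measurable (cell tau m l) by exact: measurable_cell.
have tC := trivIset_cell tau_mono (m := m).
have -> : [set w | Z \subset vacant tau m (N w)] = [set w | N w B = (0%:R)%:E].
  apply/seteqP; split => w /=.
    move=> /fintype.subsetP ZV; rewrite /B measure_bigsetU_ord// big1// => l /ZV.
    by rewrite inE => /eqP.
  move=> h; apply/fintype.subsetP => l lZ; rewrite inE eq_le measure_ge0 andbT.
  suff : (N w (cell tau m l) <= N w B)%E by rewrite h.
  apply: le_measure; rewrite ?inE; [exact: mC | exact: bigsetU_measurable |].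
  by move=> y cy; rewrite /B (bigD1 l lZ); left.
rewrite (@poisson_void _ (\sum_(l in Z) mass l)) ?expr0 ?mul1r ?invr1//.
- by rewrite mul1r.
- exact: bigsetU_measurable.
- rewrite /B; apply: (big_ind (fun A : set RB => A `<=` `]0, +oo[%classic)) => //.
    by move=> A1 A2 h1 h2 x [/h1|/h2].
  by move=> l _; exact: cell_pos.
rewrite /intensity /B -big_enum ge0_integral_bigsetU//=.
- by rewrite -sumEFin big_enum; apply: eq_bigr => l _; exact: intensity_cell.
- exact: enum_uniq.
- exact: (@sub_trivIset _ _ _ [set: 'I_m]).
- exact: measurable_funTS.
- by move=> x _; rewrite lee_fin; exact: rho_ge0.
Qed.

(** [1 - (1 + mu) * exp (- mu) <= 1 - (1 + mu) * (1 - mu) = mu ^ 2]. *)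
Lemma poisson_doubled l : pr P (doubled tau m N l) <= mass l ^+ 2.
Proof.
have mC := measurable_cell tau m l.
have C0 := cell_pos tau_gt0 (m := m) (l := l).
have m0 : measurable [set w | N w (cell tau m l) = 0%E] by exact: measurable_count.
have m1 : measurable [set w | N w (cell tau m l) = 1%E] by exact: measurable_count.
have -> : doubled tau m N l = ~` ([set w | N w (cell tau m l) = 0%E] `|` [set w | N w (cell tau m l) = 1%E]) by [].
rewrite prC; last exact: measurableU.
have p0 := poisson_void 0 mC C0 (intensity_cell l).
have p1 := poisson_void 1 mC C0 (intensity_cell l).
have U : pr P ([set w | N w (cell tau m l) = 0%E] `|` [set w | N w (cell tau m l) = 1%E]) =
    expR (- mass l) + mass l * expR (- mass l).
  apply: EFin_inj; rewrite -prE; last exact: measurableU.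
  rewrite (measureU P m0 m1) ?EFinD; last first.
    by apply/seteqP; split => w //= [->] /esym/eqP; rewrite onee_eq0.
  congr (_ + _)%E.
    by rewrite [LHS]prE// p0 expr0 fact0 divr1 mul1r.
  by rewrite [LHS]prE// p1 expr1 divr1.
rewrite U; have := expR_ge1Dx (- mass l); have := mass_ge0 l; nra.
Qed.

Lemma pr_tail_bad_poisson x M : 0 < x -> pr P (tail_bad N x M) =
  1 - (\sum_(k < M.+1) (x `^ (- alpha)) ^+ k / k`!%:R) * expR (- x `^ (- alpha)).
Proof.
move=> x0; rewrite pr_tail_bad// mulr_suml; congr (_ - _); apply: eq_bigr => k _.
rewrite -(poisson_void k _ _ (intensity_ray x0)).
- congr (pr _ _); apply/seteqP; split => w /=; rewrite /tail_pattern /=.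
    by move=> /(_ 0%N (ltnSn _)); rewrite mul1r.
  by move=> h l; rewrite ltnS leqn0 => /eqP ->; rewrite mul1r.
- exact: measurable_itv.
- by move=> y; rewrite /ray /= !in_itv/= !andbT; exact: lt_trans.
Qed.

Lemma poisson_tail_bad x e : 0 < x -> 0 < e -> exists M, pr P (tail_bad N x M) <= e.
Proof.
move=> x0 e0; set y := x `^ (- alpha).
have cvgy : series (exp_coeff y) k @[k --> \oo] --> expR y.
  exact: is_cvg_series_exp_coeff.
have c : (1 - series (exp_coeff y) k * expR (- y)) @[k --> \oo] --> (0 : R).
  have -> : 0 = 1 - expR y * expR (- y) :> R by rewrite expRN divff ?subrr// gt_eqF// expR_gt0.
  by apply: cvgB; [exact: cvg_cst | apply: cvgMl].
have [n0 _ /(_ n0.+1 (leqnSn _))] := cvgr_lt _ c _ e0; rewrite /= => h.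
exists n0; rewrite pr_tail_bad_poisson// -/y; apply/ltW; apply: le_lt_trans h.
by rewrite /series /= big_mkord.
Qed.

Lemma poisson_top_bad e : 0 < e -> exists2 C, (0 < C)%N & pr P (tail_bad N C%:R 0) <= e.
Proof.
move=> e0; have [n0 h] := powR_ge_eventually e^-1 alpha0.
exists n0.+1 => //; rewrite pr_tail_bad_poisson// big_ord1 expr0 fact0 divr1 mul1r.
have : n0.+1%:R `^ (- alpha) <= e.
  by rewrite powRN -[leRHS]invrK lef_pV2 ?posrE ?invr_gt0 ?powR_gt0// h.
by have := expR_ge1Dx (- n0.+1%:R `^ (- alpha)); lra.
Qed.

End PowerIntensity.

(** * Large entries *)

(** Squeezed by [exp (- p / (1 - p)) <= 1 - p <= exp (- p)], raised to the power [M n]. *)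
Lemma expR_limit (R : realType) (M : nat -> nat) (p : nat -> R) (mu : R) :
  (forall n, 0 <= p n) -> p n @[n --> \oo] --> 0 -> (M n)%:R * p n @[n --> \oo] --> mu ->
  (1 - p n) ^+ M n @[n --> \oo] --> expR (- mu).
Proof.
move=> p0 cp cMp.
have cexp (u : nat -> R) (l : R) : u n @[n --> \oo] --> l -> expR (u n) @[n --> \oo] --> expR l.
  by move=> cu; exact: (cvg_comp _ _ cu (@continuous_expR R l)).
have cup : expR (- ((M n)%:R * p n)) @[n --> \oo] --> expR (- mu).
  by apply: cexp; exact: cvgN.
have clo : expR (- ((M n)%:R * p n / (1 - p n))) @[n --> \oo] --> expR (- mu).
  apply: cexp; apply: cvgN; rewrite -[mu]divr1; apply: cvgM => //.
  have c1 : 1 - p n @[n --> \oo] --> (1 : R).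
    by rewrite -[X in _ --> (X : R)]subr0; apply: cvgB => //; exact: cvg_cst.
  by apply: cvgV => //; exact: oner_neq0.
apply: squeeze_cvgr clo cup.
have : \forall n \near \oo, p n < 2^-1 by apply: (cvgr_lt _ cp); rewrite invr_gt0.
apply: filterS => n pn; have q0 : 0 < 1 - p n by lra.
have pe (x : R) : expR (- (x * (M n)%:R)) = expR (- x) ^+ M n.
  by rewrite -mulNr mulrC expRM_natl.
apply/andP; split.
  rewrite (mulrC (M n)%:R) mulrAC pe lerXn2r ?nnegrE ?expR_ge0 ?(ltW q0)//.
  rewrite -[leRHS]invrK expRN lef_pV2 ?posrE ?expR_gt0 ?invr_gt0//.
  apply: le_trans (expR_ge1Dx _); rewrite -[leLHS]mul1r ler_pdivrMr// mulrDl mul1r.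
  by rewrite divfK ?gt_eqF//; lra.
by rewrite (mulrC (M n)%:R) pe lerXn2r ?nnegrE ?expR_ge0 ?(ltW q0)//; exact: expR_ge1Dx.
Qed.

Section EigProcess.
Variable R : realType.
Local Notation RB := (measurableTypeR R).

Lemma eig_processE (b : R) (l : seq R) (B : set RB) (p : pred R) : 0 < b ->
  B `<=` `]0, +oo[%classic -> (forall y, B y <-> p y) ->
  eig_process b l B = ((count (fun y => p (b^-1 * y)) l)%:R)%:E.
Proof.
move=> b0 B0 Bp; rewrite /eig_process /eig_measure /= /mrestr /msum (setIidl B0).
elim: l => [|y l IH] /=; first by rewrite big_ord0.
rewrite big_ord_recl /= natrD EFinD -IH; congr (_ + _)%E.
have iff : (b^-1 * y \in B) = p (b^-1 * y).
  by apply/idP/idP => [/set_mem/Bp|h]; last exact/mem_set/Bp.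
rewrite /atom_if_pos; case: ifPn => y0; first by rewrite /= diracE iff.
rewrite /mzero -iff memNset// => /B0; rewrite /= in_itv/= andbT pmulr_rgt0 ?invr_gt0//.
by rewrite (negbTE y0).
Qed.

Lemma eig_process_ray (b x : R) (l : seq R) : 0 < b -> 0 < x ->
  eig_process b l (ray x) = ((count (fun y => x * b < y) l)%:R)%:E.
Proof.
move=> b0 x0; rewrite (@eig_processE _ _ _ (fun y => x < y))//.
- congr (_%:R%:E); apply: eq_count => y /=; by rewrite mulrC ltr_pdivlMr.
- by move=> y; rewrite /ray /= !in_itv/= !andbT; exact: lt_trans.
- by move=> y; rewrite /ray /= in_itv/= andbT.
Qed.

Lemma point_process_eig (d : measure_display) (T : measurableType d) (b : R)
    (l : T -> seq R) (n : nat) : (forall w, size (l w) = n) ->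
  (forall i, measurable_fun setT (fun w => (l w)`_i)) ->
  point_process (fun w => eig_process b (l w)).
Proof.
move=> ln ml B mB; pose B' : set RB := B `&` `]0, +oo[%classic.
have mB' : measurable B' by apply: measurableI => //; exact: measurable_itv.
pose A : set RB := `]0, +oo[%classic `&` (fun y : RB => (b^-1 * y : RB)) @^-1` B'.
have mA : measurable A.
  have mf : measurable_fun (`]0, +oo[%classic : set RB) (fun y : RB => (b^-1 * y : RB)).
    by apply: measurable_funM; [exact: measurable_cst | exact: measurable_id].
  by apply: mf => //; exact: measurable_itv.
have -> : (fun w => eig_process b (l w) B) = (fun w => (\sum_(i < n) \1_A ((l w)`_i))%:E).
  apply/funext => w; rewrite /eig_process /eig_measure /= /mrestr /msum ln -sumEFin.
  apply: eq_bigr => i _; rewrite /atom_if_pos indicE; case: ifPn => y0.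
    rewrite /= diracE; congr ((_ : bool)%:R%:E); apply/idP/idP => /set_mem h; apply/mem_set.
      by split => //=; rewrite in_itv/= y0.
    by case: h.
  rewrite memNset// => -[]; rewrite /= in_itv/= andbT.
  by rewrite (negbTE y0).
apply/measurable_EFinP; apply: measurable_sum => i.
by apply: measurableT_comp (ml i); exact: measurable_indic.
Qed.

End EigProcess.

Section Entries.
Context (R : realType) (d : measure_display) (T : measurableType d).
Variables (P : probability T R) (X : nat * nat -> T -> R) (G : R -> R).
Local Notation RB := (measurableTypeR R).
Hypothesis mX : forall p, measurable_fun setT (X p).
Hypothesis indep : mutually_independent P [set p : nat * nat | (p.1 <= p.2)%N] (X : _ -> T -> R).
Hypothesis XG : forall p (x : R), (p.1 <= p.2)%N -> pr P [set w | x < `|X p w|] = G x.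

Definition pairs n : seq (nat * nat) :=
  [seq (nat_of_ord p.1, nat_of_ord p.2) | p in [pred p : 'I_n * 'I_n | (p.1 < p.2)%N]].

Lemma pairs_uniq n : uniq (pairs n).
Proof.
rewrite map_inj_uniq ?enum_uniq// => -[i j] [i' j'] /= [ii' jj'].
by congr (_, _); exact: val_inj.
Qed.

Lemma mem_pairs n p : p \in pairs n -> (p.1 <= p.2)%N.
Proof. by move=> /mapP[[i j]]; rewrite mem_enum inE /= => /ltnW ij ->. Qed.

Lemma size_pairs n : size (pairs n) = 'C(n, 2).
Proof.
rewrite size_map -cardE -sum1_card -bin2_sum big_mkcond /=.
rewrite -(pair_bigA _ (fun i j : 'I_n => if (i < j)%N then 1%N else 0%N)) /= exchange_big /=.
rewrite big_mkord; apply: eq_bigr => j _.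
rewrite (eq_bigr (fun i : 'I_n => ((i < j)%N : nat))); last by move=> i _; case: ltnP.
by rewrite sum_ltn_ord (minn_idPr (ltnW (ltn_ord j))).
Qed.

(** The normalization counts [n * (n + 1) / 2] entries, diagonal included, while the point process
    of entries uses [i < j]. In this form the discrepancy is [n], and [n * G (x * b n)] tends to
    0. *)
Lemma pairs_natr n : (size (pairs n))%:R = (n * n.+1)%:R / 2 - n%:R :> R.
Proof.
rewrite size_pairs bin2; apply: (@mulIf _ 2) => //; rewrite mulrBl divfK//.
have e : ((n * n.-1)./2 * 2 + n * 2 = n * n.+1)%N.
  have odd0 : odd (n * n.-1) = false by rewrite oddM; case: n => //= k; rewrite andNb.
  by rewrite muln2 -[X in (X + _)%N]add0n -[X in (X + _ + _)%N]/(nat_of_bool false) -odd0 odd_double_half; case: n {odd0} => //= k; lia.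
by rewrite -e natrD !natrM addrK.
Qed.

Definition abs_entries n w : seq R := [seq `|X p w| | p <- pairs n].

Lemma abs_entries_ray b x n w (A : 'M[R]_n) : 0 < b -> 0 < x ->
  (forall i j : 'I_n, (i < j)%N -> A i j = X (nat_of_ord i, nat_of_ord j) w) ->
  eig_process b (abs_entries n w) (ray x) = (#|large_pairs A (x * b)|%:R)%:E.
Proof.
move=> b0 x0 AX; rewrite eig_process_ray//; congr (_%:R%:E).
rewrite /abs_entries /pairs count_map count_map /= -sum1_count big_enum_cond /= sum1_card.
apply: eq_card => -[i j]; rewrite !inE /=.
by apply: andb_id2l => ij; rewrite AX.
Qed.

Lemma point_process_entries b n : point_process (fun w => eig_process b (abs_entries n w)).
Proof.
apply: (@point_process_eig _ _ _ _ _ (size (pairs n))) => [w|i]; first by rewrite size_map.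
have [ip|ip] := ltnP i (size (pairs n)); last first.
  rewrite (_ : (fun w => _) = cst 0); first exact: measurable_cst.
  by apply/funext => w; rewrite /abs_entries nth_default// size_map.
rewrite (_ : (fun w => _) = (fun w => `|X (nth (0%N, 0%N) (pairs n) i) w|)); last first.
  by apply/funext => w; rewrite (nth_map (0%N, 0%N)).
by apply: measurableT_comp => //; exact: normr_measurable.
Qed.

Section Grid.
Variables (tau : nat -> R) (m : nat) (b : R).
Hypotheses (tau_gt0 : forall i, 0 < tau i) (tau_mono : forall i j, (i <= j)%N -> tau i <= tau j).
Hypothesis b0 : 0 < b.

Let hit p l : set T := [set w | cell tau m l (b^-1 * `|X p w|)].

Let measurable_scaled p : measurable_fun [set: T] (fun w => (b^-1 * `|X p w| : RB)).
Proof.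
apply: measurable_funM; first exact: measurable_cst.
by apply: measurableT_comp => //; exact: normr_measurable.
Qed.

Let measurable_hit p l : measurable (hit p l).
Proof.
rewrite -[hit p l]setTI; apply: (measurable_scaled p) => //; exact: measurable_cell.
Qed.

Definition cell_prob l : R :=
  G (tau l * b) - (if (l.+1 < m)%N then G (tau l.+1 * b) else 0).

Let gt_scaled x y : (x < b^-1 * y) = (x * b < y).
Proof. by rewrite mulrC ltr_pdivlMr. Qed.

Let pr_hit p l : (p.1 <= p.2)%N -> pr P (hit p l) = cell_prob l.
Proof.
move=> pp; rewrite /cell_prob -!(XG _ pp); case: ifPn => lm; last first.
  rewrite subr0; congr (pr P _); apply/seteqP; split => w; rewrite /hit /cell (negbTE lm) /ray /= in_itv/= andbT gt_scaled//.
have m1 x := measurable_gt (mX p) x.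
rewrite (pr_setID P (m1 _) (m1 (tau l.+1 * b))) (_ : _ `&` [set w | _] = [set w | tau l.+1 * b < `|X p w|]); last first.
  apply/seteqP; split => w /=; first by case.
  by move=> h; split => //; apply: le_lt_trans h; rewrite ler_pM2r// tau_mono.
rewrite [RHS]addrAC subrr add0r; congr (pr P _); apply/seteqP; split => w; rewrite /hit /cell lm /= in_itv/= gt_scaled.
  by move=> /andP[h1]; rewrite leNgt gt_scaled => /negP.
by move=> [-> /negP]; rewrite leNgt gt_scaled.
Qed.

Lemma cell_prob_ge0 l : 0 <= cell_prob l.
Proof. by rewrite -(@pr_hit (0%N, 0%N))// pr_ge0. Qed.

Let pr_hits p (Z : {set 'I_m}) : (p.1 <= p.2)%N ->
  pr P (\big[setU/set0]_(l in Z) hit p l) = \sum_(l in Z) cell_prob l.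
Proof.
move=> pp; apply: EFin_inj; rewrite -prE; last exact: bigsetU_measurable.
rewrite [LHS](@measure_bigsetU_ord _ _ _ P) -?sumEFin//; last first.
  move=> i j _ _ [w [ci cj]]; apply: (trivIset_cell tau_mono) => //.
  by exists (b^-1 * `|X p w|).
by apply: eq_bigr => l _; rewrite -(pr_hit l pp) -prE.
Qed.

Let cell_count n w l : eig_process b (abs_entries n w) (cell tau m l) =
  ((count (fun p => w \in hit p l) (pairs n))%:R)%:E.
Proof.
rewrite (@eig_processE _ _ _ _ (fun y => y \in cell tau m l))//.
- by rewrite /abs_entries count_map.
- exact: cell_pos.
- by move=> y; split=> [/mem_set|/set_mem].
Qed.

Lemma pr_entries_vacant n (Z : {set 'I_m}) :
  pr P [set w | Z \subset vacant tau m (eig_process b (abs_entries n w))] =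
  (1 - \sum_(l in Z) cell_prob l) ^+ size (pairs n).
Proof.
pose B : set R := [set y | forall l : 'I_m, l \in Z -> ~ cell tau m l (b^-1 * `|y|)].
have XB p : X p @^-1` B = ~` \big[setU/set0]_(l in Z) hit p l.
  apply/seteqP; split => w /= h.
    apply: (big_ind (fun A : set T => ~ A w)) => //; by move=> A1 A2 h1 h2 [].
  by move=> l lZ hl; apply: h; rewrite (bigD1 l lZ); left.
have mB : measurable B.
  rewrite (_ : B = ~` \big[setU/set0]_(l in Z) ((fun y : R => (b^-1 * `|y| : RB)) @^-1` (cell tau m l))).
    apply: measurableC; apply: bigsetU_measurable => l _.
    rewrite -[X in measurable X]setTI; have mf : measurable_fun [set: R] (fun y : R => (b^-1 * `|y| : RB)).
      by apply: measurable_funM; [exact: measurable_cst | exact: normr_measurable].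
    by apply: mf => //; exact: measurable_cell.
  apply/seteqP; split => y /= h.
    apply: (big_ind (fun A : set R => ~ A y)) => //; by move=> A1 A2 h1 h2 [].
  by move=> l lZ hl; apply: h; rewrite (bigD1 l lZ); left.
have -> : [set w | Z \subset vacant tau m (eig_process b (abs_entries n w))] =
    \bigcap_(p in [set` pairs n]) X p @^-1` B.
  apply/seteqP; split => w /=.
    move=> /fintype.subsetP ZV p /= pp l lZ hl.
    have := ZV l lZ; rewrite inE cell_count eqe pnatr_eq0 -leqn0 leqNgt -has_count.
    by move=> /negP; apply; apply/hasP; exists p => //; exact/mem_set.
  move=> h; apply/fintype.subsetP => l lZ; rewrite inE cell_count eqe pnatr_eq0.
  rewrite -leqn0 leqNgt -has_count; apply/hasPn => p pp; apply/negP => /set_mem hl.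
  exact: h hl.
have := indep (B := fun=> B) (pairs_uniq n) (@mem_pairs n) (fun=> mB).
rewrite /pr => ->; rewrite (eq_big_seq (fun=> (1 - \sum_(l in Z) cell_prob l)%:E)); last first.
  move=> p pp; rewrite XB prE; last by apply: measurableC; exact: bigsetU_measurable.
  by rewrite prC ?pr_hits//; [exact: mem_pairs pp | exact: bigsetU_measurable].
rewrite prodEFin/= big_const_seq count_predT.
by elim: (size _) => [|k IH]; rewrite ?expr0//= IH exprS.
Qed.

(* A count [c] satisfies 1_(c >= 2) <= c - 1_(c >= 1). *)
Lemma pr_entries_doubled n l : (l < m)%N ->
  pr P (doubled tau m (fun w => eig_process b (abs_entries n w)) l) <=
  (size (pairs n))%:R * cell_prob l - 1 + (1 - cell_prob l) ^+ size (pairs n).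
Proof.
move=> lm; pose l' := Ordinal lm; pose Y w := eig_process b (abs_entries n w).
have pY : point_process Y by exact: point_process_entries.
have := pr_entries_vacant n [set l']; rewrite big_set1 => <-.
rewrite -/Y; set V := [set w | _].
have mV : measurable V.
  have mv (i : 'I_m) : measurable [set w | i \in vacant tau m (Y w)].
    exact: measurable_vacant.
  exact: (measurable_set_pred mv (fun W : {set 'I_m} => [set l']%SET \subset W)).
have mD := measurable_doubled tau m pY l.
have b1 p : bmeas (\1_(hit p l) : T -> R) by exact: bmeas_indic.
have -> : (size (pairs n))%:R * cell_prob l = Ex P (fun w => \sum_(p <- pairs n) \1_(hit p l) w).
  rewrite Ex_sum; last by [].
  rewrite (eq_big_seq (fun=> cell_prob l)); last first.
    by move=> p pp; rewrite Ex_indic// pr_hit// (mem_pairs pp).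
  by rewrite big_const_seq count_predT iter_addr addr0 mulr_natl.
rewrite -(Ex_indic P mD) -(Ex_indic P mV) -[in leRHS](Ex_cst P 1) -ExB; [|exact: bmeas_sum|exact: bmeas_cst].
have bV : bmeas (\1_V : T -> R) by exact: bmeas_indic.
have bS : bmeas (fun w => \sum_(p <- pairs n) \1_(hit p l) w - 1 : R).
  by apply: bmeasB; [exact: bmeas_sum | exact: bmeas_cst].
rewrite -ExD//; apply: le_Ex; [exact: bmeas_indic | exact: bmeasD |] => w.
set c := count (fun p => w \in hit p l) (pairs n).
have -> : \sum_(p <- pairs n) \1_(hit p l) w = c%:R :> R.
  by rewrite /c -sum1_count natr_sum [RHS]big_mkcond /=; apply: eq_bigr => p _; rewrite indicE; case: (_ \in _).
have Yc : Y w (cell tau m l) = (c%:R)%:E := cell_count n w l.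
have VE : (w \in V) = (c == 0)%N.
  by apply/idP/idP => [/set_mem|h]; [|apply/mem_set]; move: (Yc); rewrite /V /= finset.sub1set inE /= => ->; rewrite eqe pnatr_eq0 // => ->.
have DE : w \in doubled tau m Y l -> (1 < c)%N.
  move=> /set_mem; rewrite /doubled /= Yc; case: (c) => [|[|c']]//.
    by case; left.
  by case; right.
clearbody c; rewrite !indicE VE; case: (boolP (w \in _)) => [/DE c1|_].
  by case: c c1 {VE DE Yc} => [|[|c]]// _; rewrite /= addr0 -[c.+2%:R]natr1 addrK ler1n.
by case: c {VE DE Yc} => [|c]; rewrite /= ?sub0r ?addNr// addr0 -natr1 addrK.
Qed.

End Grid.

Variables (alpha : R) (b : nat -> R).
Hypotheses (alpha0 : 0 < alpha) (b_pos : \forall n \near \oo, 0 < b n).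
Hypothesis tailG : forall x : R, 0 < x ->
  (n * n.+1)%:R / 2 * G (x * b n) @[n --> \oo] --> x `^ (- alpha).

Let nG_cvg0 x : 0 < x -> n%:R * G (x * b n) @[n --> \oo] --> 0.
Proof.
move=> x0; rewrite -[X in _ --> (X : R)](mulr0 (x `^ (- alpha) * 2)).
have -> : (fun n => n%:R * G (x * b n)) = (fun n => ((n * n.+1)%:R / 2 * G (x * b n) * 2) * n.+1%:R^-1).
  by apply/funext => n; rewrite natrM; field; rewrite nat1r.
by apply: cvgM; [apply: cvgMl; exact: tailG | exact: cvg_harmonic].
Qed.

Lemma pairs_tail_cvg (x : R) : 0 < x ->
  (size (pairs n))%:R * G (x * b n) @[n --> \oo] --> x `^ (- alpha).
Proof.
move=> x0; under eq_fun do rewrite pairs_natr mulrBl.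
by rewrite -[x `^ _]subr0; apply: cvgB; [exact: tailG | exact: nG_cvg0].
Qed.

Lemma tail_cvg0 (x : R) : 0 < x -> G (x * b n) @[n --> \oo] --> 0.
Proof.
move=> x0; have G0 y : 0 <= G y by rewrite -(@XG (0%N, 0%N))// pr_ge0.
apply: (@squeeze_cvgr _ _ _ _ (cst 0) (fun n => n%:R * G (x * b n))); [|exact: cvg_cst|exact: nG_cvg0].
by exists 1%N => // n n0 /=; rewrite G0 ler_peMl// ler1n.
Qed.

Section Grid.
Variables (tau : nat -> R) (m : nat).
Hypotheses (tau_gt0 : forall i, 0 < tau i) (tau_mono : forall i j, (i <= j)%N -> tau i <= tau j).

Lemma cell_prob_cvg l : (size (pairs n))%:R * cell_prob tau m (b n) l @[n --> \oo] -->
  mass alpha tau m l.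
Proof.
rewrite /cell_prob /mass; under eq_fun do rewrite mulrBr.
apply: cvgB; first exact: pairs_tail_cvg.
case: (_ < m)%N; first exact: pairs_tail_cvg.
by under eq_fun do rewrite mulr0; exact: cvg_cst.
Qed.

Lemma cell_prob_cvg0 l : cell_prob tau m (b n) l @[n --> \oo] --> 0.
Proof.
rewrite -[X in _ --> (X : R)]subr0 /cell_prob; apply: cvgB; first exact: tail_cvg0.
by case: (_ < m)%N; [exact: tail_cvg0 | exact: cvg_cst].
Qed.

Let Y n w := eig_process (b n) (abs_entries n w).

Lemma entries_vacant_cvg (Z : {set 'I_m}) :
  pr P [set w | Z \subset vacant tau m (Y n w)] @[n --> \oo] -->
  expR (- \sum_(l in Z) mass alpha tau m l).
Proof.
(* [expR_limit] asks for a sequence that is nonnegative throughout; the sum is known to be so once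
   [b n] is positive, and the absolute value covers the other [n]. *)
pose p n : R := `|\sum_(l in Z) cell_prob tau m (b n) l|.
have pE : \forall n \near \oo, \sum_(l in Z) cell_prob tau m (b n) l = p n.
  apply: filterS b_pos => n bn; rewrite /p ger0_norm// sumr_ge0// => l _.
  exact: cell_prob_ge0.
have cp : p n @[n --> \oo] --> 0.
  have : \sum_(l in Z) cell_prob tau m (b n) l @[n --> \oo] --> \sum_(l in Z) (0 : R).
    by apply: cvg_fin_sum => l _; exact: cell_prob_cvg0.
  by rewrite big1// => h; rewrite -(normr0 R); exact: cvg_norm.
have cMp : (size (pairs n))%:R * p n @[n --> \oo] --> \sum_(l in Z) mass alpha tau m l.
  have : \sum_(l in Z) (size (pairs n))%:R * cell_prob tau m (b n) l @[n --> \oo] -->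
      \sum_(l in Z) mass alpha tau m l.
    by apply: cvg_fin_sum => l _; exact: cell_prob_cvg.
  apply: cvg_trans; apply: near_eq_cvg; apply: filterS pE => n <-.
  by rewrite mulr_sumr.
have := expR_limit (fun n => normr_ge0 _) cp cMp.
apply: cvg_trans; apply: near_eq_cvg; apply: filterS2 b_pos pE => n bn pn.
by rewrite /Y pr_entries_vacant// [in RHS]pn.
Qed.

Lemma entries_doubled l e : (l < m)%N -> 0 < e ->
  \forall n \near \oo, pr P (doubled tau m (Y n) l) <= mass alpha tau m l ^+ 2 + e.
Proof.
move=> lm e0; pose l' := Ordinal lm; pose mu := mass alpha tau m l.
have mu0 : 0 <= mu by exact: mass_ge0.
have cv : (1 - cell_prob tau m (b n) l) ^+ size (pairs n) @[n --> \oo] --> expR (- mu).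
  have := @entries_vacant_cvg [set l']%SET; rewrite finset.big_set1.
  apply: cvg_trans; apply: near_eq_cvg; apply: filterS b_pos => n bn.
  by rewrite /Y pr_entries_vacant// finset.big_set1.
have cu : (size (pairs n))%:R * cell_prob tau m (b n) l - 1 +
    (1 - cell_prob tau m (b n) l) ^+ size (pairs n) @[n --> \oo] --> mu - 1 + expR (- mu).
  by apply: cvgD => //; apply: cvgB; [exact: cell_prob_cvg | exact: cvg_cst].
(* [exp (- mu) <= 1 / (1 + mu)] bounds the limit by [mu ^ 2]. *)
have lim_lt : mu - 1 + expR (- mu) < mu ^+ 2 + e.
  have h1 := expR_ge1Dx mu; have h2 := expR_gt0 mu.
  have h3 : expR (- mu) * (1 + mu) <= 1.
    by rewrite expRN mulrC ler_pdivrMr// mul1r.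
  have h4 := expR_gt0 (- mu); nra.
apply: filterS2 b_pos (cvgr_lt _ cu _ lim_lt) => n bn h.
apply: le_trans (ltW h); exact: pr_entries_doubled.
Qed.

End Grid.
End Entries.

Section SmallCells.
Variables (R : realType) (alpha : R).
Hypothesis alpha0 : 0 < alpha.

(** Starts at [h] with mesh [h / q], so that every [q]-th point is one of the pattern levels [h],
    [2 h], and so on. *)
Definition grid (h : R) (q l : nat) : R := (q + l)%:R * (h / q%:R).

Lemma grid_gt0 h q l : 0 < h -> (0 < q)%N -> 0 < grid h q l.
Proof. by move=> h0 q0; rewrite mulr_gt0 ?divr_gt0 ?ltr0n// ltn_addr. Qed.

Lemma grid_mono h q i j : 0 < h -> (i <= j)%N -> grid h q i <= grid h q j.
Proof. by move=> h0 ij; rewrite ler_wpM2r ?divr_ge0 ?(ltW h0)// ler_nat leq_add2l. Qed.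

Lemma grid_mul h q s : (0 < q)%N -> grid h q (s * q) = s.+1%:R * h.
Proof.
move=> q0; rewrite /grid -mulSn natrM -mulrA; congr (_ * _).
by rewrite mulrC divfK// pnatr_eq0 -lt0n.
Qed.

Lemma grid_ge h q l : 0 < h -> (0 < q)%N -> h <= grid h q l.
Proof.
move=> h0 q0; have := @grid_mono h q 0 l h0 (leq0n _).
by have := @grid_mul h q 0 q0; rewrite mul0n mul1r => ->.
Qed.

Lemma sum_mass tau m : (0 < m)%N -> \sum_(l < m) mass alpha tau m l = tau 0%N `^ (- alpha).
Proof.
case: m => // m _; rewrite big_ord_recr /= {2}/mass ltnn subr0.
rewrite (eq_bigr (fun l : 'I_m => tau l `^ (- alpha) - tau l.+1 `^ (- alpha))); last first.
  by move=> l _; rewrite /mass ltnS ltn_ord.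
elim: m => [|m IH]; first by rewrite big_ord0 add0r.
by rewrite big_ord_recr /= -addrA subrK.
Qed.

(** Consecutive grid points have ratio at most [1 + 1 / q], because the grid starts at [h], and the
    last of the [q ^ 2 + 1] cells starts at [(q + 1) h]. Both resulting bounds on the mass vanish as
    [q] grows. [r <= q] places all pattern levels on the grid. *)
Lemma small_cells h e r : 0 < h -> 0 < e -> exists q, [/\ (0 < q)%N, (r <= q)%N &
  forall l, (l < (q * q).+1)%N -> mass alpha (grid h q) (q * q).+1 l <= e].
Proof.
move=> h0 e0; pose U := h `^ (- alpha); have U0 : 0 < U by rewrite powR_gt0.
have c1 : U * (1 - (1 + n.+1%:R^-1) `^ (- alpha)) @[n --> \oo] --> (0 : R).
  have -> : 0 = U * (1 - (1 + 0) `^ (- alpha)) by rewrite addr0 powR1 subrr mulr0.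
  apply: cvgMr; apply: cvgB; first exact: cvg_cst.
  have cc : (1 + n.+1%:R^-1 : R) @[n --> \oo] --> (1 + 0 : R).
    by apply: cvgD; [exact: cvg_cst | exact: cvg_harmonic].
  have c10 : 0 < 1 + 0 :> R by rewrite addr0.
  exact: (cvg_comp _ _ cc (@powR_continuous R (1 + 0) (- alpha) c10)).
have c2 := powR_natN_cvg0 U alpha0.
have [n1 _ h1] := cvgr_lt _ c1 _ e0; have [n2 _ h2] := cvgr_lt _ c2 _ e0.
pose q := (n1 + n2 + r).+1; exists q; split => //; first by rewrite /q; lia.
have {}h1 : U * (1 - (1 + q%:R^-1) `^ (- alpha)) <= e.
  by apply: ltW; apply: h1; rewrite /=; lia.
have {}h2 : U * q%:R `^ (- alpha) <= e.
  by apply: ltW; apply: h2; rewrite /=; lia.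
have q0 : 0 < q%:R :> R by rewrite ltr0n.
move=> l lm; have t0 := @grid_gt0 h q l h0 isT; have th := @grid_ge h q l h0 isT.
have na : - alpha <= 0 by rewrite oppr_le0 ltW.
have tU : grid h q l `^ (- alpha) <= U by exact: ge_powR_base.
rewrite /mass; case: ifP => lm'.
  apply: le_trans h1; apply: (@le_trans _ _ (grid h q l `^ (- alpha) * (1 - (1 + q%:R^-1) `^ (- alpha)))).
    rewrite mulrBr mulr1 lerD2l lerN2 -powRM ?(ltW t0)//.
    apply: ge_powR_base; [exact: grid_gt0 | | by []].
    rewrite mulrDr mulr1 {1}/grid addnS -natr1 mulrDl mul1r lerD2l.
    by rewrite ler_pM2r ?invr_gt0.
  have q1 : 1 <= 1 + q%:R^-1 :> R by rewrite lerDl invr_ge0 ltW.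
  apply: ler_wpM2r tU; rewrite subr_ge0; apply: le_trans (ge_powR_base ltr01 q1 na) _.
  by rewrite powR1.
have {lm lm'} -> : l = (q * q)%N by move: lm; rewrite ltnS leq_eqVlt => /orP[/eqP//|]; rewrite -ltnS lm'.
rewrite subr0 grid_mul// mulrC powRM ?(ltW h0)//.
apply: le_trans h2; rewrite ler_wpM2l ?(ltW U0)//.
by apply: ge_powR_base => //; rewrite ler_nat.
Qed.

End SmallCells.

Section EntriesPattern.
Context (R : realType) (d d' : measure_display) (T : measurableType d) (T' : measurableType d').
Variables (P : probability T R) (P' : probability T' R).
Variables (X : nat * nat -> T -> R) (G : R -> R) (alpha : R) (b : nat -> R).
Hypothesis mX : forall p, measurable_fun setT (X p).
Hypothesis indep : mutually_independent P [set p : nat * nat | (p.1 <= p.2)%N] (X : _ -> T -> R).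
Hypothesis XG : forall p (x : R), (p.1 <= p.2)%N -> pr P [set w | x < `|X p w|] = G x.
Hypotheses (alpha0 : 0 < alpha) (b_pos : \forall n \near \oo, 0 < b n).
Hypothesis tailG : forall x : R, 0 < x ->
  (n * n.+1)%:R / 2 * G (x * b n) @[n --> \oo] --> x `^ (- alpha).
Variable N : T' -> pointMeasure R.
Hypothesis hN : Poisson_point_process P' N (fun x : R => alpha / x `^ (1 + alpha)).

Lemma entries_pattern_cvg (h : R) r k : 0 < h ->
  pr P (tail_pattern (fun w => eig_process (b n) (abs_entries X n w)) h r k) @[n --> \oo] -->
  pr P' (tail_pattern N h r k).
Proof.
move=> h0; apply/cvgrPdist_le => e e0.
pose U := h `^ (- alpha); have U0 : 0 < U by rewrite powR_gt0.
(* The squared masses sum to at most [e1] times the total mass [U], that is [e / 4]. *)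
pose e1 := e / (4 * U); have e10 : 0 < e1 by rewrite divr_gt0// mulr_gt0.
have e20 : 0 < e / 2 by rewrite divr_gt0.
have [q [q0 rq small]] := small_cells alpha0 r h0 e10.
set m := (q * q).+1 in small; set tau := grid h q in small.
have tau0 i : 0 < tau i by exact: grid_gt0.
have tau_mono i j : (i <= j)%N -> tau i <= tau j by exact: grid_mono.
have pN : point_process N by case: hN.
have pY n : point_process (fun w => eig_process (b n) (abs_entries X n w)).
  exact: point_process_entries.
have idx s : (s < r)%N -> (s * q < m)%N /\ tau (s * q)%N = s.+1%:R * h.
  move=> sr; split; last exact: grid_mul.
  by rewrite ltnS leq_mul2r (leq_trans (ltnW sr) rq) orbT.
have vac (Z : {set 'I_m}) := entries_vacant_cvg mX indep XG b_pos tailG tau0 tau_mono (Z := Z).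
have := @pattern_close _ tau m tau_mono _ _ _ _ P P' _ N pY pN h r _
  (fun l => mass alpha tau m l ^+ 2) idx k (e / 2) e20.
move=> /(_ _ _ _)/filterS; apply; first last.
- by move=> l; exact: poisson_doubled.
- move=> l e' lm e'0; exact: (entries_doubled mX indep XG alpha0 b_pos tailG tau0 tau_mono lm e'0).
- by move=> Z; rewrite (poisson_vacant alpha0 tau0 tau_mono hN); exact: vac.
move=> n hn; rewrite distrC; apply: le_trans hn _.
have : \sum_(l < m) mass alpha tau m l ^+ 2 <= e1 * U.
  rewrite -[U]/(h `^ _) -(mul1r h) -(grid_mul h 0 q0) mul0n -(@sum_mass _ alpha (grid h q) m)// mulr_sumr.
  apply: ler_sum => l _; rewrite expr2 ler_wpM2r ?small//; exact: mass_ge0.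
have -> : e1 * U = e / 4 by rewrite /e1; field; rewrite gt_eqF.
lra.
Qed.

End EntriesPattern.

(** * Heavy-tailed symmetric matrices *)

(** Altogether [b] has the exponent [s - e <= 0], so its lower bound [N ^ beta] suffices. This turns
    the moment estimates into comparisons of powers of [n]. *)
Lemma scaled_powR (R : realType) (b N th beta s e : R) : 1 <= N -> N `^ beta <= b -> s <= e ->
  (b * N `^ (- th)) `^ s * b `^ (- e) <= N `^ (- (th * s) - beta * (e - s)).
Proof.
move=> N1 Nb se; have N0 : 0 < N by exact: lt_le_trans N1.
have Nb0 : 0 < N `^ beta by rewrite powR_gt0.
have b0 : 0 < b by exact: lt_le_trans Nb.
rewrite powRM ?powR_ge0 ?(ltW b0)// mulrAC -powR_add// -powRrM mulNr.
have -> : - (th * s) - beta * (e - s) = beta * (s - e) + (- (th * s)) by ring.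
rewrite [leRHS]powR_add// ler_wpM2r ?powR_ge0// powRrM; apply: ge_powR_base => //; lra.
Qed.

Lemma quad_const_mx (R : rcfType) n (c : R) (v : 'rV[R]_n) :
  `|dotv (v *m (const_mx c : 'M[R]_n)) v| <= n%:R * `|c| * dotv v v.
Proof.
rewrite quadE; apply: le_trans (ler_norm_sum _ _ _) _.
apply: (@le_trans _ _ (\sum_i \sum_j `|c| * ((v 0 i ^+ 2 + v 0 j ^+ 2) / 2))).
  apply: ler_sum => i _; apply: le_trans (ler_norm_sum _ _ _) _; apply: ler_sum => j _.
  rewrite mxE normrM ler_wpM2l//.
  have h1 := sqr_ge0 (v 0 i - v 0 j); have h2 := sqr_ge0 (v 0 i + v 0 j).
  by rewrite ler_norml; apply/andP; split; nra.
have e (i : 'I_n) : \sum_j `|c| * ((v 0 i ^+ 2 + v 0 j ^+ 2) / 2) =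
    `|c| / 2 * (n%:R * v 0 i ^+ 2 + dotv v v).
  rewrite -mulr_sumr -mulr_suml big_split /= sumr_const card_ord -[_ *+ n]mulr_natl.
  by rewrite /dotv mulrCA mulrC.
rewrite (eq_bigr _ (fun i _ => e i)) -mulr_sumr big_split /= -mulr_sumr sumr_const card_ord.
rewrite -[_ *+ n]mulr_natl (eq_bigr (fun i => v 0 i * v 0 i)) -/(dotv v v); last by [].
rewrite le_eqVlt; apply/orP; left; apply/eqP; by field.
Qed.

Section Union.
Context (R : realType) (d : measure_display) (T : measurableType d) (P : probability T R).

Lemma pr_bigU (I : Type) (s : seq I) (Q : pred I) (F : I -> set T) :
  (forall i, measurable (F i)) ->
  pr P (\big[setU/set0]_(i <- s | Q i) F i) <= \sum_(i <- s | Q i) pr P (F i).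
Proof.
move=> mF; elim: s => [|i s IH]; first by rewrite !big_nil /pr measure0.
rewrite !big_cons; case: ifP => // Qi.
apply: le_trans (prU P (mF i) _) _; first by apply: bigsetU_measurable => j _; exact: mF.
by rewrite lerD2l.
Qed.

Lemma pr_cvg0_pow (B : nat -> set T) (C r : R) : 0 < r ->
  (\forall n \near \oo, pr P (B n) <= C * n%:R `^ (- r)) ->
  pr P (B n) @[n --> \oo] --> 0.
Proof.
move=> r0 h; apply: (@squeeze_cvgr _ _ _ _ (cst 0) (fun n => C * n%:R `^ (- r))).
- by apply: filterS h => n ->; rewrite andbT /= pr_ge0.
- exact: cvg_cst.
- exact: powR_natN_cvg0.
Qed.

End Union.

Lemma edge_inj n (i j j' : 'I_n) : edge i j = edge i j' -> j = j'.
Proof.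
rewrite /edge => -[h1 h2]; apply/val_inj/(@addnI i).
by rewrite -addn_min_max h1 h2 addn_min_max.
Qed.

Lemma edge_sorted n (i j : 'I_n) : ((edge i j).1 <= (edge i j).2)%N.
Proof. by rewrite /= geq_min !leq_max leqnn. Qed.

Section HeavyTailedMatrix.
Context (R : realType) (d : measure_display) (T : measurableType d) (P : probability T R).
Variables (X : nat * nat -> T -> R) (G : R -> R) (alpha : R) (b : nat -> R).
Hypothesis mX : forall p, measurable_fun setT (X p).
Hypothesis indep : mutually_independent P [set p : nat * nat | (p.1 <= p.2)%N] (X : _ -> T -> R).
Hypothesis XG : forall p (x : R), (p.1 <= p.2)%N -> pr P [set w | x < `|X p w|] = G x.
Hypothesis Xid : forall p (g : R -> R), (p.1 <= p.2)%N -> measurable_fun setT g ->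
  (exists M : R, forall x, `|g x| <= M) ->
  Ex P (fun w => g (X p w)) = Ex P (fun w => g (X (0%N, 0%N) w)).
Hypothesis alpha0 : 0 < alpha.
Hypothesis tailG : forall delta : R, 0 < delta -> exists C x0, [/\ 0 < C, 1 <= x0 &
  forall x, x0 <= x -> G x <= C * x `^ (- (alpha - delta))].
Hypothesis b_pow : forall beta : R, 0 < beta -> beta < 2 / alpha ->
  exists n0 : nat, forall n, (n0 <= n)%N -> n%:R `^ beta <= b n.
Hypothesis centered : 2 <= alpha -> ('E_P[X (0%N, 0%N)] = 0)%E.

Definition entries_mx n w : 'M[R]_n := \matrix_(i, j) X (edge i j) w.

Variable kap : R.
Hypotheses (kap0 : 0 < kap) (kap100 : kap <= 1 / 100).
(* The truncation level is [b_n n^-th] and [n^beta <= b_n]. Since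
   [(beta - th) p > 3/2], the bound [n^3 G(b_n n^-th)^2] for the probability that
   some row has two large entries tends to 0. *)
Let th := (4 * alpha)^-1.
Let beta := (2 - kap) / alpha.
Let p := alpha - alpha * kap.

Let th_alpha : th * alpha = 1 / 4.
Proof. by rewrite /th; field; rewrite gt_eqF. Qed.

Let beta_alpha : beta * alpha = 2 - kap.
Proof. by rewrite /beta; field; rewrite gt_eqF. Qed.

Let th0 : 0 < th. Proof. by rewrite /th invr_gt0 mulr_gt0. Qed.

Let beta0 : 0 < beta. Proof. by rewrite /beta divr_gt0//; move: kap100; lra. Qed.

Let betath : th < beta.
Proof. by rewrite -(ltr_pM2r alpha0) th_alpha beta_alpha; move: kap100; lra. Qed.

Let p0 : 0 < p.
Proof. by rewrite /p -{1}(mulr1 alpha) -mulrBr mulr_gt0//; move: kap100; lra. Qed.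

Let b_ge : \forall n \near \oo, n%:R `^ beta <= b n.
Proof.
have [|n0 h] := b_pow beta0; last by exists n0.
by rewrite ltr_pM2r ?invr_gt0//; move: kap0; lra.
Qed.

Definition trunc n := b n * n%:R `^ (- th).

Let trunc_ge M : \forall n \near \oo, M <= trunc n.
Proof.
have bt : 0 < beta - th by rewrite subr_gt0.
have [n0 h] := powR_ge_eventually M bt.
near=> n; have n1 : (0 < n)%N by near: n; exists 1%N.
have nR : 0 < n%:R :> R by rewrite ltr0n.
apply: (@le_trans _ _ (n%:R `^ (beta - th))); first by apply: h; near: n; exists n0.
by rewrite powR_add// /trunc ler_wpM2r ?powR_ge0//; near: n.
Unshelve. all: by end_near.
Qed.

Let scaled s e : s <= e -> \forall n \near \oo,
  trunc n `^ s * b n `^ (- e) <= n%:R `^ (- (th * s) - beta * (e - s)).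
Proof.
move=> se; near=> n; apply: scaled_powR => //.
  by rewrite ler1n; near: n; exists 1%N.
by near: n.
Unshelve. all: by end_near.
Qed.


Definition crowded n : set T :=
  \big[setU/set0]_(t : 'I_n * 'I_n * 'I_n | t.1.2 != t.2)
    ([set w | trunc n < `|X (edge t.1.1 t.1.2) w|] `&` [set w | trunc n < `|X (edge t.1.1 t.2) w|])
  `|` \big[setU/set0]_(i < n) [set w | trunc n < `|X (edge i i) w|].

Let measurable_big n q : measurable [set w | trunc n < `|X q w|].
Proof. exact: measurable_gt. Qed.

Lemma measurable_crowded n : measurable (crowded n).
Proof.
by apply: measurableU; apply: bigsetU_measurable => t _ //; exact: measurableI.
Qed.

Lemma crowdedP n w : ~ crowded n w ->
  (forall i j j' : 'I_n, trunc n < `|entries_mx n w i j| ->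
    trunc n < `|entries_mx n w i j'| -> j = j') /\
  (forall i : 'I_n, ~~ (trunc n < `|entries_mx n w i i|)).
Proof.
move=> nc; split=> [i j j'|i]; rewrite !mxE.
  move=> h1 h2; apply/eqP/negPn/negP => jj'; apply: nc; left.
  by rewrite (bigD1 ((i, j), j'))//=; left.
by apply/negP => h; apply: nc; right; rewrite (bigD1 i)//=; left.
Qed.

(** There are at most [n ^ 3] pairs of entries sharing a row, independent because their edges
    differ, and [n] diagonal entries. The bound is [n ^ 3 * G ^ 2 + n * G], with [G] taken at
    [trunc n]. *)
Lemma pr_crowded_cvg0 : pr P (crowded n) @[n --> \oo] --> 0.
Proof.
have d0 : 0 < alpha * kap by rewrite mulr_gt0.
have [C [x0 [C0 x01 GC]]] := tailG d0; rewrite -/p in GC.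
(* The tail at [trunc n] is at most [C * n ^ (- e)], and [e = (2 - kap - 1 / 4) * (1 - kap)] is
   close to [7 / 4]. *)
pose e := (beta - th) * p.
have eE : 3 / 2 < e.
  have -> : e = (beta * alpha - th * alpha) * (1 - kap) by rewrite /e /p; ring.
  by rewrite th_alpha beta_alpha; move: kap0 kap100; nra.
apply: (@pr_cvg0_pow _ _ _ _ _ (C ^+ 2 + C) (2 * e - 3)); first by lra.
near=> n.
have n1 : (0 < n)%N by near: n; exists 1%N.
have N1 : 1 <= n%:R :> R by rewrite ler1n.
have nR : 0 < n%:R :> R by rewrite ltr0n.
have xx : x0 <= trunc n by near: n; exact: trunc_ge.
have Gx : G (trunc n) <= C * n%:R `^ (- e).
  apply: le_trans (GC _ xx) _; rewrite ler_wpM2l ?(ltW C0)//.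
  have : trunc n `^ (- p) * b n `^ (- 0) <= n%:R `^ (- (th * - p) - beta * (0 - - p)).
    by near: n; apply: scaled; rewrite oppr_le0 ltW.
  rewrite oppr0 powRr0 mulr1; congr (_ <= _ `^ _).
  by rewrite /e; ring.
have G0 : 0 <= G (trunc n) by rewrite -(@XG (0%N, 0%N))// pr_ge0.
have prow : pr P (\big[setU/set0]_(t : 'I_n * 'I_n * 'I_n | t.1.2 != t.2)
    ([set w | trunc n < `|X (edge t.1.1 t.1.2) w|] `&` [set w | trunc n < `|X (edge t.1.1 t.2) w|])) <=
    n%:R ^+ 3 * G (trunc n) ^+ 2.
  apply: le_trans (pr_bigU _ _ _ _) _; first by move=> t; exact: measurableI.
  apply: (@le_trans _ _ (\sum_(t : 'I_n * 'I_n * 'I_n) G (trunc n) ^+ 2)); last first.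
    rewrite sumr_const -[_ *+ _]mulr_natl !card_prod !card_ord !natrM.
    by have -> : n%:R ^+ 3 = n%:R * n%:R * n%:R :> R by ring.
  rewrite big_mkcond /=; apply: ler_sum => -[[i j] j'] _ /=; case: ifPn => jj'; last exact: sqr_ge0.
  have mY : measurable [set y : R | trunc n < `|y|] by apply: (measurable_gt (X := id)).
  have uJ : uniq [:: edge i j; edge i j'].
    by rewrite /= inE andbT; apply: contra_neq jj'; exact: edge_inj.
  have sJ q : q \in [:: edge i j; edge i j'] -> (q.1 <= q.2)%N.
    by rewrite !inE => /orP[] /eqP ->; exact: edge_sorted.
  have := indep uJ sJ (fun=> mY); rewrite big_cons big_seq1 => h.
  rewrite -lee_fin -prE; last exact: measurableI.
  rewrite (_ : _ `&` _ = \bigcap_(q in [set` [:: edge i j; edge i j']]) X q @^-1` [set y | trunc n < `|y|]).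
    rewrite [leLHS]h [X in (X * _)%E](prE P (measurable_big n _)) [X in (_ * X)%E](prE P (measurable_big n _)).
    by rewrite !XG ?edge_sorted// expr2.
  apply/seteqP; split => w /=.
    by case=> h1 h2 q /=; rewrite !inE => /orP[] /eqP ->.
  by move=> h'; split; apply: h'; rewrite /= !inE eqxx ?orbT.
have pdiag : pr P (\big[setU/set0]_(i < n) [set w | trunc n < `|X (edge i i) w|]) <= n%:R * G (trunc n).
  apply: le_trans (pr_bigU _ _ _ _) _; first by [].
  rewrite (eq_bigr (fun=> G (trunc n))); last by move=> i _; rewrite XG// edge_sorted.
  by rewrite sumr_const card_ord mulr_natl.
apply: le_trans (prU P _ _) _.
- by apply: bigsetU_measurable => t _; exact: measurableI.
- by apply: bigsetU_measurable => t _.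
have E1 : n%:R ^+ 3 * G (trunc n) ^+ 2 <= C ^+ 2 * n%:R `^ (- (2 * e - 3)).
  apply: (@le_trans _ _ (n%:R ^+ 3 * (C * n%:R `^ (- e)) ^+ 2)).
    by rewrite ler_wpM2l ?exprn_ge0// lerXn2r ?nnegrE// (le_trans G0).
  rewrite exprMn mulrCA ler_wpM2l ?exprn_ge0 ?(ltW C0)//.
  have -> : - (2 * e - 3) = 3%:R + (- e) * 2%:R by ring.
  by rewrite powR_add// powRrM !powR_mulrn ?powR_ge0 ?(ltW nR).
have E2 : n%:R * G (trunc n) <= C * n%:R `^ (- (2 * e - 3)).
  apply: (@le_trans _ _ (n%:R * (C * n%:R `^ (- e)))); first by rewrite ler_wpM2l.
  rewrite mulrCA ler_wpM2l ?(ltW C0)// -{1}(powRr1 (ltW nR)) -powR_add//.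
  apply: le_powR_exp => //; suff : e <= 2 by lra.
  have -> : e = (beta * alpha - th * alpha) * (1 - kap) by rewrite /e /p; ring.
  by rewrite th_alpha beta_alpha; move: kap0 kap100; nra.
by rewrite mulrDl; lra.
Unshelve. all: by end_near.
Qed.

Definition cut_mx n w : 'M[R]_n := sym_rv X n (cut (trunc n)) w.

Lemma cut_mxE n w : cut_mx n w =
  \matrix_(i, j) (if trunc n < `|entries_mx n w i j| then 0 else entries_mx n w i j).
Proof. by apply/matrixP => i j; rewrite !mxE /cut; case: ltP. Qed.

Let sym_rv_tr n g w : (sym_rv X n g w)^T = sym_rv X n g w.
Proof. by apply/matrixP => i j; rewrite !mxE /edge minnC maxnC. Qed.

Let bmeas_power n (g : R -> R) k i j : measurable_fun setT g ->
  (exists M : R, forall x, `|g x| <= M) -> bmeas (fun w => (sym_rv X n g w ^+ k) i j).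
Proof.
move=> mg gM; elim: k i j => [|k IH] i j.
  by under eq_fun do rewrite expr0 mxE; exact: bmeas_cst.
under eq_fun do rewrite exprS mxE.
apply: bmeas_sum => l _; apply: bmeasM; last exact: IH.
by under eq_fun do rewrite mxE; exact: bmeas_comp.
Qed.

Let bmeas_trace n (g : R -> R) k : measurable_fun setT g ->
  (exists M : R, forall x, `|g x| <= M) -> bmeas (fun w => \tr (sym_rv X n g w ^+ k)).
Proof. by move=> mg gM; apply: bmeas_sum => i _; exact: bmeas_power. Qed.

Definition small_whp (eta del : R) n := exists B, [/\ measurable B, pr P B <= del &
  forall w, ~ B w -> forall v, `|dotv (v *m cut_mx n w) v| <= eta * b n * dotv v v].

Let second_moment (s : R) : 0 < s -> 2 - p <= s -> exists2 K, 0 < K &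
  \forall n \near \oo, forall q, (q.1 <= q.2)%N ->
    Ex P (fun w => cut (trunc n) (X q w) ^+ 2) <= K * trunc n `^ s.
Proof.
move=> s0 ps; have d0 : 0 < alpha * kap by rewrite mulr_gt0.
have [C [x0 [C0 x01 GC]]] := tailG d0; rewrite -/p in GC.
have GC' x : x0 <= x -> pr P [set w | x < `|X (0%N, 0%N) w|] <= C * x `^ (- p).
  by move=> xx; rewrite XG//; exact: GC.
have [K K0 hK] := second_moment_bound (mX (0%N, 0%N)) x01 C0 GC' s0 ps.
exists K => //; apply: filterS (trunc_ge x0) => n xn q qq.
have t0 : 0 <= trunc n by apply: le_trans xn; apply: le_trans x01.
rewrite (Xid (g := fun y => cut (trunc n) y ^+ 2))//; first exact: hK.
  by apply: measurable_funX; exact: measurable_cut.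
exists (trunc n ^+ 2) => y; rewrite normrX lerXn2r ?nnegrE// cut_le//.
Qed.

Let eventually_small (C r e : R) : 0 < r -> 0 < e -> \forall n \near \oo, C * n%:R `^ (- r) <= e.
Proof.
move=> r0 e0; apply: filterS (cvgr_lt _ (powR_natN_cvg0 C r0) _ e0) => n; exact: ltW.
Qed.

(** The expected squared Frobenius norm is at most [n ^ 2 * K * trunc n ^ s]; Markov's inequality
    compares it with [(eta * b n) ^ 2]. *)
Lemma small_part_lt2 eta del : alpha < 2 -> 16 * alpha * kap <= 2 - alpha ->
  0 < eta -> 0 < del -> \forall n \near \oo, small_whp eta del n.
Proof.
move=> a2 kap2 eta0 del0; pose s := 2 - p.
have s0 : 0 < s.
  have : 0 < alpha * kap by rewrite mulr_gt0.
  by rewrite /s /p; lra.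
have [K K0 hK] := second_moment s0 (lexx _).
(* The ratio is at most of order [n ^ (- r)]. Truncating below [b n] gains [th * s >= 4 * kap],
   while the [kap] in [beta] and [p] cost less than [3 * kap]. *)
pose r := th * s + beta * (2 - s) - 2.
have r0 : 0 < r.
  have h1 : 4 * kap <= th * s.
    have -> : th * s = (2 - alpha + alpha * kap) / (4 * alpha).
      by rewrite /th /s /p; field; rewrite gt_eqF.
    rewrite ler_pdivlMr ?mulr_gt0//; have : 0 < alpha * kap by rewrite mulr_gt0.
    lra.
  have -> : r = th * s + beta * alpha * (1 - kap) - 2 by rewrite /r /s /p; ring.
  by rewrite beta_alpha; move: kap0; nra.
near=> n.
have n1 : (0 < n)%N by near: n; exists 1%N.
have nR : 0 < n%:R :> R by rewrite ltr0n.
have b0 : 0 < b n by apply: lt_le_trans (_ : n%:R `^ beta <= b n); [rewrite powR_gt0 | near: n].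
have t0 : 0 <= trunc n by near: n; exact: trunc_ge.
have e0 : 0 < eta * b n by rewrite mulr_gt0.
have cutb : exists M : R, forall x, `|cut (trunc n) x| <= M by exists (trunc n) => y; exact: cut_le.
have mcut := measurable_cut (trunc n).
pose f w := \tr (cut_mx n w ^+ 2).
have fE w : f w = \sum_i \sum_j cut_mx n w i j ^+ 2.
  by rewrite /f (@trace_expmx _ _ _ (sym_rv_tr _ _ _) 1).
have bf : bmeas f by exact: bmeas_trace.
have f0 w : 0 <= f w by rewrite fE; do 2 (apply: sumr_ge0 => ? _); exact: sqr_ge0.
exists [set w | (eta * b n) ^+ 2 <= f w]; split.
- rewrite -[X in measurable X]setTI.
  exact: (measurable_fun_le measurableT (measurable_cst _) bf.1).
- apply: le_trans (markov_ineq P _ bf f0) _; first by rewrite exprn_gt0.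
  have Ef : Ex P f <= n%:R ^+ 2 * (K * trunc n `^ s).
    under eq_Ex do rewrite fE.
    rewrite Ex_sum; last first.
      by move=> i _; apply: bmeas_sum => j _; apply: bmeasX; under eq_fun do rewrite mxE; exact: bmeas_comp.
    apply: (@le_trans _ _ (\sum_(i < n) \sum_(j < n) K * trunc n `^ s)).
      apply: ler_sum => i _; rewrite Ex_sum; last first.
        by move=> j _; apply: bmeasX; under eq_fun do rewrite mxE; exact: bmeas_comp.
      apply: ler_sum => j _; under eq_Ex do rewrite mxE.
      by move: (edge i j) (edge_sorted i j); near: n.
    by rewrite !sumr_const !card_ord -[leLHS]mulr_natl -[X in _ * X <= _]mulr_natl mulrA -expr2.
  rewrite ler_pdivrMr ?exprn_gt0//; apply: (le_trans Ef).
  have sc : trunc n `^ s * b n `^ (- 2) <= n%:R `^ (- (th * s) - beta * (2 - s)).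
    by near: n; apply: scaled; rewrite /s; move: p0; lra.
  have sm : K / eta ^+ 2 * n%:R `^ (- r) <= del.
    by near: n; apply: eventually_small.
  have b2 : b n `^ (- 2) = (b n ^+ 2)^-1 by rewrite powRN powR_mulrn// ltW.
  rewrite b2 ler_pdivrMr ?exprn_gt0// in sc.
  have n2 : n%:R ^+ 2 * n%:R `^ (- (th * s) - beta * (2 - s)) = n%:R `^ (- r).
    rewrite -powR_mulrn ?(ltW nR)// -powR_add//; congr (_ `^ _); by rewrite /r; ring.
  apply: (@le_trans _ _ (n%:R ^+ 2 * (K * (n%:R `^ (- (th * s) - beta * (2 - s)) * b n ^+ 2)))).
    by rewrite ler_wpM2l ?exprn_ge0// ler_wpM2l ?(ltW K0).
  have -> : n%:R ^+ 2 * (K * (n%:R `^ (- (th * s) - beta * (2 - s)) * b n ^+ 2)) =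
      (K / eta ^+ 2 * n%:R `^ (- r)) * (eta * b n) ^+ 2.
    by rewrite -n2; field; rewrite gt_eqF.
  by rewrite ler_wpM2r ?sqr_ge0.
- move=> w /negP; rewrite -ltNge => /ltW fw v.
  by apply: (@quad_trace_le _ _ _ (sym_rv_tr _ _ _) 0 _ v (ltW e0)).
Unshelve. all: by end_near.
Qed.

Let cut_mean n := Ex P (fun w => cut (trunc n) (X (0%N, 0%N) w)).

Let cut_mean_le : 2 <= alpha -> exists2 K, 0 < K &
  \forall n \near \oo, `|cut_mean n| <= K * trunc n `^ (1 - p).
Proof.
move=> a2; have d0 : 0 < alpha * kap by rewrite mulr_gt0.
have [C [x0 [C0 x01 GC]]] := tailG d0; rewrite -/p in GC.
have GC' x : x0 <= x -> pr P [set w | x < `|X (0%N, 0%N) w|] <= C * x `^ (- p).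
  by move=> xx; rewrite XG//; exact: GC.
have p1 : 1 < p by rewrite /p; move: a2 kap0 kap100; nra.
have [K K0 hK] := truncated_mean_bound (mX (0%N, 0%N)) x01 C0 GC' p1 (centered a2).
by exists K => //; apply: filterS (trunc_ge x0) => n; exact: hK.
Qed.

(** The truncated matrix is [b n] times a centred bounded matrix plus a constant mean matrix.
    [trace_moment] with a large even power handles the first, [quad_const_mx] the second; each
    receives [eta / 2]. *)
Lemma small_part_ge2 eta del : 2 <= alpha -> 16 * kap <= 4 - alpha ->
  0 < eta -> 0 < del -> \forall n \near \oo, small_whp eta del n.
Proof.
(* [2 - p <= alpha * kap <= 4 * kap], so the truncated second moment grows at most like this small
   power. *)
move=> a2 kap4 eta0 del0; pose s := 4 * kap.
have s0 : 0 < s by rewrite mulr_gt0.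
have ps : 2 - p <= s by rewrite /s /p; move: a2 kap0 kap4; nra.
have s2 : s <= 2 by rewrite /s; move: kap100; lra.
have [K K0 hK] := second_moment s0 ps.
have [K' K'0 hK'] := cut_mean_le a2.
(* [n] times the variance over [b n ^ 2] is at most of order [n ^ (- tau)]. That [tau > 0] rests on
   [alpha < 4], in the form [16 * kap <= 4 - alpha]. *)
pose tau := beta * (2 - s) - 1.
have tau0 : 0 < tau.
  rewrite /tau subr_gt0 -(ltr_pM2r alpha0) mul1r mulrAC beta_alpha /s.
  by move: kap0 kap4 kap100 a2; nra.
(* At most [th], so that [rho] bounds the entries; at most [tau / 4], so that [rho ^ 2] bounds [n]
   times the variance with a factor [n ^ (- (2 * sig))] to spare against the constant [K]. *)
pose sig := Num.min th (tau / 4).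
have sig0 : 0 < sig by rewrite lt_min th0 divr_gt0.
have sig_th : sig <= th by rewrite ge_min lexx.
have sig_tau : 4 * sig <= tau.
  have : sig <= tau / 4 by rewrite ge_min lexx orbT.
  lra.
(* Ensures [sig * q >= 2], so that [rho ^ q <= 2 ^ q / n ^ 2] beats the factor [n] of
   [trace_moment]; [q] has the shape required by [quad_trace_le]. *)
pose r := (Num.truncn sig^-1).+1; pose q := (2 ^ r + 2 ^ r)%N.
have sq : 2 <= sig * q%:R.
  have h1 : 1 <= sig * r%:R.
    rewrite -ler_pdivrMl// mulr1; apply: ltW; exact: truncnS_gt.
  have h2 : r%:R <= (2 ^ r)%:R :> R by rewrite ler_nat ltnW// ltn_expl.
  have h3 : sig * r%:R <= sig * (2 ^ r)%:R by rewrite ler_wpM2l// ltW.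
  by rewrite natrD mulrDr; lra.
pose W := (walk_cst 1 q)%:R : R.
(* [n] times the truncated mean, divided by [b n], is at most of order [n ^ (- ex)]. *)
pose ex := th + (beta - th) * p - 1.
have ex0 : 0 < ex.
  have -> : ex = th + (beta * alpha - th * alpha) * (1 - kap) - 1 by rewrite /ex /p; ring.
  by rewrite th_alpha beta_alpha; move: kap0 kap100 th0; nra.
near=> n.
have n1 : (0 < n)%N by near: n; exists 1%N.
have nR : 0 < n%:R :> R by rewrite ltr0n.
have N1 : 1 <= n%:R :> R by rewrite ler1n.
have b0 : 0 < b n by apply: lt_le_trans (_ : n%:R `^ beta <= b n); [rewrite powR_gt0 | near: n].
have t0 : 0 <= trunc n by near: n; exact: trunc_ge.
have mcut := measurable_cut (trunc n).
have cutb : exists M : R, forall x, `|cut (trunc n) x| <= M by exists (trunc n) => y; exact: cut_le.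
pose m := cut_mean n; pose g y : R := (cut (trunc n) y - m) / b n.
pose rho : R := 2 * n%:R `^ (- sig).
have rho0 : 0 <= rho by rewrite mulr_ge0 ?powR_ge0.
have bcut l : bmeas (fun w => cut (trunc n) (X l w)) by exact: bmeas_cut.
have m_le : `|m| <= trunc n.
  by apply: Ex_le_bound => // w; exact: cut_le.
have mg : measurable_fun setT g.
  by apply: measurable_funM; [apply: measurable_funB => // | ]; exact: measurable_cst.
have grho y : `|g y| <= rho.
  rewrite normrM normfV (gtr0_norm b0) ler_pdivrMr//.
  apply: le_trans (ler_normB _ _) _; apply: (@le_trans _ _ (trunc n + trunc n)).
    by rewrite lerD// cut_le.
  rewrite /trunc /rho -mulr2n -[leLHS]mulr_natl (mulrC (b n)) -[leRHS]mulrA.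
  by rewrite ler_wpM2l// ler_wpM2r ?(ltW b0)// le_powR_exp// lerN2.
have gb : exists M : R, forall x, `|g x| <= M by exists rho.
have Ecut l : (l.1 <= l.2)%N -> Ex P (fun w => cut (trunc n) (X l w)) = m.
  by move=> ll; rewrite (Xid ll mcut cutb).
have g_mean l : (l.1 <= l.2)%N -> Ex P (fun w => g (X l w)) = 0.
  move=> ll; under eq_Ex do rewrite /g mulrC.
  rewrite ExZ; last by apply: bmeasB => //; exact: bmeas_cst.
  by rewrite ExB ?Ex_cst ?Ecut ?subrr ?mulr0//; exact: bmeas_cst.
have g_var l : (l.1 <= l.2)%N -> n%:R * Ex P (fun w => g (X l w) ^+ 2) <= rho ^+ 2.
  move=> ll; have gE w : g (X l w) ^+ 2 =
      (b n ^+ 2)^-1 * (cut (trunc n) (X l w) ^+ 2 + ((- (2 * m)) * cut (trunc n) (X l w) + m ^+ 2)).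
    by rewrite /g; field; rewrite gt_eqF.
  under eq_Ex do rewrite gE.
  have bc2 : bmeas (fun w => cut (trunc n) (X l w) ^+ 2) by exact: bmeasX.
  have bc1 : bmeas (fun w => - (2 * m) * cut (trunc n) (X l w)) by exact: bmeasZ.
  have bc0 : bmeas (fun w : T => m ^+ 2) by exact: bmeas_cst.
  rewrite ExZ; last by apply: bmeasD => //; exact: bmeasD.
  rewrite ExD//; last exact: bmeasD.
  rewrite ExD// ExZ// Ex_cst Ecut//.
  have h1 : Ex P (fun w => cut (trunc n) (X l w) ^+ 2) <= K * trunc n `^ s.
    by move: l ll {gE bc2 bc1}; near: n.
  have sc : trunc n `^ s * b n `^ (- 2) <= n%:R `^ (- (th * s) - beta * (2 - s)).
    by near: n; exact: scaled.
  have b2 : b n `^ (- 2) = (b n ^+ 2)^-1 by rewrite powRN powR_mulrn// ltW.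
  rewrite b2 in sc.
  have sc' : n%:R `^ (- (th * s) - beta * (2 - s)) <= n%:R `^ (- 1 + (- (2 * sig) + (- (2 * sig)))).
    apply: le_powR_exp => //; have : 0 <= th * s by rewrite mulr_ge0 ?(ltW th0) ?(ltW s0).
    by move: sig_tau; rewrite /tau; lra.
  have sm : K * n%:R `^ (- (2 * sig)) <= 4.
    by near: n; apply: eventually_small; rewrite ?mulr_gt0.
  have rho2 : rho ^+ 2 = 4 * n%:R `^ (- (2 * sig)).
    rewrite /rho exprMn -[X in _ * X = _]powR_mulrn ?powR_ge0// -powRrM.
    have -> : - sig * 2%:R = - (2 * sig) by ring.
    by congr (_ * _); ring.
  rewrite [leRHS]powR_add// [X in _ <= _ * X]powR_add// in sc'.
  have n11 : n%:R * n%:R `^ (- 1) = 1 :> R by rewrite powRN powRr1 ?(ltW nR)// divff// gt_eqF.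
  have bi0 : 0 <= (b n ^+ 2)^-1 by rewrite invr_ge0 sqr_ge0.
  apply: (@le_trans _ _ (n%:R * ((b n ^+ 2)^-1 * (K * trunc n `^ s)))).
    rewrite ler_wpM2l ?(ltW nR)// ler_wpM2l//; apply: le_trans h1; have := sqr_ge0 m; nra.
  apply: (@le_trans _ _ (n%:R * (K * (n%:R `^ (- 1) * (n%:R `^ (- (2 * sig)) * n%:R `^ (- (2 * sig))))))).
    rewrite ler_wpM2l ?(ltW nR)// mulrCA ler_wpM2l ?(ltW K0)// mulrC.
    exact: le_trans sc sc'.
  by rewrite rho2 mulrCA [X in _ * X <= _]mulrA n11 mul1r [leLHS]mulrA ler_wpM2r ?powR_ge0.
pose f w := \tr (sym_rv X n g w ^+ q).
have bf : bmeas f by exact: bmeas_trace.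
have f0 w : 0 <= f w.
  rewrite /f /q (trace_expmx (sym_rv_tr _ _ _)).
  by do 2 (apply: sumr_ge0 => ? _); exact: sqr_ge0.
have e2 : 0 < eta / 2 by rewrite divr_gt0.
have Ef : Ex P f <= rho ^+ q * (n%:R * W).
  by rewrite /W -natrM; exact: (trace_moment mX indep n1 mg grho g_mean g_var).
have mean_small : n%:R * `|m| <= b n * (eta / 2).
  have h1 : `|cut_mean n| <= K' * trunc n `^ (1 - p) by near: n.
  have sc : trunc n `^ (1 - p) * b n `^ (- 1) <= n%:R `^ (- (th * (1 - p)) - beta * (1 - (1 - p))).
    by near: n; apply: scaled; move: p0; lra.
  rewrite powRN powRr1 ?(ltW b0)// ler_pdivrMr// in sc.
  have sm : K' * n%:R `^ (- ex) <= eta / 2 by near: n; apply: eventually_small; rewrite ?divr_gt0.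
  have nn : n%:R * n%:R `^ (- (th * (1 - p)) - beta * (1 - (1 - p))) = n%:R `^ (- ex).
    rewrite -{1}(powRr1 (ltW nR)) -powR_add//; congr (_ `^ _); rewrite /ex; ring.
  apply: (@le_trans _ _ (n%:R * (K' * (n%:R `^ (- (th * (1 - p)) - beta * (1 - (1 - p))) * b n)))).
    rewrite ler_wpM2l ?(ltW nR)//; apply: le_trans h1 _.
    by rewrite ler_wpM2l ?(ltW K'0).
  have -> : n%:R * (K' * (n%:R `^ (- (th * (1 - p)) - beta * (1 - (1 - p))) * b n)) =
     b n * (K' * n%:R `^ (- ex)) by rewrite -nn; ring.
  by rewrite ler_wpM2l ?(ltW b0).
exists [set w | (eta / 2) ^+ q <= f w]; split.
- rewrite -[X in measurable X]setTI.
  exact: (measurable_fun_le measurableT (measurable_cst _) bf.1).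
- apply: le_trans (markov_ineq P _ bf f0) _; first by rewrite exprn_gt0.
  rewrite ler_pdivrMr ?exprn_gt0//; apply: (le_trans Ef).
  have sm : 2 ^+ q * W / (eta / 2) ^+ q * n%:R `^ (- 1) <= del.
    by near: n; apply: eventually_small.
  have rq : rho ^+ q <= 2 ^+ q * n%:R `^ (- 2).
    rewrite /rho exprMn ler_wpM2l ?exprn_ge0// -powR_mulrn ?powR_ge0// -powRrM.
    by apply: le_powR_exp => //; rewrite mulNr lerN2.
  apply: (@le_trans _ _ (2 ^+ q * n%:R `^ (- 2) * (n%:R * W))).
    by rewrite ler_wpM2r// mulr_ge0 ?(ltW nR)// ler0n.
  have n2 : n%:R `^ (- 2) * n%:R = n%:R `^ (- 1) :> R.
    by rewrite -{2}(powRr1 (ltW nR)) -powR_add//; congr (_ `^ _); ring.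
  have -> : 2 ^+ q * n%:R `^ (- 2) * (n%:R * W) =
      2 ^+ q * W / (eta / 2) ^+ q * n%:R `^ (- 1) * (eta / 2) ^+ q.
    have Ep : 0 < (eta / 2) ^+ q by rewrite exprn_gt0.
    rewrite -n2; move: Ep; move: ((eta / 2) ^+ q) (2 ^+ q) (n%:R `^ (- 2)) => E U V Ep.
    by field; rewrite gt_eqF.
  by rewrite ler_wpM2r// exprn_ge0// ltW.
- move=> w /negP; rewrite -ltNge => /ltW fw v.
  have h1 := @quad_trace_le _ _ _ (sym_rv_tr n g w) r _ v (ltW e2) fw.
  have -> : cut_mx n w = b n *: sym_rv X n g w + const_mx m.
    by apply/matrixP => i j; rewrite !mxE /g; field; rewrite gt_eqF.
  have v0 : 0 <= dotv v v by apply: sumr_ge0 => i _; rewrite -expr2 sqr_ge0.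
  rewrite quadD; apply: le_trans (ler_normD _ _) _.
  have h2 := quad_const_mx m v.
  have -> : dotv (v *m (b n *: sym_rv X n g w)) v = b n * dotv (v *m sym_rv X n g w) v.
    by rewrite -scalemxAr dotvZl.
  rewrite normrM (gtr0_norm b0).
  have h3 : b n * `|dotv (v *m sym_rv X n g w) v| <= b n * (eta / 2 * dotv v v).
    by rewrite ler_wpM2l ?(ltW b0).
  have h4 : n%:R * `|m| * dotv v v <= b n * (eta / 2) * dotv v v by rewrite ler_wpM2r.
  have -> : eta * b n * dotv v v = b n * (eta / 2 * dotv v v) + b n * (eta / 2) * dotv v v by field.
  by rewrite lerD// (le_trans h2).
Unshelve. all: by end_near.
Qed.

End HeavyTailedMatrix.

(** * Eigenvalues *)

(* The sublevel sets of [f] are countable unions of sets [sum_i |g_i - q_i| < r]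
   with rational centres and radii. *)
Lemma measurable_lipschitz (R : realType) (d : measure_display) (T : measurableType d)
    (I : finType) (g : I -> T -> R) (f : T -> R) :
  (forall i, measurable_fun setT (g i)) ->
  (forall w w', f w <= f w' + \sum_i `|g i w - g i w'|) -> measurable_fun setT f.
Proof.
move=> mg fg mT; apply: (measurability _ (RGenInftyO.measurableE R)) => //.
move=> _ [_ [t ->] <-]; rewrite setTI.
pose F (u : {ffun I -> rat} * rat) : set T :=
  [set w | (\sum_i `|g i w - ratr (u.1 i)| < ratr u.2) /\
    forall w', \sum_i `|g i w' - ratr (u.1 i)| < ratr u.2 -> f w' < t].
have -> : f @^-1` `]-oo, t[%classic = \bigcup_u F u.
  apply/seteqP; split => w /=; rewrite in_itv/=; last first.
    by case=> u _ [wu h]; exact: h.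
  move=> ft; pose e := (t - f w) / 2; have e0 : 0 < e by rewrite divr_gt0// subr_gt0.
  have [r /[!in_itv]/= /andP[r0 re]] := rat_in_itvoo e0.
  pose c : R := ratr r / #|I|.+1%:R; have c0 : 0 < c by rewrite divr_gt0.
  have ex i : exists q : rat, `|g i w - ratr q| < c.
    have lt : g i w - c < g i w + c by lra.
    have [q /[!in_itv]/= /andP[q1 q2]] := rat_in_itvoo lt.
    by exists q; rewrite ltr_distl; apply/andP; split; lra.
  have [q hq] := choice ex.
  have hw : \sum_i `|g i w - ratr (q i)| < ratr r.
    apply: (@le_lt_trans _ _ (\sum_(i : I) c)); first by apply: ler_sum => i _; exact: ltW.
    rewrite sumr_const -[_ *+ _]mulr_natr /c mulrAC ltr_pdivrMr// ltr_pM2l//.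
    by rewrite ltr_nat.
  exists ([ffun i => q i], r) => //; split => /= [|w'].
    by under eq_bigr do rewrite ffunE.
  under eq_bigr do rewrite ffunE.
  move=> hw'; apply: le_lt_trans (fg w' w) _.
  have : \sum_i `|g i w' - g i w| <= \sum_i `|g i w' - ratr (q i)| + \sum_i `|g i w - ratr (q i)|.
    rewrite -big_split /=; apply: ler_sum => i _.
    have -> : g i w' - g i w = (g i w' - ratr (q i)) - (g i w - ratr (q i)) by ring.
    exact: ler_normB.
  by move: re; rewrite /e; lra.
apply: countable_bigcupT_measurable; first exact: countableP.
move=> u; have [h|nh] := pselect (forall w', \sum_i `|g i w' - ratr (u.1 i)| < ratr u.2 -> f w' < t).
  rewrite (_ : F u = [set w | \sum_i `|g i w - ratr (u.1 i)| < ratr u.2]); last first.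
    by apply/seteqP; split => w; [case | split].
  have mS : measurable_fun setT (fun w => \sum_i `|g i w - ratr (u.1 i)|).
    apply: measurable_sum => i; apply: measurableT_comp; first exact: normr_measurable.
    by apply: measurable_funB => //; exact: measurable_cst.
  rewrite (_ : [set w | _] = setT `&` (fun w => \sum_i `|g i w - ratr (u.1 i)|) @^-1` `]-oo, ratr u.2[%classic).
    by apply: mS => //; exact: measurable_itv.
  by rewrite setTI; apply/seteqP; split => w /=; rewrite in_itv.
by rewrite (_ : F u = set0)//; apply/seteqP; split => w //= -[].
Qed.

Section Eigenvalues.
Context (R : realType) (d : measure_display) (T : measurableType d) (P : probability T R).
Variable X : nat * nat -> T -> R.
Hypothesis mX : forall p, measurable_fun setT (X p).
Variable lambda : forall n : nat, T -> n.-tuple R.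
Hypothesis hlambda : forall n w, ordered_eigenvalues (entries_mx X n w) (lambda n w).

Lemma entries_mx_tr n w : (entries_mx X n w)^T = entries_mx X n w.
Proof. by apply/matrixP => i j; rewrite !mxE /edge minnC maxnC. Qed.

(** [lambda] is only known to list the eigenvalues at each [w]. Measurability comes from their
    Lipschitz dependence on the entries, by Weyl's inequality and [quad_entries]. *)
Lemma measurable_eigenvalue n k : measurable_fun setT (fun w => (lambda n w)`_k).
Proof.
have [kn|nk] := ltnP k n; last first.
  rewrite (_ : (fun w => _) = cst 0); first exact: measurable_cst.
  by apply/funext => w; rewrite nth_default ?size_tuple.
apply: (@measurable_lipschitz _ _ _ ('I_n * 'I_n)%type (fun ij w => entries_mx X n w ij.1 ij.2)).
  move=> [i j] /=; rewrite (_ : (fun w => _) = X (edge i j))//.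
  by apply/funext => w; rewrite mxE.
move=> w w'; rewrite -lerBlDr -(pair_bigA _ (fun i j => `|entries_mx X n w i j - entries_mx X n w' i j|)) /=.
have [s1 c1] := hlambda n w; have [s2 c2] := hlambda n w'.
apply: (eigenvalue_perturbation (A := entries_mx X n w') (B := entries_mx X n w)) => //;
  rewrite ?size_tuple//; try exact: entries_mx_tr.
move=> v; apply: le_trans (quad_entries _ _) _.
rewrite ler_wpM2r//; first by apply: sumr_ge0 => i _; rewrite -expr2 sqr_ge0.
by apply: ler_sum => i _; apply: ler_sum => j _; rewrite !mxE distrC.
Qed.

Lemma point_process_eigenvalues b n : point_process (fun w => eig_process b (lambda n w)).
Proof.
apply: (@point_process_eig _ _ _ _ _ n) => [w|i]; first by rewrite size_tuple.
exact: measurable_eigenvalue.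
Qed.

End Eigenvalues.

Section Transfer.
Context (R : realType) (d d' : measure_display) (T : measurableType d) (T' : measurableType d').
Variables (P : probability T R) (P' : probability T' R).
Variables (X : nat * nat -> T -> R) (G : R -> R) (alpha : R) (b : nat -> R).
Hypothesis mX : forall p, measurable_fun setT (X p).
Hypothesis XG : forall p (x : R), (p.1 <= p.2)%N -> pr P [set w | x < `|X p w|] = G x.
Hypotheses (alpha0 : 0 < alpha) (b_pos : \forall n \near \oo, 0 < b n).
Hypothesis tailG : forall x : R, 0 < x ->
  (n * n.+1)%:R / 2 * G (x * b n) @[n --> \oo] --> x `^ (- alpha).
Variable N : T' -> pointMeasure R.
Hypothesis entries_cvg : forall (h : R) r k, 0 < h ->
  pr P (tail_pattern (fun w => eig_process (b n) (abs_entries X n w)) h r k) @[n --> \oo] -->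
  pr P' (tail_pattern N h r k).
Hypothesis crowded_cvg0 : pr P (crowded X alpha b n) @[n --> \oo] --> 0.
Hypothesis small : forall eta del, 0 < eta -> 0 < del ->
  \forall n \near \oo, small_whp P X alpha b eta del n.
Variable lambda : forall n : nat, T -> n.-tuple R.
Hypothesis hlambda : forall n w, ordered_eigenvalues (entries_mx X n w) (lambda n w).

Let U (x : R) := x `^ (- alpha).

Definition gap n (u v : R) : set T :=
  \big[setU/set0]_(p <- pairs n)
    ([set w | u < `|X p w|] `&` ~` [set w | v < `|X p w|]).

Let measurable_gap n u v : measurable (gap n u v).
Proof.
apply: bigsetU_measurable => p _; apply: measurableI; first exact: measurable_gt.
by apply: measurableC; exact: measurable_gt.
Qed.

Let pr_gap n u v : u <= v -> pr P (gap n u v) <= (size (pairs n))%:R * (G u - G v).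
Proof.
move=> uv; have mg p x := measurable_gt (mX p) x.
apply: le_trans (pr_bigU _ _ _ _) _.
  by move=> p; apply: measurableI; [exact: mg | apply: measurableC; exact: mg].
rewrite (eq_big_seq (fun=> G u - G v)).
  by rewrite big_const_seq count_predT iter_addr addr0 mulr_natl.
move=> p /mem_pairs pp; rewrite -!(XG _ pp) (pr_setID P (mg p u) (mg p v)).
have -> : [set w | u < `|X p w|] `&` [set w | v < `|X p w|] = [set w | v < `|X p w|].
  by apply/seteqP; split => w /=; [case | move=> h; split => //; exact: le_lt_trans h].
by rewrite [RHS]addrAC subrr add0r.
Qed.

Let gap_pairs n u v w x : ~ gap n u v w -> u <= x -> x <= v ->
  large_pairs (entries_mx X n w) x = large_pairs (entries_mx X n w) v.
Proof.
move=> ng ux xv; apply/setP => -[i j]; rewrite !inE /=; apply: andb_id2l => ij.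
rewrite mxE; apply/idP/idP => h; last exact: le_lt_trans h.
rewrite ltNge; apply/negP => h'; apply: ng; rewrite /gap.
have eE : edge i j = (nat_of_ord i, nat_of_ord j).
  by rewrite /edge (minn_idPl (ltnW ij)) (maxn_idPr (ltnW ij)).
have ep : edge i j \in pairs n.
  by rewrite eE; apply/mapP; exists (i, j) => //; rewrite mem_enum inE.
rewrite (big_rem _ ep) /=; left; split => /=; first exact: le_lt_trans h.
by apply/negP; rewrite -leNgt.
Qed.

Let gap_cvg (u v : R) : 0 < u -> 0 < v ->
  (size (pairs n))%:R * (G (u * b n) - G (v * b n)) @[n --> \oo] --> U u - U v.
Proof.
move=> u0 v0; under eq_fun do rewrite mulrBr.
by apply: cvgB; exact: (pairs_tail_cvg tailG).
Qed.

(** By continuity of [x ^ (- alpha)], the limiting mass of windows around the pattern levels tends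
    to 0 with their width; [eta <= h / 4] keeps the windows above the truncation level. *)
Let small_width h r e : 0 < h -> 0 < e -> exists eta, [/\ 0 < eta, eta <= h / 4 &
  \sum_(s < r) (U (s.+1%:R * h - eta) - U (s.+1%:R * h + 2 * eta)) < e].
Proof.
move=> h0 e0; pose w n := h / 4 * n.+1%:R^-1 : R.
have cw : w n @[n --> \oo] --> 0.
  by rewrite -[X in _ --> (X : R)](mulr0 (h / 4)); apply: cvgMr; exact: cvg_harmonic.
have cU (t : R) (c : R) : 0 < t -> U (t + c * w n) @[n --> \oo] --> U t.
  move=> t0; have ct : t + c * w n @[n --> \oo] --> t.
    rewrite -[X in _ --> (X : R)]addr0 -[X in _ + X](mulr0 c).
    by apply: cvgD; [exact: cvg_cst | exact: cvgMr].
  exact: (cvg_comp _ _ ct (@powR_continuous R t (- alpha) t0)).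
have c0 : \sum_(s < r) (U (s.+1%:R * h - w n) - U (s.+1%:R * h + 2 * w n)) @[n --> \oo] -->
    \sum_(s < r) (0 : R).
  apply: cvg_fin_sum => s _; have t0 : 0 < s.+1%:R * h by rewrite mulr_gt0.
  rewrite -(subrr (U (s.+1%:R * h))); apply: cvgB; last exact: cU.
  by under eq_fun do rewrite -mulN1r; exact: cU.
rewrite big1// in c0.
have [n _ /(_ n (leqnn n)) hn] := cvgr_lt _ c0 _ e0.
exists (w n); split => //; first by rewrite /w mulr_gt0 ?divr_gt0// invr_gt0.
by rewrite /w ler_piMr ?divr_ge0 ?(ltW h0)// invf_le1// ler1n.
Qed.

(** Off an event of probability at most [e / 2] the eigenvalue and entry counts agree at every
    pattern level, deterministically: no row is crowded, the small part has norm at most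
    [eta * b n], and no entry falls into the windows around the levels. *)
Lemma eigen_pattern_cvg (h : R) r k : 0 < h ->
  pr P (tail_pattern (fun w => eig_process (b n) (lambda n w)) h r k) @[n --> \oo] -->
  pr P' (tail_pattern N h r k).
Proof.
move=> h0; apply/cvgrPdist_le => e e0.
have e4 : 0 < e / 4 by rewrite divr_gt0.
have e8 : 0 < e / 8 by rewrite divr_gt0.
have e2 : 0 < e / 2 by rewrite divr_gt0.
have [eta [eta0 eta_h sum_lt]] := small_width r h0 e4.
pose t (s : nat) : R := s.+1%:R * h.
have th s : h <= t s by rewrite /t ler_peMl ?(ltW h0)// ler1n.
have tm s : 0 < t s - eta by have := th s; lra.
have tp s : 0 < t s + 2 * eta by have := th s; lra.
have gaps : \forall n \near \oo, \sum_(s < r) (size (pairs n))%:R *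
    (G ((t s - eta) * b n) - G ((t s + 2 * eta) * b n)) < e / 4.
  apply: (cvgr_lt (\sum_(s < r) (U (t s - eta) - U (t s + 2 * eta)))) => //.
  by apply: cvg_fin_sum => s _; exact: gap_cvg.
have crow : \forall n \near \oo, pr P (crowded X alpha b n) < e / 8.
  exact: (cvgr_lt _ crowded_cvg0).
have sm := small eta0 e8.
have ecv : \forall n \near \oo, `|pr P' (tail_pattern N h r k) -
    pr P (tail_pattern (fun w => eig_process (b n) (abs_entries X n w)) h r k)| <= e / 2.
  by have /cvgrPdist_le := @entries_cvg h r k h0; apply.
have tr : \forall n \near \oo, n%:R `^ (- (4 * alpha)^-1) <= h / 2.
  have a0 : 0 < (4 * alpha)^-1 by rewrite invr_gt0 mulr_gt0.
  have h2 : 0 < h / 2 by rewrite divr_gt0.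
  apply: filterS (cvgr_lt _ (powR_natN_cvg0 1 a0) _ h2) => n; rewrite mul1r; exact: ltW.
near=> n.
have bn : 0 < b n by near: n.
have [B [mB prB hB]] : small_whp P X alpha b eta (e / 8) n by near: n.
have tn : trunc alpha b n <= h / 2 * b n.
  rewrite /trunc mulrC ler_wpM2r ?(ltW bn)//; near: n; exact: tr.
have tn0 : 0 <= trunc alpha b n by rewrite /trunc mulr_ge0 ?powR_ge0 ?ltW.
(* The window is asymmetric: the extra [eta] at the upper end turns the weak inequality of
   [large_pairs_le_count] into the strict one that defines a ray. *)
pose D := \big[setU/set0]_(s < r) gap n ((t s - eta) * b n) ((t s + 2 * eta) * b n).
have mD : measurable D by apply: bigsetU_measurable => s _; exact: measurable_gap.
have mC := measurable_crowded alpha b mX n.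
pose bad := crowded X alpha b n `|` B `|` D.
have mbad : measurable bad by apply: measurableU => //; exact: measurableU.
have prbad : pr P bad <= e / 2.
  apply: le_trans (prU P _ mD) _; first exact: measurableU.
  have h1 := prU P mC mB.
  have h2 : pr P D <= e / 4.
    apply: le_trans (pr_bigU _ _ _ _) _; first by move=> s; exact: measurable_gap.
    apply: ltW; apply: (@le_lt_trans _ _ (\sum_(s < r) (size (pairs n))%:R *
      (G ((t s - eta) * b n) - G ((t s + 2 * eta) * b n)))); last by near: n.
    apply: ler_sum => s _; apply: pr_gap; rewrite ler_wpM2r ?(ltW bn)//; lra.
  have h3 : pr P (crowded X alpha b n) < e / 8 by near: n.
  lra.
have mE := measurable_tail_pattern (point_process_eigenvalues mX hlambda (b n) n) h r k.
have mY := measurable_tail_pattern (point_process_entries mX (b n) n) h r k.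
have same w : ~ bad w -> tail_pattern (fun w => eig_process (b n) (lambda n w)) h r k w <->
    tail_pattern (fun w => eig_process (b n) (abs_entries X n w)) h r k w.
  move=> nbad; have nC : ~ crowded X alpha b n w by move=> h1; apply: nbad; left; left.
  have nB : ~ B w by move=> h1; apply: nbad; left; right.
  have nD s : (s < r)%N -> ~ gap n ((t s - eta) * b n) ((t s + 2 * eta) * b n) w.
    move=> sr h1; apply: nbad; right; rewrite /D (bigD1 (Ordinal sr))//=; by left.
  suff E s : (s < r)%N -> eig_process (b n) (lambda n w) (ray (t s)) =
      eig_process (b n) (abs_entries X n w) (ray (t s)).
    by split=> pat s sr; [rewrite -E | rewrite E]; [exact: pat| |exact: pat|].
  move=> sr; have ts : 0 < t s by apply: lt_le_trans (th s).
  rewrite (@abs_entries_ray _ _ _ _ _ _ _ _ (entries_mx X n w))//; last first.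
    by move=> i j ij; rewrite mxE /edge (minn_idPl (ltnW ij)) (maxn_idPr (ltnW ij)).
  rewrite eig_process_ray//; congr (_%:R%:E).
  have [row diag] := crowdedP nC.
  have [sl cl] := hlambda n w.
  have sz : size (lambda n w) = n by rewrite size_tuple.
  have quad := hB w nB; rewrite cut_mxE in quad.
  have u1 : t s - eta <= t s by lra.
  have u2 : t s <= t s + 2 * eta by lra.
  have x1 : trunc alpha b n <= (t s - eta) * b n.
    by apply: le_trans tn _; rewrite ler_wpM2r ?(ltW bn)//; have := th s; lra.
  have x2 : trunc alpha b n <= (t s + 2 * eta) * b n.
    by apply: le_trans x1 _; rewrite ler_wpM2r ?(ltW bn)//; lra.
  have v1 : (t s - eta) * b n <= t s * b n by rewrite ler_wpM2r ?(ltW bn).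
  have v2 : t s * b n <= (t s + 2 * eta) * b n by rewrite ler_wpM2r ?(ltW bn).
  have up := count_le_large_pairs (entries_mx_tr X n w) row diag quad tn0 x1 sz cl.
  have lo := large_pairs_le_count (entries_mx_tr X n w) row diag quad tn0 x2 sz cl.
  apply/eqP; rewrite eqn_leq; apply/andP; split.
    have -> : t s * b n = (t s - eta) * b n + eta * b n by ring.
    apply: (leq_trans up); rewrite (gap_pairs (nD s sr) (lexx _) (le_trans v1 v2)).
    by rewrite -(gap_pairs (nD s sr) v1 v2) (_ : _ + _ = t s * b n)//; ring.
  rewrite (gap_pairs (nD s sr) v1 v2); apply: (leq_trans lo); apply: sub_count => y /=.
  apply: lt_le_trans; have -> : (t s + 2 * eta) * b n - eta * b n = t s * b n + eta * b n by ring.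
  by rewrite ltrDl mulr_gt0.
have h1 := pr_close P mE mY mbad same.
have h2 : `|pr P' (tail_pattern N h r k) -
    pr P (tail_pattern (fun w => eig_process (b n) (abs_entries X n w)) h r k)| <= e / 2.
  by near: n.
move: (le_trans h1 prbad) h2; rewrite !ler_norml => /andP[a1 a2] /andP[a3 a4].
by apply/andP; split; lra.
Unshelve. all: by end_near.
Qed.

End Transfer.

Lemma eig_process_le_size (R : realType) (b : R) (l : seq R) (B : set (measurableTypeR R)) :
  exists2 k, (k <= size l)%N & eig_process b l B = (k%:R)%:E.
Proof.
rewrite /eig_process /eig_measure /= /mrestr /msum.
elim: l => [|y l [k kl IH]] /=; first by exists 0%N; rewrite ?big_ord0.
rewrite big_ord_recl /= IH /atom_if_pos; case: ifPn => y0.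
  rewrite /= diracE -EFinD -natrD; eexists; last by [].
  by case: (_ \in _); rewrite //= leqW.
by exists k; [exact: leqW | rewrite /= /mzero add0e].
Qed.

Section TailFunction.
Context (R : realType) (d : measure_display) (T : measurableType d) (P : probability T R).
Variables (X : T -> R) (alpha : R) (L : R -> R).
Hypothesis mX : measurable_fun setT X.
Hypotheses (alpha0 : 0 < alpha) (hL : slowly_varying L).
Hypothesis htail : forall x : R, 0 < x -> 1 - abs_cdf P X x = L x * x `^ (- alpha).

Definition tailf x : R := 1 - abs_cdf P X x.

Let measurable_le x : measurable [set w | `|X w| <= x].
Proof.
rewrite (_ : [set w | _] = ~` [set w | x < `|X w|]); first by apply: measurableC; exact: measurable_gt.
by apply/seteqP; split => w /=; rewrite leNgt => /negP.
Qed.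

Lemma tailfE x : tailf x = pr P [set w | x < `|X w|].
Proof.
rewrite (_ : [set w | x < `|X w|] = ~` [set w | `|X w| <= x]) ?prC//.
by apply/seteqP; split => w /=; rewrite ltNge => /negP.
Qed.

Lemma tailf_mono x y : x <= y -> tailf y <= tailf x.
Proof.
move=> xy; rewrite !tailfE; apply: le_pr; [exact: measurable_gt|exact: measurable_gt|].
by move=> w /=; exact: le_lt_trans.
Qed.

Lemma tailf_le1 x : tailf x <= 1.
Proof. by rewrite tailfE pr_le1//; exact: measurable_gt. Qed.

(** If the tail vanished somewhere, [L] would vanish at all large arguments, and [L (2 * x) / L x]
    would be 0, division by 0 giving 0, against its limit 1. *)
Lemma tailf_gt0 x : 0 < tailf x.
Proof.
have t0 y : 0 <= tailf y by rewrite tailfE pr_ge0.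
rewrite lt_neqAle t0 andbT eq_sym; apply/negP => /eqP Gx0.
have h2 : 0 < 2 :> R by [].
have := cvgr_gt _ (hL h2) _ (ltr01 : 0 < (1 : R)) => -[M [_ hM]].
pose y := Num.max (Num.max x 1) (M + 1).
have y0 : 0 < y by rewrite !lt_max ltr01 orbT.
have My : M < y by rewrite lt_max; apply/orP; right; rewrite ltrDl.
have Gy : tailf y = 0.
  by apply/eqP; rewrite eq_le t0 andbT -Gx0; apply: tailf_mono; rewrite !le_max lexx.
have Ly : L y = 0.
  move: Gy; rewrite /tailf htail// => /eqP; rewrite mulf_eq0 [X in _ || X]gt_eqF ?powR_gt0// orbF.
  by move/eqP.
by have := hM y My; rewrite Ly invr0 mulr0 ltxx.
Qed.

Lemma tailf_var (t : R) : 0 < t -> tailf (t * x) / tailf x @[x --> +oo] --> t `^ (- alpha).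
Proof.
move=> t0; rewrite -[X in _ --> (X : R)]mul1r.
have : L (t * x) / L x * t `^ (- alpha) @[x --> +oo] --> 1 * t `^ (- alpha).
  by apply: cvgMl; exact: hL.
apply: cvg_trans; apply: near_eq_cvg; near=> x.
have x0 : 0 < x by near: x; exact: nbhs_pinfty_gt.
have Gx : tailf x = L x * x `^ (- alpha) by exact: htail.
have Gtx : tailf (t * x) = L (t * x) * (t * x) `^ (- alpha) by apply: htail; exact: mulr_gt0.
have GL := tailf_gt0 x; rewrite Gx in GL; rewrite Gx Gtx.
have Lx : L x != 0 by apply/eqP => L0; move: GL; rewrite L0 mul0r ltxx.
rewrite powRM ?(ltW t0) ?(ltW x0)//; field.
by rewrite Lx gt_eqF// powR_gt0.
Unshelve. all: by end_near.
Qed.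

Lemma tailf_neg x : x < 0 -> tailf x = 1.
Proof.
move=> x0; rewrite tailfE (_ : [set w | _] = setT) ?/pr ?probability_setT//.
by apply/seteqP; split => w //= _; exact: lt_le_trans x0 _.
Qed.

Local Notation b := (normalization (abs_cdf P X)).

Let S n := [set x : R | 1 - abs_cdf P X x <= 2 / (n * n.+1)%:R].

(** Protects [inf] from its default value on the empty set: by [tail_upper] the tail falls below
    every positive level. *)
Let S_neq0 n : (0 < n)%N -> S n !=set0.
Proof.
move=> n0; have a2 : 0 < alpha / 2 by rewrite divr_gt0.
have [C [x0 [C0 x01 GC]]] := tail_upper tailf_gt0 tailf_le1 tailf_var a2.
have e0 : 0 < 2 / (n * n.+1)%:R :> R by rewrite divr_gt0// ltr0n muln_gt0 n0.
have a2' : 0 < alpha - alpha / 2 by lra.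
have [n1 _ h1] := cvgr_lt _ (powR_natN_cvg0 C a2') _ e0.
exists (n1 + (Num.truncn x0).+1)%:R; rewrite /S /=.
apply: le_trans (GC _ _) _; last by apply/ltW/h1; rewrite /= leq_addr.
by apply: ltW; apply: lt_le_trans (truncnS_gt _) _; rewrite ler_nat leq_addl.
Qed.

(* For [n = 1] the set is the whole line, whose [inf] is 0 by convention. *)
Lemma normalization_lt n x : (1 < n)%N -> x < b n -> ((n * n.+1)%:R / 2)^-1 < tailf x.
Proof.
move=> n1; rewrite ltNge => /negP xb; rewrite ltNge; apply/negP; rewrite invf_div => Gx.
apply: xb; apply: ge_inf => //; exists 0 => y; rewrite /= -/(tailf y) leNgt => Gy.
rewrite leNgt; apply/negP => /tailf_neg G1; apply: negP Gy _; rewrite G1 ltr_pdivrMr ?mul1r.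
  by rewrite ltr_nat; case: n n1 {Gx} => [|[|n]]// _; rewrite mulnC; nia.
by rewrite ltr0n muln_gt0 (ltnW n1).
Qed.

Lemma normalization_gt n x : (0 < n)%N -> b n < x -> tailf x <= ((n * n.+1)%:R / 2)^-1.
Proof.
move=> n0 /(inf_lt (S_neq0 n0))[y Sy yx]; rewrite invf_div.
by apply: le_trans Sy; apply: tailf_mono; exact: ltW.
Qed.

End TailFunction.

Lemma iid_expectation (R : realType) (d : measure_display) (T : measurableType d)
    (P : probability T R) (X Y : T -> R) (g : R -> R) :
  measurable_fun setT X -> measurable_fun setT Y ->
  (forall B : set R, measurable B -> P (X @^-1` B) = P (Y @^-1` B)) ->
  measurable_fun setT g -> (exists M : R, forall x, `|g x| <= M) ->
  Ex P (fun w => g (X w)) = Ex P (fun w => g (Y w)).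
Proof.
move=> mX mY XY mg gM.
have b1 : bmeas (fun _ : T => 1 : R) by exact: bmeas_cst.
have := @Ex_transfer _ _ _ P X Y _ 1 g mX mY b1 _ mg gM.
rewrite mul1r => <- //; first by apply: eq_Ex => w; rewrite mulr1.
move=> B mB; rewrite mul1r.
have indicE (Z : T -> R) : measurable_fun setT Z -> Ex P (fun w => \1_B (Z w)) = pr P (Z @^-1` B).
  move=> mZ; rewrite -Ex_indic//; last by rewrite -[X in measurable X]setTI; exact: mZ.
rewrite (indicE _ mY) /pr -XY// -/(pr P _) -(indicE _ mX).
by apply: eq_Ex => w; rewrite mulr1.
Qed.

Theorem theorem1 (R : realType)
  (d : measure_display) (T : measurableType d) (P : probability T R)
  (alpha : R) (halpha : 0 < alpha < 4)
  (a : nat -> nat -> {RV P >-> R}) (ha : iid_upper a)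
  (L : R -> R) (hL : slowly_varying L)
  (htail : forall x : R, 0 < x ->
     1 - abs_cdf P (a 0%N 0%N) x = L x * x `^ (- alpha))
  (hmean : 2 <= alpha -> forall i j : nat, (i <= j)%N ->
     ('E_P[a i j] = 0)%E)
  (lambda : forall n : nat, T -> n.-tuple R)
  (hlambda : forall (n : nat) (w : T),
     ordered_eigenvalues (sym_mx a n w) (lambda n w))
  (d' : measure_display) (T' : measurableType d') (P' : probability T' R)
  (N : T' -> pointMeasure R)
  (hN : Poisson_point_process P' N (fun x : R => alpha / x `^ (1 + alpha))) :
  converges_in_distribution P
    (fun (n : nat) (w : T) =>
       eig_process (normalization (abs_cdf P (a 0%N 0%N)) n) (lambda n w))
    P' N.
Proof.
have [alpha0 alpha4] := andP halpha; have [indep ident] := ha.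
pose X (p : nat * nat) : T -> R := a p.1 p.2.
have mX p : measurable_fun setT (X p) by exact: measurable_funPT.
pose G := tailf P (X (0%N, 0%N)); pose b := normalization (abs_cdf P (X (0%N, 0%N))).
have mX0 := mX (0%N, 0%N).
have law p (B : set R) : (p.1 <= p.2)%N -> measurable B ->
    P (X p @^-1` B) = P (X (0%N, 0%N) @^-1` B).
  by move=> pp mB; exact: (ident p.1 p.2 pp B mB).
have XG p (x : R) : (p.1 <= p.2)%N -> pr P [set w | x < `|X p w|] = G x.
  move=> pp; rewrite /G tailfE//.
  have mB : measurable [set y : R | x < `|y|] by apply: (measurable_gt (X := id)).
  by congr fine; exact: law pp mB.
have Xid p (g : R -> R) : (p.1 <= p.2)%N -> measurable_fun setT g ->
    (exists M : R, forall x, `|g x| <= M) ->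
    Ex P (fun w => g (X p w)) = Ex P (fun w => g (X (0%N, 0%N) w)).
  by move=> pp; apply: iid_expectation => // B mB; exact: law.
have Gmono (x y : R) : x <= y -> G y <= G x by exact: tailf_mono.
have Gpos (x : R) : 0 < G x by exact: (tailf_gt0 mX0 hL htail).
have Gle1 (x : R) : G x <= 1 by exact: tailf_le1.
have Gvar (t : R) : 0 < t -> G (t * x) / G x @[x --> +oo] --> t `^ (- alpha).
  exact: (tailf_var mX0 hL htail).
have b_lt n x : (1 < n)%N -> x < b n -> ((n * n.+1)%:R / 2)^-1 < G x.
  exact: normalization_lt.
have b_gt n x : (0 < n)%N -> b n < x -> G x <= ((n * n.+1)%:R / 2)^-1.
  exact: (normalization_gt mX0 alpha0 hL htail).
have tailG delta : 0 < delta -> exists C x0, [/\ 0 < C, 1 <= x0 &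
    forall x, x0 <= x -> G x <= C * x `^ (- (alpha - delta))].
  by move=> delta0; exact: tail_upper.
have b_pow beta : 0 < beta -> beta < 2 / alpha ->
    exists n0 : nat, forall n, (n0 <= n)%N -> n%:R `^ beta <= b n.
  by move=> h1 h2; exact: (b_ge_pow alpha0 Gmono Gpos Gvar b_gt h1 h2).
have b_pos : \forall n \near \oo, 0 < b n.
  have [n0 h] := b_cvgy alpha0 Gmono Gpos Gvar b_gt 1.
  by exists n0 => // n /= /h; exact: lt_le_trans.
have scaled_tail x : 0 < x -> (n * n.+1)%:R / 2 * G (x * b n) @[n --> \oo] --> x `^ (- alpha).
  by move=> x0; exact: (tail_cvg alpha0 Gmono Gpos Gvar b_lt b_gt x0).
have centered : 2 <= alpha -> ('E_P[X (0%N, 0%N)] = 0)%E by move=> /hmean; exact.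
have hlam n w : ordered_eigenvalues (entries_mx X n w) (lambda n w) by exact: hlambda.
have kap1 : 0 < 1 / 100 :> R by rewrite divr_gt0.
(* [crowded] and [small_whp] depend on [trunc], which does not involve [kap], so each estimate can
   take its own value of [kap]. *)
have crowded0 : pr P (crowded X alpha b n) @[n --> \oo] --> 0.
  exact: (pr_crowded_cvg0 mX indep XG alpha0 tailG b_pow kap1).
have small eta del : 0 < eta -> 0 < del -> \forall n \near \oo, small_whp P X alpha b eta del n.
  move=> eta0 del0; have [a2|a2] := ltP alpha 2.
    pose kap := Num.min (1 / 100) ((2 - alpha) / (16 * alpha)).
    have kap0 : 0 < kap by rewrite lt_min kap1 divr_gt0 ?subr_gt0// mulr_gt0.
    have kap100 : kap <= 1 / 100 by rewrite ge_min lexx.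
    have kap2 : 16 * alpha * kap <= 2 - alpha.
      by rewrite mulrC -ler_pdivlMr ?mulr_gt0// ge_min lexx orbT.
    exact: (small_part_lt2 mX XG Xid alpha0 tailG b_pow kap0 kap100 a2 kap2 eta0 del0).
  pose kap := Num.min (1 / 100) ((4 - alpha) / 16).
  have kap0 : 0 < kap by rewrite lt_min kap1 divr_gt0 ?subr_gt0.
  have kap100 : kap <= 1 / 100 by rewrite ge_min lexx.
  have kap4 : 16 * kap <= 4 - alpha.
    by rewrite mulrC -ler_pdivlMr// ge_min lexx orbT.
  exact: (small_part_ge2 mX indep XG Xid alpha0 tailG b_pow centered kap0 kap100 a2 kap4 eta0 del0).
have ecv (h : R) r k : 0 < h ->
    pr P (tail_pattern (fun w => eig_process (b n) (abs_entries X n w)) h r k) @[n --> \oo] -->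
    pr P' (tail_pattern N h r k).
  exact: (entries_pattern_cvg mX indep XG alpha0 b_pos scaled_tail hN).
apply: convergence_criterion.
- by move=> n; exact: (point_process_eigenvalues mX hlam (b n) n).
- by case: hN.
- move=> n w x x0; have [k kl ->] := eig_process_le_size (b n) (lambda n w) (ray x).
  by exists k => //; rewrite size_tuple in kl.
- by move=> x e; exact: (poisson_tail_bad alpha0 hN).
- by move=> e; exact: (poisson_top_bad alpha0 hN).
- by move=> h r k h0; exact: (eigen_pattern_cvg mX XG alpha0 b_pos scaled_tail ecv crowded0 small hlam h0).
Qed.
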